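(* Let $\hbar_0,\vartheta_0,B_0$ be real numbers with $\hbar_0\neq0$, $\vartheta_0\neq0$, $B_0\neq0$, $\hbar_0-\vartheta_0B_0\neq0$, and let $r\in\mathbb R\setminus\{\hbar_0/(\vartheta_0B_0)\}$, $s\in\mathbb R$. The spectral values of the self-adjoint operator $D^{r,s}_{\hbar_0,\vartheta_0,B_0}$ on $L^2(\mathbb R^2)\otimes\mathbb C^2$ are $\{0\}\cup\{\pm\sqrt n:n\in\mathbb N\}$, and each of these spectral values has infinite multiplicity (i.e. is an eigenvalue with infinite-dimensional eigenspace). In particular, $D^{r,s}_{\hbar_0,\vartheta_0,B_0}$ does not have compact resolvent.
   Context: With $p_x=-i\hbar_0\partial_x$, $p_y=-i\hbar_0\partial_y$ on $\mathcal S(\mathbb R^2)$, put $$\Pi^{r,s}_x=\tfrac{(1-r)\hbar_0B_0}{\hbar_0-r\vartheta_0B_0}\,y+\tfrac{(r+s-rs)\vartheta_0B_0-\hbar_0}{r\vartheta_0B_0-\hbar_0}\,p_x,\qquad \Pi^{r,s}_y=-rB_0\,x+\bigl[1+r(s-1)\tfrac{\vartheta_0B_0}{\hbar_0}\bigr]p_y,$$ $\widetilde\Pi^{r,s}_x=|\hbar_0B_0|^{-1/2}\,\Pi^{r,s}_x$, $\widetilde\Pi^{r,s}_y=\operatorname{sgn}(\hbar_0B_0)|\hbar_0B_0|^{-1/2}\,\Pi^{r,s}_y$, so that $[\widetilde\Pi^{r,s}_x,\widetilde\Pi^{r,s}_y]=i\mathbb I$ on $\mathcal S(\mathbb R^2)$.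 The Dirac operator $D^{r,s}_{\hbar_0,\vartheta_0,B_0}$ is the (self-adjoint) closure of $\frac1{\sqrt2}(\widetilde\Pi^{r,s}_x\otimes\sigma^x+\widetilde\Pi^{r,s}_y\otimes\sigma^y)$ defined on $\mathcal S(\mathbb R^2)\otimes\mathbb C^2$, with $\sigma^x=\begin{pmatrix}0&1\\1&0\end{pmatrix}$, $\sigma^y=\begin{pmatrix}0&-i\\i&0\end{pmatrix}$. Here $\mathbb N=\{1,2,\dots\}$. *)

(* Defs.v *)
From HB Require Import structures.
From mathcomp Require Import all_boot all_order all_algebra.
From mathcomp Require Import all_classical all_reals all_analysis.
From mathcomp Require Import complex.

Set Implicit Arguments.
Unset Strict Implicit.
Unset Printing Implicit Defensive.

Import Order.TTheory GRing.Theory Num.Theory.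
Import numFieldNormedType.Exports.

Local Open Scope classical_set_scope.
Local Open Scope ring_scope.
Local Open Scope complex_scope.

(* The Hilbert space L^2(R^2) (x) C^2 is handled through representatives:      *)
(* a vector is a function R^2 -> C^2, and two functions are identified when    *)
(* they agree Lebesgue-almost everywhere, i.e. when the L^2 norm of their      *)
(* difference is 0. An unbounded operator is given by its graph, as a relation *)
(* u |-> v between such functions.                                             *)

Section Spinors.
Context {R : realType}.

Definition scalar_field := R * R -> R[i].
Definition spinor := R * R -> 'cV[R[i]]_2.

Definition lebesgue2 :
    {measure set (measurableTypeR R * measurableTypeR R)%type -> \bar R} :=
  (@lebesgue_measure R \x @lebesgue_measure R)%E.

Definition component (k : 'I_2) (psi : spinor) : scalar_field :=
  fun z => psi z k 0.

Definition L2 (psi : spinor) : Prop :=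
  forall k, (fun z => complex.Re (component k psi z)) \in Lfun lebesgue2 2%:E
         /\ (fun z => complex.Im (component k psi z)) \in Lfun lebesgue2 2%:E.

Definition spinor_abs (c : 'cV[R[i]]_2) : R :=
  Num.sqrt (\sum_k ((complex.Re (c k 0)) ^+ 2 + (complex.Im (c k 0)) ^+ 2)).

Definition L2norm (psi : spinor) : \bar R :=
  ('N[lebesgue2]_(2%:E) [EFin \o (spinor_abs \o psi)])%E.

(* antilinear in the first argument *)
Definition inner (phi psi : spinor) : R[i] :=
  let h z := \sum_k (component k phi z)^*%C * component k psi z in
  (\int[lebesgue2]_z complex.Re (h z)) +i* (\int[lebesgue2]_z complex.Im (h z)).

Definition L2_cvg (psi : nat -> spinor) (phi : spinor) : Prop :=
  (fun n => L2norm (psi n - phi)) @ \oo --> 0%E.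

End Spinors.
Arguments spinor : clear implicits.
Arguments scalar_field : clear implicits.

Section Operators.
Context {R : realType}.
Implicit Types (A T : spinor R -> spinor R -> Prop) (l : R[i]).

Definition op_closure A : spinor R -> spinor R -> Prop :=
  fun u v => [/\ L2 u, L2 v & exists f g : nat -> spinor R,
    [/\ forall n, A (f n) (g n), L2_cvg f u & L2_cvg g v]].

Definition densely_defined A : Prop :=
  forall u, L2 u -> exists f g : nat -> spinor R,
    (forall n, A (f n) (g n)) /\ L2_cvg f u.

Definition op_adjoint A : spinor R -> spinor R -> Prop :=
  fun u v => [/\ L2 u, L2 v & forall f g, A f g -> inner g u = inner f v].

Definition self_adjoint A : Prop :=
  densely_defined A /\ forall u v, A u v <-> op_adjoint A u v.

(* the graph of (A - l)^-1 *)
Definition op_resolvent A l : spinor R -> spinor R -> Prop :=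
  fun v u => A u (v + l *: u).

(* l is in the op_resolvent set when (A - l)^-1 is everywhere defined on L^2 and  *)
(* bounded; for a linear A the bound also gives the injectivity of A - l.      *)
Definition op_resolvent_set A : set R[i] := [set l |
  (forall v, L2 v -> exists u, op_resolvent A l v u) /\
  exists M : R, forall v u, op_resolvent A l v u -> (L2norm u <= M%:E * L2norm v)%E].

Definition op_spectrum A : set R[i] := ~` op_resolvent_set A.

Definition op_eigenspace A l : set (spinor R) := [set u | A u (l *: u)].

(* linear independence is that of the classes modulo a.e. equality *)
Definition infinite_dimensional (V : set (spinor R)) : Prop :=
  forall N : nat, exists e : 'I_N -> spinor R,
    (forall i, V (e i)) /\
    forall c : 'I_N -> R[i],
      {ae lebesgue2, forall z, \sum_i c i *: e i z = 0} ->
      forall i, c i = 0.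

Definition compact_operator T : Prop :=
  forall v u : nat -> spinor R,
    (forall n, T (v n) (u n)) ->
    (exists M : R, forall n, (L2norm (v n) <= M%:E)%E) ->
    exists (k : nat -> nat) (w : spinor R),
      [/\ {homo k : m n / (m < n)%N}, L2 w & L2_cvg (u \o k) w].

Definition has_compact_resolvent A : Prop :=
  exists2 l, op_resolvent_set A l & compact_operator (op_resolvent A l).

End Operators.

Section Schwartz.
Context {R : realType}.

Definition dir (b : bool) : R * R := if b then (0, 1) else (1, 0).

Definition iter_partial (w : seq bool) (f : R * R -> R) : R * R -> R :=
  foldr (fun b g => 'D_(dir b) g) f w.

Definition real_schwartz (f : R * R -> R) : Prop :=
  forall w : seq bool,
    (forall z, differentiable (iter_partial w f) z) /\
    forall a b : nat, exists M : R, forall z : R * R,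
      `|z.1 ^+ a * z.2 ^+ b * iter_partial w f z| <= M.

Definition schwartz (f : scalar_field R) : Prop :=
  real_schwartz (fun z => complex.Re (f z)) /\ real_schwartz (fun z => complex.Im (f z)).

Definition schwartz_spinor (psi : spinor R) : Prop :=
  forall k, schwartz (component k psi).

End Schwartz.

Section Dirac.
Context {R : realType}.

Definition cpartial (b : bool) (f : scalar_field R) : scalar_field R := fun z =>
  'D_(dir b) (fun z' => complex.Re (f z')) z +i* 'D_(dir b) (fun z' => complex.Im (f z')) z.

Definition p_x (hbar : R) (f : scalar_field R) : scalar_field R :=
  fun z => - 'i%C * hbar%:C * cpartial false f z.

Definition p_y (hbar : R) (f : scalar_field R) : scalar_field R :=
  fun z => - 'i%C * hbar%:C * cpartial true f z.

Definition Pi_x (hbar theta B r s : R) (f : scalar_field R) : scalar_field R :=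
  fun z => ((1 - r) * hbar * B / (hbar - r * theta * B) * z.2)%:C * f z
    + (((r + s - r * s) * theta * B - hbar) / (r * theta * B - hbar))%:C
      * p_x hbar f z.

Definition Pi_y (hbar theta B r s : R) (f : scalar_field R) : scalar_field R :=
  fun z => (- r * B * z.1)%:C * f z
    + (1 + r * (s - 1) * (theta * B / hbar))%:C * p_y hbar f z.

Definition tPi_x (hbar theta B r s : R) (f : scalar_field R) : scalar_field R :=
  fun z => ((Num.sqrt `|hbar * B|)^-1)%:C * Pi_x hbar theta B r s f z.

Definition tPi_y (hbar theta B r s : R) (f : scalar_field R) : scalar_field R :=
  fun z => (Num.sg (hbar * B) * (Num.sqrt `|hbar * B|)^-1)%:C
    * Pi_y hbar theta B r s f z.

Definition sigma_x : 'M[R[i]]_2 :=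
  \matrix_(j, k) (if j == k then 0 else 1).

Definition sigma_y : 'M[R[i]]_2 :=
  \matrix_(j, k) (if j == k then 0 else if j == 0 then - 'i%C else 'i%C).

(* (T (x) S) psi = S applied pointwise to T psi, T acting on each component *)
Definition op_tensor (T : scalar_field R -> scalar_field R) (S : 'M[R[i]]_2)
    (psi : spinor R) : spinor R :=
  fun z => S *m \col_k T (component k psi) z.

Definition dirac_expr (hbar theta B r s : R) (psi : spinor R) : spinor R :=
  ((Num.sqrt 2)^-1)%:C *: (op_tensor (tPi_x hbar theta B r s) sigma_x psi
                           + op_tensor (tPi_y hbar theta B r s) sigma_y psi).

Definition dirac_core (hbar theta B r s : R) : spinor R -> spinor R -> Prop :=
  fun psi phi => schwartz_spinor psi /\ phi = dirac_expr hbar theta B r s psi.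

Definition dirac_op (hbar theta B r s : R) : spinor R -> spinor R -> Prop :=
  op_closure (dirac_core hbar theta B r s).

End Dirac.

(* Main.v *)
(* Up to the scalars of the definition, the Dirac operator is D = [[0, A'], [A, 0]]
   with A = (X + iY)/sqrt 2, A' = (X - iY)/sqrt 2 and X = a y - i b d/dx,
   Y = c x - i d d/dy, where a d - b c = 1. The operators X' = a x - i b d/dy and
   Y' = c y - i d d/dx commute with X and Y and satisfy the same commutation
   relation, so their ladder operators B, B' produce the degeneracy of the spectrum.
   A chirped Gaussian psi0 = exp(-p (x^2+y^2)/2 - i q x y) is killed by A and B, and the
   functions psi_(m,n) = A'^m B'^n psi0 are orthogonal. The spinors (psi_(0,n), 0) and
   (psi_(m,n), +- sqrt m psi_(m-1,n)), m >= 1, are eigenvectors of D for 0 and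
   +- sqrt m. As x and y are combinations of A, A', B, B', the psi_(m,n) span all
   (polynomial) * psi0, which is dense: a function F in L^2 whose moments against the
   Gaussian vanish satisfies int F exp(..) (trigonometric polynomial) = 0, and bounded
   pointwise limits of trigonometric polynomials give int_Q F exp(..) = 0 for all
   quadrants Q. An orthonormal basis of eigenvectors in the core diagonalises the
   closure, from which everything is read off. *)
Require Import Defs.
From HB Require Import structures.
From mathcomp Require Import all_boot all_order all_algebra.
From mathcomp Require Import all_classical all_reals all_analysis.
From mathcomp Require Import measurable_realfun complex.
From mathcomp Require Import ring lra zify.
Set Implicit Arguments.
Unset Strict Implicit.
Unset Printing Implicit Defensive.
Import Order.TTheory GRing.Theory Num.Theory.
Import numFieldNormedType.Exports.
Import Normc.
Local Open Scope classical_set_scope.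
Local Open Scope ring_scope.
Local Open Scope complex_scope.

(** * Diagonal operators on a Hilbert space *)

Section ComplexFacts.
Context {R : rcfType}.
Implicit Types z w : R[i].

(** Vectors are functions rather than classes, so the norm is only a seminorm: uniqueness always
    reads that a difference has norm 0, and Hilbert space theory is developed for a complete,
    possibly degenerate inner product on a predicate. No spectral theorem is invoked. In an
    orthonormal basis of eigenvectors taken from the core, membership of [(u, v)] in the closure
    means that the coefficients of [v] are the eigenvalues times those of [u]; adjoint and resolvent
    become questions about sequences. All parameters enter through a, b, c, d, and a d - b c = 1 is
    the only relation used between them, so degenerate values such as b = 0 are not special. The
    operators X', Y' are X, Y with x and y exchanged, and psi0 is invariant under this exchange;
    this is why one Gaussian is killed by both lowering operators. The density proof replaces the
    Fourier transform by exponential moments: an L^2 function times a Gaussian integrates every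
    exp(a |x| + b |y|), which dominates the Taylor series of cosines and sines. *)

Lemma ReD z w : complex.Re (z + w) = complex.Re z + complex.Re w.
Proof. by case: z => a b; case: w. Qed.

Lemma ReN z : complex.Re (- z) = - complex.Re z.
Proof. by case: z. Qed.

Lemma Re_conj z : complex.Re z^*%C = complex.Re z.
Proof. by case: z. Qed.

Lemma ImD z w : complex.Im (z + w) = complex.Im z + complex.Im w.
Proof. by case: z => a b; case: w. Qed.

Lemma ImN z : complex.Im (- z) = - complex.Im z.
Proof. by case: z. Qed.

Lemma normc_sqr z : normc z ^+ 2 = complex.Re z ^+ 2 + complex.Im z ^+ 2.
Proof. by case: z => a b /=; rewrite sqr_sqrtr // addr_ge0 // sqr_ge0. Qed.

Lemma normc_conjM z : z^*%C * z = (normc z ^+ 2)%:C.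
Proof.
rewrite normc_sqr; case: z => a b; apply/eqP; rewrite eq_complex /=.
by apply/andP; split; apply/eqP; ring.
Qed.

Lemma normc_ge0 z : 0 <= normc z.
Proof. by case: z => a b; rewrite sqrtr_ge0. Qed.

Lemma normc_conj z : normc z^*%C = normc z.
Proof. by case: z => a b /=; rewrite sqrrN. Qed.

Lemma normc_eq0 z : (normc z == 0) = (z == 0).
Proof. by apply/eqP/eqP => [/eq0_normc|->] //=; rewrite expr0n addr0 sqrtr0. Qed.

Lemma normc_real (a : R) : normc a%:C = `|a|.
Proof. by rewrite /= expr0n addr0 sqrtr_sqr. Qed.

Lemma conjc_rmul (a : R) z : (a%:C * z)^*%C = a%:C * z^*%C.
Proof. by case: z => c d /=; congr (_ +i* _); ring. Qed.

Lemma ReZ (a : R) z : complex.Re (a%:C * z) = a * complex.Re z.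
Proof. by case: z => c d /=; rewrite mul0r subr0. Qed.

End ComplexFacts.

Section InnerProduct.
Context (R : realType) (V : lmodType R[i]) (P : V -> Prop) (ip : V -> V -> R[i]).

Definition ip_norm (x : V) : R := Num.sqrt (complex.Re (ip x x)).

(** The laws hold on [P] only, and [ip x x] may vanish for nonzero [x], as it does for functions
    that are 0 almost everywhere. The limit in [hilbert_complete] is unique only up to [ip_norm]
    0. *)
Record hilbert : Prop := Hilbert {
  hilbert0 : P 0;
  hilbertD : forall x y, P x -> P y -> P (x + y);
  hilbertZ : forall a x, P x -> P (a *: x);
  ipDr : forall x y z, P x -> P y -> P z -> ip x (y + z) = ip x y + ip x z;
  ipZr : forall a x y, P x -> P y -> ip x (a *: y) = a * ip x y;
  ipJ : forall x y, P x -> P y -> ip y x = (ip x y)^*%C;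
  ip_ge0 : forall x, P x -> 0 <= complex.Re (ip x x);
  hilbert_complete : forall u : nat -> V, (forall n, P (u n)) ->
    (forall e, 0 < e -> exists N, forall m n, (N <= m)%N -> (N <= n)%N ->
       ip_norm (u m - u n) < e) ->
    exists2 w, P w & ip_norm (u n - w) @[n --> \oo] --> 0 }.

Hypothesis hP : hilbert.
Hint Resolve hilbert0 hilbertD hilbertZ : core.

Lemma hilbertN x : P x -> P (- x).
Proof. by move=> Px; rewrite -scaleN1r; exact: hilbertZ. Qed.

Lemma hilbertB x y : P x -> P y -> P (x - y).
Proof. by move=> Px Py; apply: hilbertD => //; exact: hilbertN. Qed.

Lemma hilbert_sum n (f : nat -> V) :
  (forall i, P (f i)) -> P (\sum_(i < n) f i).
Proof.
move=> Pf; elim: n => [|n IH]; first by rewrite big_ord0; exact: hilbert0.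
by rewrite big_ord_recr /=; exact: hilbertD.
Qed.

Lemma ipNr x y : P x -> P y -> ip x (- y) = - ip x y.
Proof. by move=> Px Py; rewrite -scaleN1r ipZr // mulN1r. Qed.

Lemma ipBr x y z : P x -> P y -> P z -> ip x (y - z) = ip x y - ip x z.
Proof. by move=> Px Py Pz; rewrite ipDr ?ipNr //; exact: hilbertN. Qed.

Lemma ip0r x : P x -> ip x 0 = 0.
Proof. by move=> Px; rewrite -(scale0r 0) ipZr ?mul0r //; exact: hilbert0. Qed.

Lemma ipDl x y z : P x -> P y -> P z -> ip (x + y) z = ip x z + ip y z.
Proof.
move=> Px Py Pz; have Pxy := hilbertD hP Px Py.
by rewrite (ipJ hP Pz Pxy) ipDr // rmorphD /= -!(ipJ hP).
Qed.

Lemma ipZl a x z : P x -> P z -> ip (a *: x) z = a^*%C * ip x z.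
Proof.
move=> Px Pz; have Pax := hilbertZ hP a Px.
by rewrite (ipJ hP Pz Pax) ipZr // rmorphM /= -(ipJ hP).
Qed.

Lemma ipNl x y : P x -> P y -> ip (- x) y = - ip x y.
Proof. by move=> Px Py; rewrite -scaleN1r ipZl // rmorphN rmorph1 mulN1r. Qed.

Lemma ipBl x y z : P x -> P y -> P z -> ip (x - y) z = ip x z - ip y z.
Proof. by move=> Px Py Pz; rewrite ipDl ?ipNl //; exact: hilbertN. Qed.

Lemma ip0l x : P x -> ip 0 x = 0.
Proof. by move=> Px; rewrite -(scale0r 0) ipZl ?rmorph0 ?mul0r //; exact: hilbert0. Qed.

Lemma ip_norm_ge0 x : 0 <= ip_norm x.
Proof. exact: sqrtr_ge0. Qed.

Lemma ip_norm_sqr x : P x -> ip_norm x ^+ 2 = complex.Re (ip x x).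
Proof. by move=> Px; rewrite sqr_sqrtr // ip_ge0. Qed.

Lemma ipxx x : P x -> ip x x = (ip_norm x ^+ 2)%:C.
Proof.
move=> Px; rewrite ip_norm_sqr //.
have := ipJ hP Px Px; case: (ip x x) => a b [/= bN].
by congr (_ +i* _); lra.
Qed.

Lemma ip_normZ a x : P x -> ip_norm (a *: x) = normc a * ip_norm x.
Proof.
move=> Px; apply/eqP; rewrite -(@eqrXn2 _ 2) ?mulr_ge0 ?normc_ge0 ?ip_norm_ge0 //.
rewrite exprMn !ip_norm_sqr //; last exact: hilbertZ.
rewrite ipZr ?ipZl //; last exact: hilbertZ.
by rewrite mulrA mulrC (mulrC a) normc_conjM mulrC ReZ.
Qed.

Lemma ip_normN x : P x -> ip_norm (- x) = ip_norm x.
Proof. by move=> Px; rewrite -scaleN1r ip_normZ // normcN normc1 mul1r. Qed.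

Lemma ip_norm_distC x y : P x -> P y -> ip_norm (x - y) = ip_norm (y - x).
Proof. by move=> Px Py; rewrite -opprB ip_normN //; exact: hilbertB. Qed.

Lemma ip_norm0 : ip_norm 0 = 0.
Proof. by rewrite /ip_norm ip0r ?sqrtr0 //; exact: hilbert0. Qed.

Lemma ip_norm_sqrD x y : P x -> P y ->
  ip_norm (x + y) ^+ 2 = ip_norm x ^+ 2 + 2 * complex.Re (ip x y) + ip_norm y ^+ 2.
Proof.
move=> Px Py; have Pxy := hilbertD hP Px Py.
rewrite !ip_norm_sqr // ipDr // !ipDl // !ReD (ipJ hP Px Py) Re_conj.
by ring.
Qed.

Lemma cauchy_schwarz x y : P x -> P y -> normc (ip x y) <= ip_norm x * ip_norm y.
Proof.
move=> Px Py.
rewrite -(@ler_pXn2r _ 2) ?nnegrE ?mulr_ge0 ?normc_ge0 ?ip_norm_ge0 //.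
set w := ip x y; set N := normc w ^+ 2.
have N0 : 0 <= N by rewrite sqr_ge0.
(* The squared norm of [x - s * conj w * y], a quadratic in the real number [s]. *)
have main (s : R) : 0 <= ip_norm x ^+ 2 - 2 * s * N + s ^+ 2 * N * ip_norm y ^+ 2.
  have Pz : P ((- (s%:C * w^*%C)) *: y) by exact: hilbertZ.
  have := sqr_ge0 (ip_norm (x + (- (s%:C * w^*%C)) *: y)).
  rewrite ip_norm_sqrD // ip_normZ // ipZr // -/w exprMn.
  rewrite normcN normcM normc_real normc_conj exprMn real_normK ?num_real // -/N.
  by rewrite mulNr -[s%:C * _ * _]mulrA normc_conjM -/N ReN ReZ /=; lra.
rewrite exprMn; set X := ip_norm x ^+ 2 in main *; set Y := ip_norm y ^+ 2 in main *.
have Y0 : 0 <= Y by rewrite sqr_ge0.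
have [Y1|Y1] := eqVneq Y 0.
  have [->|N1] := eqVneq N 0; first by rewrite Y1 mulr0.
  (* With [Y = 0] the quadratic is affine, and at this [s] its value is [X - (X + 1) = -1]. The case
     is real, since a vector of norm 0 may be nonzero. *)
  have := main ((X + 1) / (2 * N)); rewrite Y1 mulr0 addr0.
  have -> : 2 * ((X + 1) / (2 * N)) * N = X + 1 by field.
  lra.
(* The quadratic is minimal at [s = 1 / Y]. *)
have := main Y^-1; rewrite (_ : _ + _ = X - N / Y); last by field.
by rewrite subr_ge0 ler_pdivrMr // lt_neqAle eq_sym Y1.
Qed.

Lemma ip_normD x y : P x -> P y -> ip_norm (x + y) <= ip_norm x + ip_norm y.
Proof.
move=> Px Py.
rewrite -(@ler_pXn2r _ 2) ?nnegrE ?addr_ge0 ?ip_norm_ge0 //.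
rewrite ip_norm_sqrD // sqrrD lerD2r lerD2l -[leRHS]mulr_natl ler_pM2l //.
apply: le_trans (cauchy_schwarz Px Py).
case: (ip x y) => a b /=; apply: le_trans (ler_norm a) _.
by rewrite -sqrtr_sqr ler_wsqrtr // lerDl sqr_ge0.
Qed.

Lemma ip_norm_distD x y z : P x -> P y -> P z ->
  ip_norm (x - z) <= ip_norm (x - y) + ip_norm (y - z).
Proof.
move=> Px Py Pz; rewrite -[x - z](subrKA y).
by apply: ip_normD; exact: hilbertB.
Qed.

End InnerProduct.

Section RealSequences.
Context {R : realType}.

(** Serves to show that a fixed modulus vanishes, by bounding it with a null sequence. *)
Lemma ler_cvg0 (a : R) (s : R^nat) :
  (forall n, a <= s n) -> s @ \oo --> 0 -> a <= 0.
Proof.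
move=> as_ s0; rewrite -(cvg_lim _ s0) //.
apply: limr_ge; first by apply/cvg_ex; exists 0.
by near=> n; exact: as_.
Unshelve. all: by end_near. Qed.

Lemma squeeze_cvg0 (s t : R^nat) :
  (forall n, 0 <= s n <= t n) -> t @ \oo --> 0 -> s @ \oo --> 0.
Proof.
move=> st t0; apply: (squeeze_cvgr _ (cvg_cst 0) t0).
by near=> n; exact: st.
Unshelve. all: by end_near. Qed.

End RealSequences.

(** * Expansions in an orthonormal basis *)

Section OrthonormalBasis.
Context (R : realType) (V : lmodType R[i]) (P : V -> Prop) (ip : V -> V -> R[i]).
Hypothesis hP : hilbert P ip.
Variable phi : nat -> V.
Hypothesis phiP : forall j, P (phi j).
Hypothesis phi_orth : forall i j, ip (phi i) (phi j) = (i == j)%:R.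
Hypothesis phi_total :
  forall x, P x -> (forall j, ip (phi j) x = 0) -> ip_norm ip x = 0.
Local Notation nrm := (ip_norm ip).

Definition psum (a : nat -> R[i]) n := \sum_(j < n) a j *: phi j.

Lemma psumP a n : P (psum a n).
Proof. by apply: (@hilbert_sum _ _ _ _ hP n (fun j => a j *: phi j)) => i; exact: (hilbertZ hP). Qed.

Ltac inP := repeat first [assumption | apply: phiP | apply: psumP | apply: (hilbertB hP)
  | apply: (hilbertN hP) | apply: (hilbertD hP) | apply: (hilbertZ hP) | apply: (hilbert0 hP)].

Lemma ip_psum a n i : ip (phi i) (psum a n) = if (i < n)%N then a i else 0.
Proof.
elim: n => [|n IH]; first by rewrite /psum big_ord0 (ip0r hP).
rewrite /psum big_ord_recr /= (ipDr hP) ; inP.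
rewrite IH (ipZr hP) // phi_orth ltnS.
by have [?|?|->] := ltngtP i n; rewrite ?mulr0 ?addr0 ?mulr1 ?add0r.
Qed.

Lemma psum_ip a n x : P x ->
  ip (psum a n) x = \sum_(j < n) (a j)^*%C * ip (phi j) x.
Proof.
move=> Px; elim: n => [|n IH]; first by rewrite /psum !big_ord0 (ip0l hP).
rewrite /psum !big_ord_recr /= (ipDl hP) ; inP.
by rewrite IH (ipZl hP).
Qed.

Lemma psum_psum a n m : (m <= n)%N ->
  ip (psum a m) (psum a n) = (\sum_(j < m) normc (a j) ^+ 2)%:C.
Proof.
move=> mn; rewrite psum_ip; last exact: psumP.
rewrite rmorph_sum; apply: eq_bigr => j _; rewrite ip_psum.
by rewrite (leq_trans _ mn) // normc_conjM.
Qed.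

Lemma psum_norm a n : nrm (psum a n) ^+ 2 = \sum_(j < n) normc (a j) ^+ 2.
Proof. by rewrite (ip_norm_sqr hP (psumP _ _)) psum_psum. Qed.

Lemma psum_dist a m n : (m <= n)%N -> nrm (psum a n - psum a m) ^+ 2 =
  \sum_(j < n) normc (a j) ^+ 2 - \sum_(j < m) normc (a j) ^+ 2.
Proof.
move=> mn; have [Pm Pn] := (psumP a m, psumP a n).
rewrite (ip_norm_distC hP) // (ip_norm_sqrD hP) ; inP.
rewrite (ip_normN hP) // (ipNr hP) // psum_psum // !psum_norm /=; ring.
Qed.

Lemma bessel x n : P x -> \sum_(j < n) normc (ip (phi j) x) ^+ 2 <= nrm x ^+ 2.
Proof.
move=> Px; set a := fun j => ip (phi j) x.
have Pn := psumP a n.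
have := sqr_ge0 (nrm (- psum a n + x)).
rewrite (ip_norm_sqrD hP) ; inP.
rewrite (ip_normN hP) // (ipNl hP) // psum_norm psum_ip //.
rewrite (eq_bigr (fun j : 'I_n => (normc (a j) ^+ 2)%:C)); last first.
  by move=> j _; rewrite normc_conjM.
by rewrite -rmorph_sum /=; lra.
Qed.

(** The partial sums of squares increase and are bounded, hence converge; by Pythagoras [psum a] is
    then Cauchy, and completeness provides [w]. *)
Lemma riesz_fischer (a : nat -> R[i]) (M : R) :
  (forall n, \sum_(j < n) normc (a j) ^+ 2 <= M) ->
  exists w, [/\ P w, forall j, ip (phi j) w = a j &
    nrm (psum a n - w) @[n --> \oo] --> 0].
Proof.
move=> aM; pose s n := \sum_(j < n) normc (a j) ^+ 2.
have s_cvg : cvgn s.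
  apply: nondecreasing_is_cvgn.
    apply/nondecreasing_seqP => n; rewrite /s big_ord_recr /=.
    by rewrite lerDl sqr_ge0.
  by exists M => _ [n _ <-]; exact: aM.
have [||w Pw w_lim] := hilbert_complete hP (u := psum a).
- by move=> n; exact: psumP.
- move=> e e0.
  (* Two partial sums within [e ^ 2 / 2] of the limit differ by less than [e ^ 2], which controls a
     squared distance. *)
  have /cvgrPdist_lt/(_ (e ^+ 2 / 2)) := s_cvg; rewrite divr_gt0 ?exprn_gt0 //.
  move=> /(_ isT) [N _ sN]; exists N.
  have main m n : (N <= m)%N -> (m <= n)%N -> nrm (psum a n - psum a m) < e.
    move=> Nm mn; rewrite -(@ltr_pXn2r _ 2) ?nnegrE ?ip_norm_ge0 ?ltW // psum_dist //.
    have := sN m Nm; have := sN n (leq_trans Nm mn); rewrite /= -/(s n) -/(s m).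
    by rewrite !ltr_norml => /andP[? ?] /andP[? ?]; lra.
  move=> m n Nm Nn; case/orP: (leq_total m n) => mn; last exact: main.
  rewrite (ip_norm_distC hP); [exact: main|exact: psumP..].
exists w; split=> // j; apply/eqP; rewrite -subr_eq0 -normc_eq0 eq_le normc_ge0 andbT.
(* From index [j.+1] on, the [j]-th coefficient of [psum a] is exactly [a j], so that only the
   distance to [w] remains. *)
have w_lim' : nrm (psum a (n + j.+1)%N - w) @[n --> \oo] --> 0.
  by rewrite (cvg_shiftn j.+1 (fun n => nrm (psum a n - w)) _).
apply: (ler_cvg0 _ w_lim') => n.
have PB : P (psum a (n + j.+1) - w) by apply: (hilbertB hP) => //; exact: psumP.
have := cauchy_schwarz hP (phiP j) PB.
rewrite (ipBr hP) //; last exact: psumP.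
rewrite ip_psum (_ : (j < n + j.+1)%N); last by rewrite addnS ltnS leq_addl.
rewrite -opprB normcN.
by rewrite /ip_norm phi_orth eqxx /= sqrtr1 mul1r.
Qed.

(** The limit found by [riesz_fischer] has the coefficients of [x], so totality puts it at distance
    0 from [x]. *)
Lemma psum_cvg x : P x ->
  nrm (psum (fun j => ip (phi j) x) n - x) @[n --> \oo] --> 0.
Proof.
move=> Px; set a := fun j => ip _ _.
have [w [Pw wa w_lim]] := riesz_fischer (a := a) (fun n => bessel n Px).
have wx : nrm (w - x) = 0.
  by apply: phi_total => [|j]; inP; rewrite (ipBr hP) // wa subrr.
apply: squeeze_cvg0 w_lim => n; rewrite ip_norm_ge0 /= -[leRHS]addr0 -wx.
by apply: (ip_norm_distD hP); inP.
Qed.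

(** Bessel's inequality bounds every partial sum of [u] by [M] times the norm of [v], and the
    partial sums tend to [u]. The bound on the resolvent comes from here. *)
Lemma norm_le_coef u v (M : R) : P u -> P v -> 0 <= M ->
  (forall j, normc (ip (phi j) u) <= M * normc (ip (phi j) v)) ->
  nrm u <= M * nrm v.
Proof.
move=> Pu Pv M0 uv; rewrite -subr_le0; apply: (ler_cvg0 _ (psum_cvg Pu)) => n.
set a := fun j => ip _ _.
have Pn := psumP a n.
have h1 : nrm u <= nrm (psum a n) + nrm (psum a n - u).
  rewrite (ip_norm_distC hP) // -{1}(subrK (psum a n) u) addrC (le_trans (ip_normD hP _ _)) //.
  by inP.
have h2 : nrm (psum a n) <= M * nrm v.
  rewrite -(@ler_pXn2r _ 2) ?nnegrE ?mulr_ge0 ?ip_norm_ge0 // psum_norm exprMn.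
  apply: le_trans (ler_wpM2l (sqr_ge0 M) (bessel n Pv)).
  rewrite mulr_sumr; apply: ler_sum => j _; rewrite -exprMn.
  by rewrite ler_pXn2r ?nnegrE ?mulr_ge0 ?normc_ge0 ?uv.
lra.
Qed.

(** A bounded diagonal operator is defined everywhere; with [mu j = 1 / (lam j - l)] it solves the
    resolvent equation. *)
Lemma coef_multiplier (mu : nat -> R[i]) (M : R) v : P v ->
  (forall j, normc (mu j) <= M) ->
  exists2 u, P u & (forall j, ip (phi j) u = mu j * ip (phi j) v).
Proof.
move=> Pv muM; suff aM n : \sum_(j < n) normc (mu j * ip (phi j) v) ^+ 2 <= M ^+ 2 * nrm v ^+ 2.
  by have [w [Pw wa _]] := @riesz_fischer (fun j => mu j * ip (phi j) v) _ aM; exists w.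
apply: le_trans (ler_wpM2l (sqr_ge0 M) (bessel n Pv)).
rewrite mulr_sumr; apply: ler_sum => j _; rewrite -exprMn normcM.
rewrite ler_pXn2r ?nnegrE ?mulr_ge0 ?normc_ge0 ?(le_trans _ (muM 0)) ?normc_ge0 //.
by rewrite ler_wpM2r ?normc_ge0.
Qed.

Lemma normc_ip_basis j x : P x -> normc (ip (phi j) x) <= nrm x.
Proof.
move=> Px; rewrite (le_trans (cauchy_schwarz hP (phiP j) Px)) //.
by rewrite {1}/ip_norm phi_orth eqxx /= sqrtr1 mul1r.
Qed.

(** * Closure of a symmetric operator with a basis of eigenvectors in its domain *)

Section DiagonalOperator.
Variables (A0 : V -> V -> Prop) (lam : nat -> R).
Hypothesis A0P : forall f g, A0 f g -> P f /\ P g.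
Hypothesis A0_0 : A0 0 0.
Hypothesis A0_D : forall f g f' g', A0 f g -> A0 f' g' -> A0 (f + f') (g + g').
Hypothesis A0_Z : forall a f g, A0 f g -> A0 (a *: f) (a *: g).
Hypothesis A0_phi : forall j, A0 (phi j) ((lam j)%:C *: phi j).
Hypothesis A0_sym : forall f g f' g', A0 f g -> A0 f' g' -> ip g f' = ip f g'.

Definition graph_closure u v := [/\ P u, P v & exists f g : nat -> V,
  [/\ forall n, A0 (f n) (g n),
      nrm (f n - u) @[n --> \oo] --> 0 & nrm (g n - v) @[n --> \oo] --> 0]].

(** Symmetry moves the operator onto the eigenvector [phi j], whose eigenvalue is real. *)
Lemma A0_coef f g j : A0 f g -> ip (phi j) g = (lam j)%:C * ip (phi j) f.
Proof.
move=> Afg; have [Pf Pg] := A0P Afg.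
by rewrite -(A0_sym (A0_phi j) Afg) (ipZl hP) // conjc_real.
Qed.

Lemma A0_psum a n : A0 (psum a n) (psum (fun j => (lam j)%:C * a j) n).
Proof.
elim: n => [|n IH]; first by rewrite /psum !big_ord0.
rewrite /psum !big_ord_recr /=; apply: A0_D => //.
by rewrite mulrC -scalerA; apply: A0_Z.
Qed.

(** The closure is the maximal diagonal operator. Coefficients are continuous, which gives one
    direction; conversely the truncated expansions of [u] and [v] are pairs in the graph of [A0]
    that converge to [(u, v)]. *)
Lemma graph_closureP u v : graph_closure u v <->
  [/\ P u, P v & forall j, ip (phi j) v = (lam j)%:C * ip (phi j) u].
Proof.
split=> [[Pu Pv [f [g [Afg fu gv]]]]|[Pu Pv uv]]; split=> //.
  move=> j; apply/eqP; rewrite -subr_eq0 -normc_eq0 eq_le normc_ge0 andbT.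
  have lim : nrm (g n - v) + `|lam j| * nrm (f n - u) @[n --> \oo] --> 0.
    by rewrite -[0]addr0 -{2}(mulr0 `|lam j|); apply: cvgD => //; exact: cvgMr.
  apply: (ler_cvg0 _ lim) => n; have [Pf Pg] := A0P (Afg n).
  have -> : ip (phi j) v - (lam j)%:C * ip (phi j) u =
      (lam j)%:C * ip (phi j) (f n - u) - ip (phi j) (g n - v).
    by rewrite !(ipBr hP) // (A0_coef j (Afg n)); ring.
  apply: le_trans (le_normcD _ _) _; rewrite normcN normcM normc_real addrC.
  by rewrite lerD // ?ler_wpM2l // normc_ip_basis //; inP.
exists (psum (fun j => ip (phi j) u)), (psum (fun j => ip (phi j) v)); split.
- move=> n; rewrite (_ : psum (fun j => ip (phi j) v) n =
    psum (fun j => (lam j)%:C * ip (phi j) u) n); first exact: A0_psum.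
  by apply: eq_bigr => j _; rewrite uv.
- exact: psum_cvg.
- exact: psum_cvg.
Qed.

(** Testing an adjoint pair against the eigenvectors gives back the coefficient criterion. For the
    symmetry, both inner products agree once [f] and [g] are replaced by their partial sums, and
    Cauchy-Schwarz controls the remainders. *)
Lemma graph_closure_adjoint u v : graph_closure u v <->
  [/\ P u, P v & forall f g, graph_closure f g -> ip g u = ip f v].
Proof.
split=> [/graph_closureP[Pu Pv uv]|[Pu Pv adj]]; last first.
  apply/graph_closureP; split=> // j.
  rewrite -(adj (phi j) ((lam j)%:C *: phi j)) ?(ipZl hP) ?conjc_real //.
  apply/graph_closureP; split; inP => // i; rewrite (ipZr hP) // phi_orth.
  by have [->//|_] := eqVneq i j; rewrite !mulr0.
split=> // f g /graph_closureP[Pf Pg fg].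
apply/eqP; rewrite -subr_eq0 -normc_eq0 eq_le normc_ge0 andbT.
set cf := fun j => ip (phi j) f; set cg := fun j => ip (phi j) g.
have lim : nrm (psum cg n - g) * nrm u + nrm (psum cf n - f) * nrm v
    @[n --> \oo] --> 0.
  have cvg0 k x : P x -> nrm (psum (fun j => ip (phi j) x) n - x) * k @[n --> \oo] --> 0.
    by move=> Px; rewrite -(mul0r k); apply: cvgMl; exact: psum_cvg.
  by rewrite -[0]addr0; apply: cvgD; exact: cvg0.
apply: (ler_cvg0 _ lim) => n.
have [Ps Pt] := (psumP cg n, psumP cf n).
have E : ip (psum cg n) u = ip (psum cf n) v.
  rewrite !psum_ip //; apply: eq_bigr => j _.
  by rewrite /cf /cg fg uv conjc_rmul; ring.
have -> : ip g u - ip f v = ip (psum cf n - f) v - ip (psum cg n - g) u.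
  by rewrite !(ipBl hP) // E; ring.
apply: le_trans (le_normcD _ _) _; rewrite normcN addrC.
by apply: lerD; apply: (cauchy_schwarz hP); inP.
Qed.

Lemma graph_closure_dense u : P u -> exists f g : nat -> V,
  (forall n, graph_closure (f n) (g n)) /\ nrm (f n - u) @[n --> \oo] --> 0.
Proof.
move=> Pu; exists (psum (fun j => ip (phi j) u)).
exists (psum (fun j => (lam j)%:C * ip (phi j) u)); split; last exact: psum_cvg.
move=> n; apply/graph_closureP; split; inP => j; rewrite !ip_psum.
by case: ifP => // _; rewrite mulr0.
Qed.

(** Division by [lam j - l] inverts the operator coefficient by coefficient, and the gap [c] keeps
    the divisors away from 0. *)
Lemma graph_closure_resolvent (l : R[i]) (c : R) : 0 < c ->
  (forall j, c <= normc ((lam j)%:C - l)) ->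
  (forall v, P v -> exists u, graph_closure u (v + l *: u)) /\
  (forall v u, P v -> graph_closure u (v + l *: u) -> nrm u <= c^-1 * nrm v).
Proof.
move=> c0 lc.
have nz j : (lam j)%:C - l != 0.
  by rewrite -normc_eq0 gt_eqF // (lt_le_trans c0).
split=> [v Pv|v u Pv /graph_closureP[Pu Pvu vu]].
  have [j|u Pu uE] := @coef_multiplier (fun j => ((lam j)%:C - l)^-1) c^-1 v Pv.
    by rewrite normcV lef_pV2 ?posrE // (lt_le_trans c0).
  exists u; apply/graph_closureP; split; inP => // j.
  rewrite (ipDr hP) ?(ipZr hP) //; last by inP.
  by rewrite uE; field; exact: nz.
apply: norm_le_coef => // [|j]; first by rewrite invr_ge0 ltW.
have := vu j; rewrite (ipDr hP) ?(ipZr hP) //; last by inP.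
move=> E; have -> : ip (phi j) v = ((lam j)%:C - l) * ip (phi j) u.
  by rewrite mulrBl -E addrK.
rewrite normcM mulrA ler_peMl ?normc_ge0 // mulrC ler_pdivlMr // mul1r.
exact: lc.
Qed.

End DiagonalOperator.

End OrthonormalBasis.

Notation plane R := (measurableTypeR R * measurableTypeR R)%type.

(** * Integration by parts for Schwartz functions on the plane *)

Section PlaneMeasurability.
Context {R : realType}.

(** The plane carries the product sigma-algebra, so an open set is written as a countable union of
    boxes with rational centre and half-width [1 / n.+1]. *)
Lemma open_measurable_plane (S : set (R * R)) :
  open S -> measurable (S : set (plane R)).
Proof.
move=> oS.
pose box (i : rat * rat * nat) : set (plane R) :=
  `]ratr i.1.1 - i.2.+1%:R^-1, ratr i.1.1 + i.2.+1%:R^-1[ `*`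
  `]ratr i.1.2 - i.2.+1%:R^-1, ratr i.1.2 + i.2.+1%:R^-1[.
have -> : S = \bigcup_i (if `[< box i `<=` S >] then box i else set0).
  apply/seteqP; split=> [[x y] Sxy|[x y] [i _]]; last by case: asboolP => // BS /BS.
  have /nbhs_ballP[e /= e0 eS] := open_nbhs_nbhs (conj oS Sxy).
  (* The centre is within [1 / n.+1] of the point and the box has that half-width, so the box stays
     within twice this distance of the point. *)
  have [n ne] : exists n, 2 * n.+1%:R^-1 < e.
    have [n _ /(_ n (leqnn n))] := near_infty_natSinv_lt (PosNum (divr_gt0 e0 (ltr0Sn R 1))).
    by move=> /= h; exists n; rewrite mulrC -ltr_pdivlMr.
  have n0 : 0 < n.+1%:R^-1 :> R by rewrite invr_gt0.
  set d := n.+1%:R^-1 : R in ne n0 *.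
  have approx (t : R) : exists q : rat, t - d < ratr q < t + d.
    have [|q] := @rat_in_itvoo R (t - d) (t + d); first by lra.
    by rewrite in_itv /=; exists q.
  have [[q1 /andP[a1 a2]] [q2 /andP[b1 b2]]] := (approx x, approx y).
  exists (q1, q2, n) => //; case: asboolP => [_|].
    by split; rewrite /= in_itv /= -/d; apply/andP; split; lra.
  case=> -[x' y'] [] /=; rewrite !in_itv /= -/d => /andP[c1 c2] /andP[d1 d2].
  by apply: eS; split; rewrite /ball /= ltr_norml; apply/andP; split; lra.
apply: countable_bigcupT_measurable => [|i]; first exact: countableP.
by case: asboolP => // _; apply: measurableX; exact: measurable_itv.
Qed.

Lemma continuous_measurable_plane (f : R * R -> R) :
  continuous f -> measurable_fun [set: plane R] (f : plane R -> R).
Proof.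
move=> /continuousP cf _ .
apply: (measurability _ (RGenOInfty.measurableE R)) => //.
move=> _ [_ [a ->] <-]; rewrite setTI; apply: open_measurable_plane.
by apply: cf; exact: interval_open.
Qed.

End PlaneMeasurability.

(** * An integrable weight on the plane *)

Section OneDsqr.
Context {R : realType}.
Local Notation mu := (@lebesgue_measure R).

(** By evenness a half-line suffices; there the primitive [atan] has limit [pi / 2]. *)
Lemma integrable_oneDsqrV :
  mu.-integrable [set: R] (fun x => ((1 + x ^+ 2)^-1)%:E).
Proof.
have cV : continuous (fun x : R => (1 + x ^+ 2)^-1) by exact: continuous_oneDsqrV.
have ge0 (x : R) : 0 <= (1 + x ^+ 2)^-1 by rewrite invr_ge0 addr_ge0 // sqr_ge0.
apply/integrableP; split.
  by apply/measurable_EFinP; exact: continuous_measurable_fun.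
under eq_integral do rewrite gee0_abs ?lee_fin //.
rewrite ge0_symfun_integralT //; last by move=> x /=; rewrite sqrrN.
rewrite -set_itvcy (@ge0_continuous_FTC2y _ _ (@atan R) 0 (pi / 2)) //.
- by rewrite atan0 -EFinB -EFinM ltry.
- exact: continuous_subspaceT.
- exact: cvgy_atan.
- by apply: cvg_at_right_filter; exact: continuous_atan.
- by move=> x _; rewrite derive1_atan.
Qed.

(** Common majorant of the Schwartz functions: integrable on the plane, and on each line parallel to
    an axis a multiple of [1 / (1 + t ^ 2)], as the one-dimensional argument requires. *)
Definition decay (z : R * R) : R := ((1 + z.1 ^+ 2) * (1 + z.2 ^+ 2))^-1.

Lemma decay_gt0 z : 0 < decay z.
Proof. by rewrite invr_gt0 mulr_gt0 // ltr_pwDl // sqr_ge0. Qed.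

Lemma continuous_decay : continuous decay.
Proof.
move=> z; apply: cvgV.
  by rewrite mulf_neq0 // gt_eqF // ltr_pwDl // sqr_ge0.
by apply: cvgM; apply: cvgD; try exact: cvg_cst;
  apply: cvgM; first [exact: cvg_fst|exact: cvg_snd].
Qed.

Lemma measurable_decay : measurable_fun [set: plane R] (decay : plane R -> R).
Proof. exact: (continuous_measurable_plane continuous_decay). Qed.

Lemma integrable_decay :
  (@lebesgue2 R).-integrable setT (fun z => (decay z)%:E).
Proof.
apply/(@integrable12ltyP _ _ _ _ _ mu mu).
  by apply/measurable_EFinP; exact: measurable_decay.
have /integrableP[mg fin] := integrable_oneDsqrV.
have g0 (x : R) : (0 <= ((1 + x ^+ 2)^-1)%:E)%E.
  by rewrite lee_fin invr_ge0 addr_ge0 // sqr_ge0.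
have E (x : R) : (\int[mu]_y `|(decay (x, y))%:E| =
   ((1 + x ^+ 2)^-1)%:E * \int[mu]_y ((1 + y ^+ 2)^-1)%:E)%E.
  rewrite -ge0_integralZl //; apply: eq_integral => y _.
  by rewrite gee0_abs ?lee_fin ?(ltW (decay_gt0 _)) // -EFinM /decay invfM.
have fin' : (\int[mu]_y ((1 + y ^+ 2)^-1)%:E < +oo)%E.
  by apply: le_lt_trans fin; under [leRHS]eq_integral do rewrite gee0_abs //.
under eq_integral do rewrite E.
rewrite ge0_integralZr //; last exact: integral_ge0.
by rewrite lte_mul_pinfty // ?integral_ge0 // ge0_fin_numE ?integral_ge0.
Qed.

Lemma integrable_decayM (f : plane R -> R) (M : R) :
  measurable_fun setT f -> (forall z, `|f z| <= M * decay z) ->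
  (@lebesgue2 R).-integrable setT (EFin \o f).
Proof.
move=> mf fM;apply: (@le_integrable _ (plane R) R lebesgue2 setT measurableT
  (EFin \o f) (fun z => (M * decay z)%:E)) => //.
- exact/measurable_EFinP.
- move=> z _ /=; rewrite lee_fin (le_trans (fM z)) // ler_norm //.
- under [X in integrable _ _ X]eq_fun do rewrite EFinM.
  by apply: integrableZl => //; exact: integrable_decay.
Qed.

End OneDsqr.

Section IntegrationByParts.
Context {R : realType}.
Local Notation mu := (@lebesgue_measure R).

(** Over [[- n.+1, n.+1]] the integral is a difference of boundary values of [f], which tends to 0;
    dominated convergence identifies the limit with the full integral. *)
Lemma integral_derive_decay (f g : R -> R) (M : R) :
  (forall x : R, is_derive x (1 : R) f (g x)) -> continuous g ->
  (forall x, `|f x| <= M * (1 + x ^+ 2)^-1) ->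
  (forall x, `|g x| <= M * (1 + x ^+ 2)^-1) ->
  (\int[mu]_x (g x)%:E = 0)%E.
Proof.
move=> fg cg fM gM.
have M0 : 0 <= M by have := fM 0; rewrite expr0n addr0 invr1 mulr1; exact: le_trans.
have cf : continuous f.
  by move=> x; apply: differentiable_continuous; apply/derivable1_diffP; case: (fg x).
pose h (n : nat) : R -> \bar R := (EFin \o g) \_ `[- n.+1%:R, n.+1%:R].
have hI : (\int[mu]_x h n x)%E @[n --> \oo] --> (\int[mu]_x (g x)%:E)%E.
  apply: (@dominated_cvg _ (measurableTypeR R) R mu setT measurableT h (EFin \o g) (fun x => (M * (1 + x ^+ 2)^-1)%:E)) => //.
  - move=> n; apply/(measurable_restrictT (EFin \o g)); first exact: measurable_itv.
    apply: measurable_funTS; apply/measurable_EFinP; exact: continuous_measurable_fun.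
  - move=> x _; apply: cvg_near_cst; near=> n.
    rewrite /h patchE mem_set //= in_itv /= -ler_norml.
    apply: (@le_trans _ _ n%:R); last by rewrite ler_nat.
    by near: n; exact: nbhs_infty_ger.
  - under [X in integrable _ _ X]eq_fun do rewrite EFinM.
    by apply: integrableZl => //; exact: integrable_oneDsqrV.
  - move=> n x _; rewrite /h patchE; case: ifP => _ /=; rewrite lee_fin ?gM //.
    by rewrite normr0 mulr_ge0 // invr_ge0 addr_ge0 // sqr_ge0.
have hE n : (\int[mu]_x h n x)%E = (f n.+1%:R - f (- n.+1%:R))%:E.
  rewrite /h -integral_mkcond (@continuous_FTC2 _ g f) ?EFinB //.
  - by rewrite gtrN.
  - exact: continuous_subspaceT.
  - split; first by move=> x _; case: (fg x).
    + by apply: cvg_at_right_filter; exact: cf.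
    + by apply: cvg_at_left_filter; exact: cf.
  - by move=> x _; rewrite derive1E; case: (fg x).
have hlim : (f n.+1%:R - f (- n.+1%:R)) @[n --> \oo] --> 0.
  apply/cvgr0Pnorm_le => e e0; near=> n.
  apply: (@le_trans _ _ (M * (n%:R)^-1 + M * (n%:R)^-1)).
    have n0 : (0 < n)%N by near: n; exact: nbhs_infty_gt.
    have bnd : M * (1 + n.+1%:R ^+ 2)^-1 <= M * (n%:R)^-1 :> R.
      have p : 0 < 1 + n.+1%:R ^+ 2 :> R by rewrite ltr_pwDl // sqr_ge0.
      rewrite ler_wpM2l // lef_pV2 ?posrE ?ltr0n //.
      rewrite -natrX addrC natr1 ler_nat (leq_trans (leqnSn n)) // leqW //.
      by rewrite -[leqLHS]expn1 leq_exp2l.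
    apply: le_trans (ler_normB _ _) _.
    by apply: lerD; apply: le_trans (fM _) _; rewrite ?sqrrN.
  have n0 : 0 < n%:R :> R by near: n; exact: nbhs_infty_gtr.
  rewrite -mulrDl ler_pdivrMr // -ler_pdivrMl //.
  by near: n; exact: nbhs_infty_ger.
have : (\int[mu]_x h n x)%E @[n --> \oo] --> 0%E.
  by rewrite (eq_cvg _ _ hE); apply: cvg_EFin; [exact: nearW|exact: hlim].
by move=> /(cvg_unique _ hI) -> //.
Unshelve. all: by end_near. Qed.

End IntegrationByParts.

(** * Partial derivatives along lines *)

Section PartialDerivatives.
Context {R : realType}.
Local Notation mu := (@lebesgue_measure R).

Lemma is_derive_snd (F : R * R -> R) (x y : R) : derivable F (x, y) (dir true) ->
  is_derive y (1 : R) (fun t => F (x, t)) ('D_(dir true) F (x, y)).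
Proof.
move=> dF.
have E : (fun h : R => h^-1 *: (((fun t => F (x, t)) \o shift y) (h *: (1 : R)) - F (x, y))) =
         (fun h : R => h^-1 *: ((F \o shift (x, y)) (h *: dir true) - F (x, y))).
  apply/funext => h; congr (_ *: (F _ - _)).
  transitivity ((h *: 0 + x, h *: 1 + y) : R * R); last by [].
  by rewrite scaler0 add0r.
by split; rewrite /derivable /derive E.
Qed.

Lemma is_derive_fst (F : R * R -> R) (x y : R) : derivable F (x, y) (dir false) ->
  is_derive x (1 : R) (fun t => F (t, y)) ('D_(dir false) F (x, y)).
Proof.
move=> dF.
have E : (fun h : R => h^-1 *: (((fun t => F (t, y)) \o shift x) (h *: (1 : R)) - F (x, y))) =
         (fun h : R => h^-1 *: ((F \o shift (x, y)) (h *: dir false) - F (x, y))).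
  apply/funext => h; congr (_ *: (F _ - _)).
  transitivity ((h *: 1 + x, h *: 0 + y) : R * R); last by [].
  by rewrite scaler0 add0r.
by split; rewrite /derivable /derive E.
Qed.

Lemma continuous_line_snd (F : R * R -> R) (x : R) :
  continuous F -> continuous (fun t : R => F (x, t)).
Proof.
move=> cF y; have : (x, t) @[t --> y] --> (x, y) by exact: cvg_pair (cvg_cst x) (@cvg_id _ _).
by move=> /cvg_comp; apply; exact: cF.
Qed.

Lemma continuous_line_fst (F : R * R -> R) (y : R) :
  continuous F -> continuous (fun t : R => F (t, y)).
Proof.
move=> cF x; have : (t, y) @[t --> x] --> (x, y) by exact: cvg_pair (@cvg_id _ _) (cvg_cst y).
by move=> /cvg_comp; apply; exact: cF.
Qed.

Lemma continuous_mul2 (f g : R * R -> R) :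
  continuous f -> continuous g -> continuous (fun z => f z * g z).
Proof. by move=> cf cg z; apply: cvgM; [exact: cf|exact: cg]. Qed.

Lemma continuous_add2 (f g : R * R -> R) :
  continuous f -> continuous g -> continuous (fun z => f z + g z).
Proof. by move=> cf cg z; apply: cvgD; [exact: cf|exact: cg]. Qed.

(** Fubini with the differentiated variable innermost: each inner integral is that of a
    one-dimensional derivative. *)
Lemma integral_partial (b : bool) (F : R * R -> R) (M : R) :
  (forall z, derivable F z (dir b)) -> continuous ('D_(dir b) F) ->
  (forall z, `|F z| <= M * decay z) ->
  (forall z, `|'D_(dir b) F z| <= M * decay z) ->
  \int[lebesgue2]_z 'D_(dir b) F z = 0.
Proof.
move=> dF cDF FM DFM.
have iDF := integrable_decayM (continuous_measurable_plane cDF) DFM.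
rewrite /Rintegral; suff -> : (\int[lebesgue2]_z ('D_(dir b) F z)%:E = 0)%E by [].
case: b => [|] in dF cDF FM DFM iDF *.
  rewrite -(@integral12_prod_meas1 _ _ _ _ _ mu mu _ iDF).
  rewrite (eq_integral (cst 0%E)) ?integral0 // => x _ /=.
  apply: (@integral_derive_decay _ (fun t => F (x, t)) _ (M * (1 + x ^+ 2)^-1)) => [y||y|y].
  - exact: is_derive_snd.
  - exact: continuous_line_snd cDF.
  - by rewrite -mulrA -invfM; exact: FM.
  - by rewrite -mulrA -invfM; exact: DFM.
rewrite -(@integral21_prod_meas1 _ _ _ _ _ mu mu _ iDF).
rewrite (eq_integral (cst 0%E)) ?integral0 // => y _ /=.
apply: (@integral_derive_decay _ (fun t => F (t, y)) _ (M * (1 + y ^+ 2)^-1)) => [x||x|x].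
- exact: is_derive_fst.
- exact: continuous_line_fst cDF.
- by rewrite -mulrA [_^-1 * _^-1]mulrC -invfM; exact: FM.
- by rewrite -mulrA [_^-1 * _^-1]mulrC -invfM; exact: DFM.
Qed.

End PartialDerivatives.

Section RealSchwartz.
Context {R : realType}.
Implicit Types f g : R * R -> R.

Lemma schwartz_differentiable f z : real_schwartz f -> differentiable f z.
Proof. by move=> /(_ [::])[]. Qed.

Lemma schwartz_derivable f z v : real_schwartz f -> derivable f z v.
Proof. by move=> fS; apply: diff_derivable; exact: schwartz_differentiable. Qed.

Lemma schwartz_continuous f : real_schwartz f -> continuous f.
Proof.
by move=> fS z; apply: differentiable_continuous; exact: schwartz_differentiable.
Qed.

Lemma schwartz_partial f b : real_schwartz f -> real_schwartz ('D_(dir b) f).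
Proof. by move=> fS w; have := fS (w ++ [:: b]); rewrite /iter_partial foldr_cat. Qed.

(** Multiplication by [(1 + x ^ 2) (1 + y ^ 2)] produces four monomial multiples of [f], each of
    them bounded. *)
Lemma schwartz_decay f (a b : nat) : real_schwartz f ->
  exists M : R, forall z, `|z.1 ^+ a * z.2 ^+ b * f z| <= M * decay z.
Proof.
move=> /(_ [::])[_ fS].
have [M1 H1] := fS a b; have [M2 H2] := fS (a.+2) b.
have [M3 H3] := fS a (b.+2); have [M4 H4] := fS (a.+2) (b.+2).
exists (M1 + M2 + M3 + M4) => z.
rewrite /decay ler_pdivlMr; last by rewrite mulr_gt0 // ltr_pwDl // sqr_ge0.
have -> (u : R) : u * ((1 + z.1 ^+ 2) * (1 + z.2 ^+ 2)) =
   u + z.1 ^+ 2 * u + z.2 ^+ 2 * u + z.1 ^+ 2 * z.2 ^+ 2 * u by ring.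
have := H1 z; have := H2 z; have := H3 z; have := H4 z; rewrite /iter_partial /=.
set u := z.1 ^+ a * z.2 ^+ b * f z.
have nE (v w : R) : `|v ^+ 2 * w| = v ^+ 2 * `|w|.
  by rewrite normrM ger0_norm ?sqr_ge0.
have -> : z.1 ^+ a.+2 * z.2 ^+ b * f z = z.1 ^+ 2 * u.
  by rewrite /u -addn2 exprD; ring.
have -> : z.1 ^+ a * z.2 ^+ b.+2 * f z = z.2 ^+ 2 * u.
  by rewrite /u -(addn2 b) exprD; ring.
have -> : z.1 ^+ a.+2 * z.2 ^+ b.+2 * f z = z.1 ^+ 2 * (z.2 ^+ 2 * u).
  by rewrite /u -(addn2 a) -(addn2 b) !exprD; ring.
by rewrite !nE; lra.
Qed.

Lemma schwartz_decay0 f : real_schwartz f ->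
  exists M : R, forall z, `|f z| <= M * decay z.
Proof.
move=> /(@schwartz_decay f 0 0)[M fM]; exists M => z.
by have := fM z; rewrite !expr0 !mul1r.
Qed.

Lemma decay_le1 (z : R * R) : decay z <= 1.
Proof.
rewrite /decay invf_le1 ?mulr_gt0 ?ltr_pwDl ?sqr_ge0 //.
by rewrite -[leLHS]mulr1 ler_pM // lerDl sqr_ge0.
Qed.

Lemma decayM f g : (exists M : R, forall z, `|f z| <= M * decay z) ->
  (exists M : R, forall z, `|g z| <= M * decay z) ->
  exists M : R, forall z, `|f z * g z| <= M * decay z.
Proof.
move=> [M fM] [N gN]; exists (M * N) => z; rewrite normrM.
have d0 := ltW (decay_gt0 z).
have N0 : 0 <= N by rewrite -(pmulr_lge0 _ (decay_gt0 z)) (le_trans _ (gN z)).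
have M0 : 0 <= M by rewrite -(pmulr_lge0 _ (decay_gt0 z)) (le_trans _ (fM z)).
rewrite mulrAC ler_pM // (le_trans (gN z)) // -[leRHS]mulr1.
by rewrite ler_wpM2l // decay_le1.
Qed.

Lemma decayD f g : (exists M : R, forall z, `|f z| <= M * decay z) ->
  (exists M : R, forall z, `|g z| <= M * decay z) ->
  exists M : R, forall z, `|f z + g z| <= M * decay z.
Proof.
move=> [M fM] [N gN]; exists (M + N) => z; rewrite mulrDl.
by rewrite (le_trans (ler_normD _ _)) // lerD.
Qed.

Lemma schwartz_integrableM f g : real_schwartz f -> real_schwartz g ->
  (@lebesgue2 R).-integrable setT (EFin \o (f \* g)).
Proof.
move=> fS gS.
have [M fgM] := decayM (schwartz_decay0 fS) (schwartz_decay0 gS).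
apply: (integrable_decayM _ fgM).
by apply: measurable_funM; apply: continuous_measurable_plane; exact: schwartz_continuous.
Qed.

(** The product of [f] and [g] and its partial derivative both decay, so the derivative has integral
    0. *)
Lemma schwartz_by_parts f g b : real_schwartz f -> real_schwartz g ->
  \int[lebesgue2]_z (f z * 'D_(dir b) g z) = - \int[lebesgue2]_z ('D_(dir b) f z * g z).
Proof.
move=> fS gS.
have [f'S g'S] := (schwartz_partial b fS, schwartz_partial b gS).
have DE z : 'D_(dir b) (f * g) z = f z * 'D_(dir b) g z + 'D_(dir b) f z * g z.
  rewrite deriveM; [|exact: schwartz_derivable..].
  by rewrite addrC [X in _ + X = _]mulrC [X in X + _ = _]mulrC addrC mulrC [X in _ + X]mulrC.
apply/eqP; rewrite -subr_eq0 opprK; apply/eqP.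
rewrite -RintegralD //; [|exact: schwartz_integrableM..].
under eq_Rintegral do rewrite -DE.
have [M M1] := decayM (schwartz_decay0 fS) (schwartz_decay0 gS).
have [N N1] := decayD (decayM (schwartz_decay0 fS) (schwartz_decay0 g'S))
                      (decayM (schwartz_decay0 f'S) (schwartz_decay0 gS)).
have cDE : 'D_(dir b) (f * g) = (fun z => f z * 'D_(dir b) g z + 'D_(dir b) f z * g z).
  by apply/funext => z; exact: DE.
apply: (@integral_partial _ b _ (Num.max M N)).
- by move=> z; apply: derivableM; exact: schwartz_derivable.
- rewrite cDE => z.
  by move: z; apply: continuous_add2; apply: continuous_mul2; exact: schwartz_continuous.
- move=> z; apply: le_trans (M1 z) _.
  by rewrite ler_wpM2r ?(ltW (decay_gt0 z)) // le_max lexx.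
- move=> z; rewrite DE; apply: le_trans (N1 z) _.
  by rewrite ler_wpM2r ?(ltW (decay_gt0 z)) // le_max lexx orbT.
Qed.

End RealSchwartz.

(** * The Hilbert space of square-integrable spinors *)

Section L2Complete.
Context d (T : measurableType d) (R : realType) (mu : {measure set T -> \bar R}).
Implicit Types f g w : T -> R.

(** The squared L^2 norm, as an extended real; [sqintD] stands in for the triangle inequality. *)
Definition sqint f : \bar R := (\int[mu]_x (f x ^+ 2)%:E)%E.

Lemma measurable_sqr f : measurable_fun setT f ->
  measurable_fun setT (fun x => (f x ^+ 2)%:E).
Proof. by move=> mf; apply/measurable_EFinP; exact: measurable_funX. Qed.

Lemma Lfun2P f : f \in Lfun mu 2%:E <-> measurable_fun setT f /\ (sqint f < +oo)%E.
Proof.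
have E : (\int[mu]_x (`|(EFin \o f) x| `^ 2))%E = sqint f.
  apply: eq_integral => x _ /=.
  by rewrite powR_mulrn // real_normK ?num_real.
split=> [|[mf fin]].
  rewrite inE => /andP[]; rewrite !inE /= /finite_norm unlock => mf fin; split=> //.
  by rewrite -E; apply: lty_poweRy fin; rewrite invr_eq0.
apply/andP; split; rewrite inE //= /finite_norm unlock.
by apply: poweR_lty; rewrite E.
Qed.

Lemma sqintD f g : measurable_fun setT f -> measurable_fun setT g ->
  (sqint (fun x => f x + g x)%R <= 2%:E * sqint f + 2%:E * sqint g)%E.
Proof.
move=> mf mg; rewrite /sqint -!ge0_integralZl //; try exact: measurable_sqr;
  try by move=> x _; rewrite lee_fin sqr_ge0.
rewrite -ge0_integralD //; try by move=> x _; rewrite lee_fin mulr_ge0 // sqr_ge0.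
- apply: ge0_le_integral => //.
  + by move=> x _; rewrite lee_fin sqr_ge0.
  + by apply: measurable_sqr; exact: measurable_funD.
  + apply: emeasurable_funD; apply: measurable_funeM; exact: measurable_sqr.
  + move=> x _; rewrite -!EFinM -EFinD lee_fin.
    by have := sqr_ge0 (f x - g x); rewrite /=; nra.
- by apply: measurable_funeM; exact: measurable_sqr.
- by apply: measurable_funeM; exact: measurable_sqr.
Qed.

Lemma sqintN f : sqint (fun x => - f x) = sqint f.
Proof. by apply: eq_integral => x _; rewrite sqrrN. Qed.

(** Along a fast subsequence the increments [g k] have squared norm below [8 ^- k], so the series of
    [4 ^ k * g k ^ 2] has a finite integral and its sum [S] is finite almost everywhere. There [g k]
    is at most [sqrt S / 2 ^ k], the telescoping series converges, and Fatou's lemma carries the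
    Cauchy estimate to the limit. *)
Lemma L2_complete (u : nat -> T -> R) :
  (forall n, u n \in Lfun mu 2%:E) ->
  (forall e : R, 0 < e -> exists N, forall m n, (N <= m)%N -> (N <= n)%N ->
    (sqint (fun x => u m x - u n x)%R < e%:E)%E) ->
  exists2 w, w \in Lfun mu 2%:E & forall e : R, 0 < e -> exists N, forall n, (N <= n)%N ->
    (sqint (fun x => u n x - w x)%R <= e%:E)%E.
Proof.
move=> uL cauchy.
have mu_ n : measurable_fun setT (u n) by have /Lfun2P[] := uL n.
have /choice[N0 HN0] : forall k : nat, exists N, forall m n, (N <= m)%N -> (N <= n)%N ->
    (sqint (fun x => u m x - u n x)%R < (8 ^- k)%:E)%E.
  by move=> k; apply: cauchy; rewrite invr_gt0 exprn_gt0.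
(* The successors in the sum make [s k] at least [k] as well as at least [N0 k], and [s] is
   nondecreasing. *)
pose s k := (\sum_(j < k.+1) (N0 j).+1)%N.
have sN k : (N0 k <= s k)%N by rewrite /s big_ord_recr /= addnS ltnW // ltnS leq_addl.
have sk k : (k <= s k)%N.
  elim: k => // k IH; rewrite /s big_ord_recr /= addnS ltnS.
  by rewrite (leq_trans IH) // leq_addr.
have sS k : (s k <= s k.+1)%N by rewrite /s [leqRHS]big_ord_recr leq_addr.
pose g k x := u (s k.+1) x - u (s k) x.
have mg k : measurable_fun setT (g k) by exact: measurable_funB.
have gk k : (sqint (g k) < (8 ^- k)%:E)%E.
  by apply: HN0 => //; exact: leq_trans (sS k).
pose S x : \bar R := (\sum_(k <oo) (4 ^+ k * g k x ^+ 2)%:E)%E.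
have t0 k x : (0 <= (4 ^+ k * g k x ^+ 2)%:E)%E.
  by rewrite lee_fin; apply: mulr_ge0; [exact: exprn_ge0|exact: sqr_ge0].
have mt k : measurable_fun setT (fun x => (4 ^+ k * g k x ^+ 2)%:E).
  by apply/measurable_EFinP; apply: measurable_funM => //; exact: measurable_funX.
have mS : measurable_fun setT S.
  by apply: ge0_emeasurable_sum => // k x _ _; exact: t0.
have S0 x : (0 <= S x)%E by apply: nneseries_ge0 => k _ _; exact: t0.
have Sfin : (\int[mu]_x S x < +oo)%E.
  rewrite integral_nneseries //.
  apply: (@le_lt_trans _ _ 2%:E); last exact: ltry.
  apply: lime_le; first by apply: is_cvg_nneseries => k _ _; apply: integral_ge0.
  apply: nearW => n; apply: (@le_trans _ _ (\sum_(0 <= k < n) (2 ^- k)%:E)%E).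
    apply: lee_sum => k _.
    under eq_integral do rewrite EFinM.
    rewrite ge0_integralZl //; last 2 first.
      exact: measurable_sqr.
      by move=> x _; rewrite lee_fin sqr_ge0.
    rewrite (_ : 2 ^- k = 4 ^+ k * 8 ^- k) ?EFinM; last first.
      rewrite (_ : 8 = 2 * 4 :> R); last by ring.
      by rewrite exprMn invfM mulrCA divff ?mulr1 // expf_neq0.
    by rewrite lee_wpmul2l // ?lee_fin ?exprn_ge0 // ltW // gk.
  rewrite sumEFin lee_fin.
  have -> : \sum_(0 <= k < n) 2 ^- k = 2 - 2 * 2 ^- n :> R.
    elim: n => [|n IH]; first by rewrite big_nil expr0 invr1; ring.
    by rewrite big_nat_recr //= IH exprS; field; rewrite expf_neq0.
  by rewrite gerBl mulr_ge0 // invr_ge0 exprn_ge0.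
pose G := S @^-1` [set t | t \is a fin_num].
have mG : measurable G.
  have -> : G = [set: T] `&` [set x | S x \is a fin_num] by rewrite setTI.
  exact: emeasurable_fin_num.
have GT : mu (~` G) = 0%E.
  have /integrable_ae : mu.-integrable setT S.
    by apply/integrableP; split => //; under eq_integral do rewrite gee0_abs //.
  move=> /(_ measurableT)[A [mA A0 GA]].
  apply/eqP; rewrite eq_le measure_ge0 andbT -A0 le_measure ?inE //; first exact: measurableC.
  by move=> x /= Gx; apply: GA => /= /(_ I).
(* The cut-off forces convergence at every point, to 0 outside [G], so that the limit is measurable;
   it alters [u (s k)] on a null set only. *)
pose v k x := u (s k) x * \1_G x.
have mv k : measurable_fun setT (v k).
  by apply: measurable_funM => //; exact: measurable_indic.
have vcvg x : cvgn (v ^~ x).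
  have [Gx|Gx] := pselect (G x); last first.
    rewrite (_ : v ^~ x = cst 0); first exact: is_cvg_cst.
    by apply/funext => k; rewrite /v indicE memNset // mulr0.
  set C := fine (S x).
  have C0 : 0 <= C by exact: fine_ge0.
  have gC k : 4 ^+ k * g k x ^+ 2 <= C.
    rewrite -lee_fin /C fineK //.
    apply: le_trans (@nneseries_lim_ge R (fun k => (4 ^+ k * g k x ^+ 2)%:E) xpredT 0 k.+1 _).
      by rewrite big_nat_recr //= leeDr // sume_ge0.
    by move=> n _ _; exact: t0.
  have gC' k : `|g k x| <= geometric (Num.sqrt C) 2^-1 k.
    rewrite /geometric /= exprVn ler_pdivlMr ?exprn_gt0 //.
    rewrite -(@ler_pXn2r _ 2) ?nnegrE ?sqrtr_ge0 ?mulr_ge0 ?exprn_ge0 //.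
    rewrite sqr_sqrtr // exprMn real_normK ?num_real // mulrC -exprM mulnC exprM.
    by have -> : 2 ^+ 2 = 4 :> R by ring.
  have cg : cvgn (series (fun k => g k x)).
    apply: normed_cvg; apply: (@series_le_cvg _ _ (geometric (Num.sqrt C) 2^-1)) ; try by [].
    + by move=> k; exact: normr_ge0.
    + by move=> k; exact: (le_trans (normr_ge0 _) (gC' k)).
    + by apply: is_cvg_geometric_series; rewrite ger0_norm ?invf_lt1 // ltr1n.
  have -> : v ^~ x = (fun k => u (s 0%N) x + series (fun k => g k x) k).
    apply/funext => k; rewrite /v indicE mem_set // mulr1 seriesEnat /=.
    by rewrite (telescope_sumr (fun k => u (s k) x)) // addrC subrK.
  by apply: is_cvgD => //; exact: is_cvg_cst.
pose w x := limn (v ^~ x).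
have vw x : v ^~ x @ \oo --> w x by exact: vcvg.
have mw : measurable_fun setT w by apply: (measurable_fun_cvg mv) => x _; exact: vw.
have main (e : R) : 0 < e -> exists N, forall n, (N <= n)%N -> (sqint (fun x => u n x - w x)%R <= e%:E)%E.
  move=> e0; have [N HN] := cauchy e e0; exists N => n Nn.
  pose h k x := ((u n x - v (k + N)%N x) ^+ 2)%:E.
  have mh k : measurable_fun setT (h k).
    by apply: measurable_sqr; exact: measurable_funB.
  have hw x : limn_einf (h ^~ x) = ((u n x - w x) ^+ 2)%:E.
    apply: (@cvg_limn_einf_sup _ _ _ _).1; apply: cvg_EFin; first exact: nearW.
    have vNw : v (k + N)%N x @[k --> \oo] --> w x.
      by rewrite (cvg_shiftn N (v ^~ x) _); exact: vw.
    have c : u n x - v (k + N)%N x @[k --> \oo] --> u n x - w x.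
      by apply: cvgB => //; exact: cvg_cst.
    exact: (cvgM c c).
  rewrite /sqint; under eq_integral do rewrite -hw.
  have h0 k x : [set: T] x -> (0 <= h k x)%E by move=> _; rewrite lee_fin sqr_ge0.
  have := @fatou _ T R mu setT measurableT h mh h0; move=> /le_trans; apply.
  have hI k : (\int[mu]_x h k x <= e%:E)%E.
    apply: le_trans (ltW (HN n (s (k + N)) Nn _)).
      rewrite le_eqVlt; apply/orP; left; apply/eqP.
      apply: ge0_ae_eq_integral => //.
      + by apply: measurable_sqr; exact: measurable_funB.
      + by move=> x _; rewrite lee_fin sqr_ge0.
      + by move=> x _; rewrite lee_fin sqr_ge0.
      exists (~` G); split=> //; first exact: measurableC.
      by move=> x /= nh Gx; apply: nh => _; rewrite /h /v indicE mem_set // mulr1.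
    by apply: leq_trans (sk _); exact: leq_addl.
  rewrite limn_einf_lim; apply: lime_le; first exact: is_cvg_einfs.
  apply: nearW => k; apply: le_trans (hI k).
  by apply: ereal_inf_lbound; exists k => /=.
exists w => //; apply/Lfun2P; split=> //.
have [N HN] := main 1 ltr01.
have -> : w = (fun x => u N x + - (u N x - w x)) by apply/funext => x /=; ring.
apply: le_lt_trans (sqintD _ _) _ => //.
  by apply: measurableT_comp => //; exact: measurable_funB.
rewrite sqintN; apply: lte_add_pinfty; rewrite lte_mul_pinfty //.
  by have /Lfun2P[] := uL N.
by apply: le_lt_trans (HN N (leqnn N)) (ltry _).
Qed.

End L2Complete.

Section RealL2.
Context {R : realType}.
Local Notation L2r := (Lfun (@lebesgue2 R) 2%:E).
Implicit Types f g h : R * R -> R.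

Definition rip f g : R := \int[lebesgue2]_z (f z * g z).

Lemma L2r_measurable f : f \in L2r -> measurable_fun [set: plane R] (f : plane R -> R).
Proof. by move=> /Lfun2P[]. Qed.

Lemma L2r_integrableM f g : f \in L2r -> g \in L2r ->
  (@lebesgue2 R).-integrable setT (EFin \o (fun z => f z * g z)).
Proof. by move=> fL gL; apply/Lfun1_integrable; exact: Lfun2_mul_Lfun1. Qed.

Lemma L2rZ (a : R) f : f \in L2r -> (fun z => a * f z) \in L2r.
Proof.
move=> fL; have : a \o* f \in L2r by apply: Lfun_scale; rewrite // ler1n.
by rewrite (_ : a \o* f = (fun z => a * f z)) //; apply/funext => z /=; rewrite mulrC.
Qed.

Lemma L2rD f g : f \in L2r -> g \in L2r -> (fun z => f z + g z) \in L2r.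
Proof.
move=> /Lfun2P[mf ff] /Lfun2P[mg fg]; apply/Lfun2P; split.
  exact: measurable_funD.
apply: le_lt_trans (sqintD _ mf mg) _.
by apply: lte_add_pinfty; rewrite lte_mul_pinfty.
Qed.

Lemma L2r0 : (fun=> 0) \in L2r.
Proof.
apply/Lfun2P; split; first exact: measurable_cst.
by rewrite /sqint; under eq_integral do rewrite expr0n; rewrite integral0 ltry.
Qed.

Lemma ripC f g : rip f g = rip g f.
Proof. by apply: eq_Rintegral => z _; rewrite mulrC. Qed.

Lemma ripDr f g h : f \in L2r -> g \in L2r -> h \in L2r ->
  rip f (fun z => g z + h z) = rip f g + rip f h.
Proof.
move=> fL gL hL; rewrite /rip -RintegralD //; try exact: L2r_integrableM.
by apply: eq_Rintegral => z _; rewrite mulrDr.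
Qed.

Lemma ripZr (a : R) f g : f \in L2r -> g \in L2r ->
  rip f (fun z => a * g z) = a * rip f g.
Proof.
move=> fL gL; rewrite /rip -RintegralZl //; last exact: L2r_integrableM.
by apply: eq_Rintegral => z _; rewrite mulrCA.
Qed.

Lemma rip_ge0 f : 0 <= rip f f.
Proof. by apply: Rintegral_ge0 => z _; rewrite -expr2 sqr_ge0. Qed.

Lemma sqint_rip f : f \in L2r -> sqint lebesgue2 f = (rip f f)%:E.
Proof.
move=> fL; rewrite /rip /Rintegral fineK.
  by apply: eq_integral => z _; rewrite expr2.
by apply: integrable_fin_num => //; exact: L2r_integrableM.
Qed.

Lemma decay_L2r f : measurable_fun [set: plane R] (f : plane R -> R) ->
  (exists M : R, forall z, `|f z| <= M * decay z) -> f \in L2r.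
Proof.
move=> mf fM; have [M ffM] := decayM fM fM.
apply/Lfun2P; split=> //.
have := integrable_decayM (measurable_funM mf mf) ffM.
move=> /integrableP[_]; apply: le_lt_trans; rewrite le_eqVlt; apply/orP; left; apply/eqP.
by apply: eq_integral => z _; rewrite gee0_abs /= ?expr2 // lee_fin -expr2 sqr_ge0.
Qed.

Lemma schwartz_L2r f : real_schwartz f -> f \in L2r.
Proof.
move=> fS; apply: decay_L2r; last exact: schwartz_decay0.
by apply: continuous_measurable_plane; exact: schwartz_continuous.
Qed.

End RealL2.

Section ScalarL2.
Context {R : realType}.
Local Notation L2r := (Lfun (@lebesgue2 R) 2%:E).
Implicit Types f g h : scalar_field R.

Definition re f : R * R -> R := fun z => complex.Re (f z).
Definition im f : R * R -> R := fun z => complex.Im (f z).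

Definition sL2 f := re f \in L2r /\ im f \in L2r.

(** The Hermitian product as four real integrals, so that linearity and integration by parts are
    inherited from [rip]. *)
Definition sinner f g : R[i] :=
  (rip (re f) (re g) + rip (im f) (im g)) +i* (rip (re f) (im g) - rip (im f) (re g)).

Lemma reD f g : re (f + g) = fun z => re f z + re g z.
Proof. by apply/funext => z; rewrite /re ReD. Qed.

Lemma imD f g : im (f + g) = fun z => im f z + im g z.
Proof. by apply/funext => z; rewrite /im ImD. Qed.

Lemma reZ (a : R[i]) f :
  re (a *: f) = fun z => complex.Re a * re f z + (- complex.Im a) * im f z.
Proof.
apply/funext => z; rewrite /re /im /=.
have -> : (a *: f) z = a * f z by [].
by case: a => a b; case: (f z) => c d /=; ring.
Qed.

Lemma imZ (a : R[i]) f :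
  im (a *: f) = fun z => complex.Re a * im f z + complex.Im a * re f z.
Proof.
apply/funext => z; rewrite /re /im /=.
have -> : (a *: f) z = a * f z by [].
by case: a => a b; case: (f z) => c d /=; ring.
Qed.

Lemma sL2_0 : sL2 0.
Proof. by split; exact: L2r0. Qed.

Lemma sL2D f g : sL2 f -> sL2 g -> sL2 (f + g).
Proof. by move=> [a b] [c d]; split; rewrite ?reD ?imD; apply: L2rD. Qed.

Lemma sL2Z a f : sL2 f -> sL2 (a *: f).
Proof. by move=> [c d]; split; rewrite ?reZ ?imZ; apply: L2rD; exact: L2rZ. Qed.

Lemma sinnerDr f g h : sL2 f -> sL2 g -> sL2 h ->
  sinner f (g + h) = sinner f g + sinner f h.
Proof.
move=> [f1 f2] [g1 g2] [h1 h2]; rewrite /sinner reD imD !ripDr //.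
by apply/eqP; rewrite eq_complex /=; apply/andP; split; apply/eqP; ring.
Qed.

Lemma sinnerZr a f g : sL2 f -> sL2 g -> sinner f (a *: g) = a * sinner f g.
Proof.
move=> [f1 f2] [g1 g2]; rewrite /sinner reZ imZ !ripDr ?ripZr //; try exact: L2rZ.
by case: a => a b; apply/eqP; rewrite eq_complex /=; apply/andP; split; apply/eqP; ring.
Qed.

Lemma sinnerJ f g : sinner g f = (sinner f g)^*%C.
Proof.
by rewrite /sinner /= (ripC (re g)) (ripC (im g)) (ripC (re g)) (ripC (im g)) opprB.
Qed.

Lemma sinner_ge0 f : 0 <= complex.Re (sinner f f).
Proof. by rewrite /= addr_ge0 // rip_ge0. Qed.

End ScalarL2.

Section SpinorL2.
Context {R : realType}.
Local Notation L2r := (Lfun (@lebesgue2 R) 2%:E).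
Implicit Types phi psi : spinor R.

Lemma componentD k phi psi : component k (phi + psi) = component k phi + component k psi.
Proof. by apply/funext => z; rewrite /component /= mxE. Qed.

Lemma componentZ k a psi : component k (a *: psi) = a *: component k psi.
Proof. by apply/funext => z; rewrite /component /= mxE. Qed.

Lemma component0 k : component k (0 : spinor R) = 0.
Proof. by apply/funext => z; rewrite /component /= mxE. Qed.

Lemma innerE phi psi : L2 phi -> L2 psi ->
  inner phi psi = \sum_k sinner (component k phi) (component k psi).
Proof.
move=> L1 L2_; rewrite /inner !big_ord_recl big_ord0 addr0.
set k0 : 'I_2 := ord0; set k1 : 'I_2 := lift ord0 ord0.
have [int int'] : (forall k, (@lebesgue2 R).-integrable setT (EFin \o (fun z =>
      re (component k phi) z * re (component k psi) z +
      im (component k phi) z * im (component k psi) z))) /\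
    (forall k, (@lebesgue2 R).-integrable setT (EFin \o (fun z =>
      re (component k phi) z * im (component k psi) z -
      im (component k phi) z * re (component k psi) z))).
  split=> k.
    have := integrableD measurableT (L2r_integrableM (L1 k).1 (L2_ k).1)
      (L2r_integrableM (L1 k).2 (L2_ k).2).
    by apply: eq_integrable.
  have := integrableB measurableT (L2r_integrableM (L1 k).1 (L2_ k).2)
    (L2r_integrableM (L1 k).2 (L2_ k).1).
  by apply: eq_integrable.
apply/eqP; rewrite eq_complex /=; apply/andP; split; apply/eqP.
- transitivity (\int[lebesgue2]_z (
    (re (component k0 phi) z * re (component k0 psi) z +
     im (component k0 phi) z * im (component k0 psi) z) +
    (re (component k1 phi) z * re (component k1 psi) z +
     im (component k1 phi) z * im (component k1 psi) z))).
    apply: eq_Rintegral => z _; rewrite !big_ord_recl big_ord0 addr0 ReD /re /im.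
    by congr (_ + _); case: (component _ phi z) => a b; case: (component _ psi z) => c d /=; ring.
  rewrite RintegralD //.
  by congr (_ + _); rewrite RintegralD //; apply: L2r_integrableM;
    first [exact: (L1 _).1|exact: (L1 _).2|exact: (L2_ _).1|exact: (L2_ _).2].
- transitivity (\int[lebesgue2]_z (
    (re (component k0 phi) z * im (component k0 psi) z -
     im (component k0 phi) z * re (component k0 psi) z) +
    (re (component k1 phi) z * im (component k1 psi) z -
     im (component k1 phi) z * re (component k1 psi) z))).
    apply: eq_Rintegral => z _; rewrite !big_ord_recl big_ord0 addr0 ImD /re /im.
    by congr (_ + _); case: (component _ phi z) => a b; case: (component _ psi z) => c d /=; ring.
  rewrite RintegralD //.
  by congr (_ + _); rewrite RintegralB //; apply: L2r_integrableM;
    first [exact: (L1 _).1|exact: (L1 _).2|exact: (L2_ _).1|exact: (L2_ _).2].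
Qed.

Lemma L2_0 : L2 (0 : spinor R).
Proof. by move=> k; rewrite component0; exact: sL2_0. Qed.

Lemma L2D phi psi : L2 phi -> L2 psi -> L2 (phi + psi).
Proof. by move=> L1 L2_ k; rewrite componentD; exact: (sL2D (L1 k) (L2_ k)). Qed.

Lemma L2Z a phi : L2 phi -> L2 (a *: phi).
Proof. by move=> L1 k; rewrite componentZ; exact: (sL2Z _ (L1 k)). Qed.

Lemma L2B phi psi : L2 phi -> L2 psi -> L2 (phi - psi).
Proof. by move=> L1 L2_; rewrite -scaleN1r; apply: L2D => //; exact: L2Z. Qed.

Lemma inner_norm_sqr psi : L2 psi -> complex.Re (inner psi psi) =
  \sum_k (rip (re (component k psi)) (re (component k psi)) +
          rip (im (component k psi)) (im (component k psi))).
Proof. by move=> L1; rewrite innerE // !big_ord_recl !big_ord0 !addr0 ReD. Qed.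

Lemma L2normE psi : L2 psi -> L2norm psi = (ip_norm inner psi)%:E.
Proof.
move=> L1; rewrite /L2norm unlock.
have -> : (\int[lebesgue2]_z (`|(EFin \o (spinor_abs \o psi)) z| `^ 2))%E =
    (complex.Re (inner psi psi))%:E.
  have S k := L2r_integrableM (L1 k).1 (L1 k).1.
  have S' k := L2r_integrableM (L1 k).2 (L1 k).2.
  rewrite inner_norm_sqr // !big_ord_recl big_ord0 addr0 !EFinD.
  set k0 : 'I_2 := ord0; set k1 : 'I_2 := lift ord0 ord0.
  rewrite -!sqint_rip ?(L1 _).1 ?(L1 _).2 // /sqint.
  have m1 k : measurable_fun setT (fun z => (re (component k psi) z ^+ 2)%:E).
    by apply: measurable_sqr; exact: L2r_measurable (L1 k).1.
  have m2 k : measurable_fun setT (fun z => (im (component k psi) z ^+ 2)%:E).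
    by apply: measurable_sqr; exact: L2r_measurable (L1 k).2.
  rewrite -!ge0_integralD //; try (by move=> z _; rewrite ?adde_ge0 // lee_fin sqr_ge0);
    try (by apply: emeasurable_funD; [exact: m1|exact: m2]); try exact: m1; try exact: m2.
  apply: eq_integral => z _ /=.
  rewrite powR_mulrn // real_normK ?num_real // sqr_sqrtr; last first.
    by apply: sumr_ge0 => k _; rewrite addr_ge0 // sqr_ge0.
  by rewrite !big_ord_recl big_ord0 addr0.
rewrite poweR12_sqrt //.
rewrite lee_fin inner_norm_sqr //.
by apply: sumr_ge0 => k _; rewrite addr_ge0 // rip_ge0.
Qed.

(** Completeness is that of the four real functions that make up a spinor. *)
Lemma L2_hilbert : hilbert (@L2 R) inner.
Proof.
split.
- exact: L2_0.
- exact: L2D.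
- exact: L2Z.
- move=> x y z Lx Ly Lz; have Lyz := L2D Ly Lz; rewrite !innerE // -big_split /=.
  by apply: eq_bigr => k _; rewrite componentD sinnerDr //; [exact: Lx|exact: Ly|exact: Lz].
- move=> a x y Lx Ly; have Lay := L2Z a Ly; rewrite !innerE // mulr_sumr.
  by apply: eq_bigr => k _; rewrite componentZ sinnerZr //; [exact: Lx|exact: Ly].
- move=> x y Lx Ly; rewrite !innerE // rmorph_sum.
  by apply: eq_bigr => k _; rewrite sinnerJ.
- move=> x Lx; rewrite inner_norm_sqr //.
  by apply: sumr_ge0 => k _; rewrite addr_ge0 // rip_ge0.
move=> u uL cauchy.
pose part (b : bool) (k : 'I_2) (psi : spinor R) := if b then re (component k psi) else im (component k psi).
have partL b k psi : L2 psi -> part b k psi \in L2r by case: b => /(_ k)[].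
have part_le b k psi : L2 psi -> rip (part b k psi) (part b k psi) <= ip_norm inner psi ^+ 2.
  move=> Lpsi; rewrite sqr_sqrtr; last first.
    by rewrite inner_norm_sqr // sumr_ge0 // => i _; rewrite addr_ge0 // rip_ge0.
  rewrite inner_norm_sqr // (bigD1 k) //= -[leLHS]addr0 lerD //.
    by rewrite /part; case: b; rewrite ?lerDl ?lerDr rip_ge0.
  by rewrite sumr_ge0 // => i _; rewrite addr_ge0 // rip_ge0.
have partB b k x y : part b k (x - y) = fun z => part b k x z - part b k y z.
  rewrite /part; case: b; apply/funext => z; rewrite /re /im /component /= !mxE.
    by rewrite ReD ReN.
  by rewrite ImD ImN.
have lim (bk : bool * 'I_2) : exists w, w \in L2r /\ forall e : R, 0 < e ->
    exists N, forall n, (N <= n)%N ->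
    (sqint lebesgue2 (fun z => part bk.1 bk.2 (u n) z - w z)%R <= e%:E)%E.
  have [n||w wL wlim] := @L2_complete _ _ _ (@lebesgue2 R) (fun n => part bk.1 bk.2 (u n)).
  - exact: partL.
  (* [sqint] is a squared norm, hence the Cauchy condition at [sqrt e]. *)
  - move=> e e0; have [|N HN] := cauchy (Num.sqrt e); first by rewrite sqrtr_gt0.
    exists N => m n Nm Nn; have LB := L2B (uL m) (uL n).
    rewrite -partB sqint_rip ?partL // lte_fin (le_lt_trans (part_le _ _ _ LB)) //.
    by rewrite -[ltRHS](sqr_sqrtr (ltW e0)) ltr_pXn2r ?nnegrE ?ip_norm_ge0 ?sqrtr_ge0 ?HN.
  - by exists w.
have [w Hw] := choice lim.
pose W : spinor R := fun z => \col_k (w (true, k) z +i* w (false, k) z).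
have partW b k : part b k W = w (b, k).
  by apply/funext => z; rewrite /part; case: b; rewrite /re /im /component /W mxE.
have WL : L2 W.
  move=> k; suff : part true k W \in L2r /\ part false k W \in L2r by [].
  by rewrite !partW; split; [exact: (Hw (true, k)).1|exact: (Hw (false, k)).1].
exists W => //.
apply/cvgr0Pnorm_le => e e0.
(* Four parts of squared norm at most [e ^ 2 / 8] each add up to at most [e ^ 2 / 2]. *)
have e4 : 0 < e ^+ 2 / 8 by rewrite divr_gt0 // exprn_gt0.
have e2 : 0 < e ^+ 2 by rewrite exprn_gt0.
have HN bk := (Hw bk).2 _ e4.
have [N {}HN] := choice HN.
exists (\max_(bk : bool * 'I_2) N bk)%N => // n /= Nn.
rewrite ger0_norm ?ip_norm_ge0 // -(@ler_pXn2r _ 2) ?nnegrE ?ip_norm_ge0 ?ltW //.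
have LB := L2B (uL n) WL.
rewrite sqr_sqrtr; last first.
  by rewrite inner_norm_sqr // sumr_ge0 // => i _; rewrite addr_ge0 // rip_ge0.
have le4 b k : rip (part b k (u n - W)) (part b k (u n - W)) <= e ^+ 2 / 8.
  rewrite -lee_fin -sqint_rip ?partL // partB partW.
  by apply: (HN (b, k)); apply: leq_trans Nn; exact: (leq_bigmax (b, k)).
rewrite inner_norm_sqr // !big_ord_recl big_ord0 addr0.
have := le4 true ord0; have := le4 false ord0.
have := le4 true (lift ord0 ord0); have := le4 false (lift ord0 ord0).
by rewrite /part /=; lra.
Qed.

End SpinorL2.

(** * The moment problem with Gaussian weight *)

Section Annihilator.
Context {R : realType}.
Variable G : R * R -> R.
Hypothesis mG : measurable_fun [set: plane R] (G : plane R -> R).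
Implicit Types phi psi : R * R -> R.

Local Notation measurable2 phi := (measurable_fun [set: plane R] (phi : plane R -> R)).
Local Notation integrable2 phi :=
  ((@lebesgue2 R).-integrable setT (fun z : plane R => ((phi : R * R -> R) z)%:E)).

(** The test functions orthogonal to [G]. Limits under the integral enlarge this class from
    monomials to cosines and sines of linear forms, then to indicators of quadrants. *)
Definition ann phi : Prop := (\int[lebesgue2]_z (phi z * G z)%:E = 0)%E.

Lemma ann_ext phi psi : phi =1 psi -> ann phi -> ann psi.
Proof. by move=> E; rewrite /ann => <-; apply: eq_integral => z _; rewrite E. Qed.

Lemma annZ (a : R) phi : integrable2 (fun z => phi z * G z) -> ann phi ->
  ann (fun z => a * phi z).
Proof.
move=> int A; rewrite /ann; under eq_integral do rewrite -mulrA EFinM.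
by rewrite integralZl // A mule0.
Qed.

Lemma annD phi psi : integrable2 (fun z => phi z * G z) ->
  integrable2 (fun z => psi z * G z) -> ann phi -> ann psi ->
  ann (fun z => phi z + psi z).
Proof.
move=> i1 i2 A1 A2; rewrite /ann; under eq_integral do rewrite mulrDl EFinD.
by rewrite integralD // A1 A2 adde0.
Qed.

Lemma ann_lim (phi_ : nat -> R * R -> R) phi (D : R * R -> R) :
  (forall n, measurable2 (phi_ n)) ->
  (forall z, phi_ n z @[n --> \oo] --> phi z) ->
  (forall n z, `|phi_ n z| <= D z) -> integrable2 (fun z => D z * `|G z|) ->
  (forall n, ann (phi_ n)) -> ann phi.
Proof.
move=> mphi lim dom iD A.
have := @dominated_cvg _ (plane R) R lebesgue2 setT measurableT
  (fun n z => (phi_ n z * G z)%:E) (fun z => (phi z * G z)%:E)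
  (fun z => (D z * `|G z|)%:E).
have -> : (fun n => \int[lebesgue2]_z (phi_ n z * G z)%:E)%E = cst 0%E.
  by apply/funext => n; exact: A.
move=> H; suff c : cst 0%E @ \oo --> (\int[lebesgue2]_x (phi x * G x)%:E)%E.
  by rewrite /ann -(cvg_lim (@ereal_hausdorff R) c) lim_cst.
apply: H => //.
- by move=> n; apply/measurable_EFinP; exact: measurable_funM.
- by move=> z _; apply: cvg_EFin; [exact: nearW|apply: cvgMl; exact: lim].
- by move=> n z _ /=; rewrite lee_fin normrM ler_wpM2r.
Qed.

Lemma bounded_integrable phi (C : R) : integrable2 G -> measurable2 phi ->
  (forall z, `|phi z| <= C) -> integrable2 (fun z => phi z * G z).
Proof.
move=> iG mphi bnd.
apply: (@le_integrable _ (plane R) R lebesgue2 setT measurableT _ (fun z => (C%:E * (G z)%:E)%E)).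
- by apply/measurable_EFinP; exact: measurable_funM.
- move=> z _ /=; rewrite lee_fin !normrM ler_wpM2r // (le_trans (bnd z)) //.
  exact: ler_norm.
- exact: integrableZl.
Qed.

Lemma ann_blim (phi_ : nat -> R * R -> R) phi (C : R) : integrable2 G ->
  (forall n, measurable2 (phi_ n)) ->
  (forall z, phi_ n z @[n --> \oo] --> phi z) ->
  (forall n z, `|phi_ n z| <= C) -> (forall n, ann (phi_ n)) -> ann phi.
Proof.
move=> iG mphi lim dom; apply: ann_lim mphi lim dom _.
have iN : integrable2 (fun z => `|G z|) by exact: integrable_norm iG.
have := integrableZl measurableT C iN.
by apply: eq_integrable.
Qed.

End Annihilator.

Section Moments.
Context {R : realType}.

Lemma pow_le_expR (x : R) n : 0 <= x -> x ^+ n <= n`!%:R * expR x.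
Proof.
case: n => [|n] x0; first by rewrite expr0 fact0 mul1r -expR0 ler_expR.
have f0 : 0 < n.+1`!%:R :> R by rewrite ltr0n fact_gt0.
rewrite -ler_pdivrMl // mulrC (le_trans _ (expR_ge1Dxn n x0)) //.
by rewrite lerDr.
Qed.

Definition gauss (p : R) (z : R * R) : R := expR (- (p / 2) * (z.1 ^+ 2 + z.2 ^+ 2)).

(** For suitable [a] and [b], a majorant of polynomials up to a constant, and of all partial sums of
    the cosine and sine series of a linear form. *)
Definition exp_norm (a b : R) (z : R * R) : R := expR (a * `|z.1| + b * `|z.2|).

(** Completing a square, [a |x| - p x^2 / 2 <= a^2 / p - p x^2 / 4]; then [exp (- p x^2 / 4)] is at
    most [1 / (1 + p x^2 / 4)], and the factor [1 + 4 / p] compares this with [1 / (1 + x^2)]. *)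
Lemma exp_quad_le (p a : R) : 0 < p ->
  exists C : R, forall x : R, expR (a * `|x|) * expR (- (p / 2) * x ^+ 2) <= C * (1 + x ^+ 2)^-1.
Proof.
move=> p0; exists (expR (a ^+ 2 / p) * (1 + 4 / p)) => x.
have x2 : 0 <= x ^+ 2 by exact: sqr_ge0.
have q0 : 0 < 1 + p / 4 * x ^+ 2.
  by rewrite ltr_pwDl // mulr_ge0 // ltW // divr_gt0.
rewrite -expRD (@le_trans _ _ (expR (a ^+ 2 / p - p / 4 * x ^+ 2))) //.
  rewrite ler_expR -subr_ge0.
  have -> : a ^+ 2 / p - p / 4 * x ^+ 2 - (a * `|x| + - (p / 2) * x ^+ 2) =
     p^-1 * (a - p / 2 * `|x|) ^+ 2.
    rewrite sqrrB exprMn real_normK ?num_real //; field; exact: lt0r_neq0.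
  by rewrite mulr_ge0 ?sqr_ge0 // invr_ge0 ltW.
rewrite expRD -[leRHS]mulrA ler_wpM2l ?expR_ge0 // expRN.
rewrite -[leRHS]invrK lef_pV2 ?posrE ?expR_gt0 //; last first.
  by rewrite invr_gt0 divr_gt0 ?ltr_pwDl // ltW ?divr_gt0.
rewrite (le_trans _ (expR_ge1Dx _)) // invf_div ler_pdivrMr ?ltr_pwDl ?ltW ?divr_gt0 //.
rewrite -subr_gt0.
have -> : (1 + p / 4 * x ^+ 2) * (1 + 4 / p) - (1 + x ^+ 2) = 4 / p + p / 4 * x ^+ 2.
  by field; exact: lt0r_neq0.
by rewrite ltr_pwDl ?divr_gt0 // mulr_ge0 // ltW // divr_gt0.
Qed.

Lemma exp_norm_gauss_decay (p a b : R) : 0 < p ->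
  exists C : R, forall z, `|exp_norm a b z * gauss p z| <= C * decay z.
Proof.
move=> p0; have [C HC] := exp_quad_le a p0; have [D HD] := exp_quad_le b p0.
exists (C * D) => z; rewrite ger0_norm ?mulr_ge0 ?expR_ge0 //.
have -> : exp_norm a b z * gauss p z =
    (expR (a * `|z.1|) * expR (- (p / 2) * z.1 ^+ 2)) *
    (expR (b * `|z.2|) * expR (- (p / 2) * z.2 ^+ 2)).
  by rewrite /exp_norm /gauss -!expRD; congr expR; ring.
rewrite /decay invfM [leRHS]mulrACA.
by apply: ler_pM => //; rewrite mulr_ge0 ?expR_ge0.
Qed.

End Moments.

(** * From monomials to trigonometric polynomials *)

Section MomentProblem.
Context {R : realType}.
Variable G : R * R -> R.
Hypothesis mG : measurable_fun [set: plane R] (G : plane R -> R).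

Local Notation measurable2 phi := (measurable_fun [set: plane R] (phi : plane R -> R)).
Local Notation integrable2 phi :=
  ((@lebesgue2 R).-integrable setT (fun z : plane R => ((phi : R * R -> R) z)%:E)).

Hypothesis GE : forall a b, integrable2 (fun z => exp_norm a b z * `|G z|).
Hypothesis Gmom : forall m n, ann G (fun z => z.1 ^+ m * z.2 ^+ n).

Lemma exp_norm_integrable phi (a b C : R) : measurable2 phi ->
  (forall z, `|phi z| <= C * exp_norm a b z) -> integrable2 (fun z => phi z * G z).
Proof.
move=> mphi bnd.
apply: (@le_integrable _ (plane R) R lebesgue2 setT measurableT _
  (fun z => (C%:E * (exp_norm a b z * `|G z|)%:E)%E)).
- by apply/measurable_EFinP; exact: measurable_funM.
- move=> z _ /=; rewrite lee_fin normrM mulrA normrM normr_id ler_wpM2r //.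
  by rewrite (le_trans (bnd z)) // ler_norm.
- exact: integrableZl.
Qed.

Lemma measurable_lin (xi eta : R) : measurable2 (fun z => xi * z.1 + eta * z.2).
Proof.
by apply: measurable_funD; apply: measurable_funM => //;
  first [exact: measurable_fst|exact: measurable_snd].
Qed.

Lemma lin_le_norm (xi eta : R) (z : R * R) :
  `|xi * z.1 + eta * z.2| <= `|xi| * `|z.1| + `|eta| * `|z.2|.
Proof. by rewrite (le_trans (ler_normD _ _)) // !normrM. Qed.

Lemma lin_pow_integrable (xi eta : R) k m n :
  integrable2 (fun z => ((xi * z.1 + eta * z.2) ^+ k * (z.1 ^+ m * z.2 ^+ n)) * G z).
Proof.
apply: (@exp_norm_integrable _ (`|xi| + 1) (`|eta| + 1) (k`!%:R * (m`!%:R * n`!%:R))).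
  apply: measurable_funM; first by apply: measurable_funX; exact: measurable_lin.
  by apply: measurable_funM; apply: measurable_funX;
    first [exact: measurable_fst|exact: measurable_snd].
move=> z; have -> : exp_norm (`|xi| + 1) (`|eta| + 1) z =
    expR (`|xi| * `|z.1| + `|eta| * `|z.2|) * (expR `|z.1| * expR `|z.2|).
  by rewrite /exp_norm -!expRD; congr expR; ring.
rewrite [leRHS](_ : _ = k`!%:R * expR (`|xi| * `|z.1| + `|eta| * `|z.2|) *
    ((m`!%:R * expR `|z.1|) * (n`!%:R * expR `|z.2|))); last by ring.
rewrite !normrM !normrX; apply: ler_pM.
- by rewrite exprn_ge0.
- by rewrite mulr_ge0 // exprn_ge0.
- rewrite (le_trans (pow_le_expR k (normr_ge0 _))) // ler_wpM2l // ler_expR.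
  exact: lin_le_norm.
- by apply: ler_pM; rewrite ?exprn_ge0 // pow_le_expR.
Qed.

(** The extra monomial lets the induction absorb one factor of the linear form at a time into the
    exponents, in place of the binomial theorem. *)
Lemma ann_lin_pow (xi eta : R) k m n :
  ann G (fun z => (xi * z.1 + eta * z.2) ^+ k * (z.1 ^+ m * z.2 ^+ n)).
Proof.
elim: k m n => [|k IH] m n.
  by apply: ann_ext (Gmom m n) => z; rewrite expr0 mul1r.
apply: (ann_ext (phi := fun z =>
  xi * ((xi * z.1 + eta * z.2) ^+ k * (z.1 ^+ m.+1 * z.2 ^+ n)) +
  eta * ((xi * z.1 + eta * z.2) ^+ k * (z.1 ^+ m * z.2 ^+ n.+1)))).
  by move=> z; rewrite !exprS; ring.
have int (a : R) m' n' : integrable2 (fun z =>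
    (a * ((xi * z.1 + eta * z.2) ^+ k * (z.1 ^+ m' * z.2 ^+ n'))) * G z).
  have := integrableZl measurableT a (lin_pow_integrable xi eta k m' n').
  by apply: eq_integrable => // z _ /=; rewrite -EFinM; congr EFin; ring.
by apply: annD => //; apply: annZ => //; exact: lin_pow_integrable.
Qed.

(** Coefficients below [1 / k!] keep every partial sum at [t] under [exp |t|], a majorant that is
    integrable against [G]; so the series may be integrated term by term. *)
Lemma ann_series (xi eta : R) (c : nat -> R) (f : R -> R) :
  (forall k, `|c k| <= k`!%:R^-1) ->
  (forall t, series (fun k => c k * t ^+ k) n @[n --> \oo] --> f t) ->
  ann G (fun z => f (xi * z.1 + eta * z.2)).
Proof.
move=> cle cf.
pose S n z := series (fun k => c k * (xi * z.1 + eta * z.2) ^+ k) n.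
have mS n : measurable2 (S n).
  rewrite /S /series /=; apply: measurable_sum => k.
  by apply: measurable_funM => //; apply: measurable_funX; exact: measurable_lin.
have Sle n z : `|S n z| <= exp_norm `|xi| `|eta| z.
  apply: (@le_trans _ _ (expR `|xi * z.1 + eta * z.2|)); last first.
    by rewrite ler_expR lin_le_norm.
  rewrite /S; set t := xi * z.1 + eta * z.2.
  apply: (@le_trans _ _ (series (exp_coeff `|t|) n)).
    rewrite /series /= (le_trans (ler_norm_sum _ _ _)) //; apply: ler_sum => k _.
    by rewrite /exp_coeff /= normrM normrX mulrC ler_wpM2l.
  apply: nondecreasing_cvgn_le; last exact: is_cvg_series_exp_coeff.
  apply/nondecreasing_seqP => k; rewrite /series /= big_nat_recr //= lerDl.
  by rewrite /exp_coeff /= divr_ge0.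
apply: (@ann_lim _ _ mG S _ (exp_norm `|xi| `|eta|)) => //.
  by move=> z; exact: cf.
elim=> [|n IH].
  rewrite /ann (eq_integral (cst 0%E)) ?integral0 // => z _.
  by rewrite /S /series /= big_nil mul0r.
apply: (ann_ext (phi := fun z => S n z +
   c n * ((xi * z.1 + eta * z.2) ^+ n * (z.1 ^+ 0 * z.2 ^+ 0)))).
  by move=> z; rewrite /S /series /= big_nat_recr //= !expr0 !mulr1.
apply: annD => //.
- apply: (@exp_norm_integrable _ `|xi| `|eta| 1) => // z.
  by rewrite mul1r.
- have := integrableZl measurableT (c n) (lin_pow_integrable xi eta n 0 0).
  by apply: eq_integrable => // z _ /=; rewrite -EFinM; congr EFin; ring.
- by apply: annZ; [exact: lin_pow_integrable|exact: ann_lin_pow].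
Qed.

Lemma ann_cos xi eta : ann G (fun z => cos (xi * z.1 + eta * z.2)).
Proof.
apply: (@ann_series _ _ (fun k => (~~ odd k)%:R * (-1) ^+ k./2 * (k`!%:R)^-1)).
  move=> k; rewrite !normrM normrX normrN1 expr1n mulr1 normfV !normr_nat.
  by case: odd; rewrite ?mul0r ?mul1r ?invr_ge0.
move=> t; rewrite -cos_coeffE unlock; exact: is_cvg_series_cos_coeff.
Qed.

Lemma ann_sin xi eta : ann G (fun z => sin (xi * z.1 + eta * z.2)).
Proof.
apply: (@ann_series _ _ (fun k => (odd k)%:R * (-1) ^+ k.-1./2 * (k`!%:R)^-1)).
  move=> k; rewrite !normrM normrX normrN1 expr1n mulr1 normfV !normr_nat.
  by case: odd; rewrite ?mul0r ?mul1r ?invr_ge0.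
move=> t; rewrite -sin_coeffE unlock; exact: is_cvg_series_sin_coeff.
Qed.

(** Trigonometric polynomials as a mere linear span. The product-to-sum formulas make it an algebra,
    so that [threshold] can be applied to its members. *)
Inductive trig : (R * R -> R) -> Prop :=
| trig_cos a b : trig (fun z => cos (a * z.1 + b * z.2))
| trig_sin a b : trig (fun z => sin (a * z.1 + b * z.2))
| trig_add f g : trig f -> trig g -> trig (fun z => f z + g z)
| trig_scale a f : trig f -> trig (fun z => a * f z).

Lemma trig_ext f g : f =1 g -> trig f -> trig g.
Proof. by move=> /funext ->. Qed.

Lemma trig_cst (c : R) : trig (fun=> c).
Proof.
apply: trig_ext (trig_scale c (trig_cos 0 0)) => z.
by rewrite !mul0r addr0 cos0 mulr1.
Qed.

Lemma cosMcos (u v : R) : cos u * cos v = 2^-1 * (cos (u - v) + cos (u + v)).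
Proof. by rewrite cosB cosD; field. Qed.

Lemma cosMsin (u v : R) : cos u * sin v = 2^-1 * (sin (u + v) + -1 * sin (u - v)).
Proof. by rewrite sinB sinD; field. Qed.

Lemma sinMcos (u v : R) : sin u * cos v = 2^-1 * (sin (u + v) + sin (u - v)).
Proof. by rewrite sinB sinD; field. Qed.

Lemma sinMsin (u v : R) : sin u * sin v = 2^-1 * (cos (u - v) + -1 * cos (u + v)).
Proof. by rewrite cosB cosD; field. Qed.

Lemma trig_mul f g : trig f -> trig g -> trig (fun z => f z * g z).
Proof.
have ce (u : R * R) (a b a' b' : R) : (a * u.1 + b * u.2) - (a' * u.1 + b' * u.2) =
    (a - a') * u.1 + (b - b') * u.2 by ring.
have ce' (u : R * R) (a b a' b' : R) : (a * u.1 + b * u.2) + (a' * u.1 + b' * u.2) =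
    (a + a') * u.1 + (b + b') * u.2 by ring.
move=> tf; elim: tf g => [a b|a b|f1 f2 _ IH1 _ IH2|c f1 _ IH1] g tg.
- elim: tg => [a' b'|a' b'|g1 g2 _ J1 _ J2|c g1 _ J1].
  + apply: trig_ext (trig_scale 2^-1 (trig_add (trig_cos (a - a') (b - b'))
                                               (trig_cos (a + a') (b + b')))) => z.
    by rewrite -(ce z) -(ce' z) ?cosMcos ?sinMsin ?cosMsin ?sinMcos.
  + apply: trig_ext (trig_scale 2^-1 (trig_add (trig_sin (a + a') (b + b'))
        (trig_scale (-1) (trig_sin (a - a') (b - b'))))) => z.
    by rewrite -(ce z) -(ce' z) ?cosMcos ?sinMsin ?cosMsin ?sinMcos.
  + by apply: trig_ext (trig_add J1 J2) => z; rewrite mulrDr.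
  + by apply: trig_ext (trig_scale c J1) => z; rewrite mulrCA.
- elim: tg => [a' b'|a' b'|g1 g2 _ J1 _ J2|c g1 _ J1].
  + apply: trig_ext (trig_scale 2^-1 (trig_add (trig_sin (a + a') (b + b'))
                                               (trig_sin (a - a') (b - b')))) => z.
    by rewrite -(ce z) -(ce' z) ?cosMcos ?sinMsin ?cosMsin ?sinMcos.
  + apply: trig_ext (trig_scale 2^-1 (trig_add (trig_cos (a - a') (b - b'))
        (trig_scale (-1) (trig_cos (a + a') (b + b'))))) => z.
    by rewrite -(ce z) -(ce' z) ?cosMcos ?sinMsin ?cosMsin ?sinMcos.
  + by apply: trig_ext (trig_add J1 J2) => z; rewrite mulrDr.
  + by apply: trig_ext (trig_scale c J1) => z; rewrite mulrCA.
- by apply: trig_ext (trig_add (IH1 g tg) (IH2 g tg)) => z; rewrite mulrDl.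
- by apply: trig_ext (trig_scale c (IH1 g tg)) => z; rewrite mulrA.
Qed.

Lemma trig_pow f n : trig f -> trig (fun z => f z ^+ n).
Proof.
move=> tf; elim: n => [|n IH].
  by apply: trig_ext (trig_cst 1) => z; rewrite expr0.
by apply: trig_ext (trig_mul tf IH) => z; rewrite exprS.
Qed.

Lemma trig_measurable f : trig f -> measurable2 f.
Proof.
elim=> [a b|a b|f1 f2 _ H1 _ H2|c f1 _ H1].
- by apply: measurableT_comp (measurable_lin a b); apply: continuous_measurable_fun; exact: continuous_cos.
- by apply: measurableT_comp (measurable_lin a b); apply: continuous_measurable_fun; exact: continuous_sin.
- exact: measurable_funD.
- exact: measurable_funM.
Qed.

Lemma trig_bounded f : trig f -> exists C : R, forall z, `|f z| <= C.
Proof.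
elim=> [a b|a b|f1 f2 _ [C1 H1] _ [C2 H2]|c f1 _ [C H]].
- by exists 1 => z; exact: cos_max.
- by exists 1 => z; exact: sin_max.
- by exists (C1 + C2) => z; rewrite (le_trans (ler_normD _ _)) // lerD.
- by exists (`|c| * C) => z; rewrite normrM ler_wpM2l.
Qed.

Lemma moment_integrable : integrable2 G.
Proof.
apply: (@le_integrable _ (plane R) R lebesgue2 setT measurableT _
  (fun z => (exp_norm 0 0 z * `|G z|)%:E)) => //.
  exact/measurable_EFinP.
by move=> z _; rewrite /exp_norm !mul0r addr0 expR0 mul1r /= normr_id.
Qed.
Local Notation iG := moment_integrable.

Lemma trig_ann f : trig f -> ann G f.
Proof.
have int g : trig g -> integrable2 (fun z => g z * G z).
  move=> tg; have [C HC] := trig_bounded tg.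
  exact: (bounded_integrable mG iG (trig_measurable tg) HC).
elim=> [a b|a b|f1 f2 t1 H1 t2 H2|c f1 t1 H1].
- exact: ann_cos.
- exact: ann_sin.
- by apply: annD => //; exact: int.
- by apply: annZ => //; exact: int.
Qed.
End MomentProblem.

(** * Polynomial approximation of a step function *)

Section Threshold.
Context {R : realType}.

Lemma bernoulli_ge (x : R) n : 0 <= x -> 1 + n%:R * x <= (1 + x) ^+ n.
Proof.
move=> x0; elim: n => [|n IH]; first by rewrite expr0 mul0r addr0.
rewrite exprS; apply: (@le_trans _ _ ((1 + x) * (1 + n%:R * x))).
  rewrite -natr1 -subr_ge0.
  have -> : (1 + x) * (1 + n%:R * x) - (1 + (n%:R + 1) * x) = n%:R * x ^+ 2 by ring.
  by rewrite mulr_ge0 // sqr_ge0.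
by rewrite ler_wpM2l // addr_ge0.
Qed.

Lemma bernoulli_le (x : R) n : 0 <= x <= 1 -> 1 - n%:R * x <= (1 - x) ^+ n.
Proof.
move=> /andP[x0 x1]; elim: n => [|n IH]; first by rewrite expr0 mul0r subr0.
rewrite exprS; apply: (@le_trans _ _ ((1 - x) * (1 - n%:R * x))).
  rewrite -natr1 -subr_ge0.
  have -> : (1 - x) * (1 - n%:R * x) - (1 - (n%:R + 1) * x) = n%:R * x ^+ 2 by ring.
  by rewrite mulr_ge0 // sqr_ge0.
by rewrite ler_wpM2l // subr_ge0.
Qed.

(** With [w = (1 + z) / 2] one has [z <= w ^ 2], so [n z ^ n <= (n w ^ n) w ^ n], and Bernoulli's
    inequality for [1 / w] bounds [n w ^ n]. *)
Lemma cvg_natM_pow (z : R) : 0 <= z < 1 -> n%:R * z ^+ n @[n --> \oo] --> 0.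
Proof.
move=> /andP[z0 z1]; set w := (1 + z) / 2.
have w0 : 0 < w by rewrite divr_gt0 // ltr_pwDl.
have w1 : w < 1 by rewrite /w; lra.
have zw : z <= w ^+ 2.
  rewrite -subr_ge0 (_ : _ - z = ((1 - z) / 2) ^+ 2) ?sqr_ge0 //.
  by rewrite /w; field.
pose C := (w^-1 - 1)^-1.
have C0 : 0 < w^-1 - 1 by rewrite subr_gt0 invf_gt1.
apply: (@squeeze_cvg0 _ _ (geometric C w)).
  move=> n; rewrite mulr_ge0 ?exprn_ge0 //=.
  apply: (@le_trans _ _ (n%:R * w ^+ n * w ^+ n)).
    rewrite -mulrA ler_wpM2l // -exprD addnn -muln2 mulnC exprM.
    by rewrite lerXn2r // nnegrE ?sqr_ge0.
  apply: ler_wpM2r; first by rewrite exprn_ge0 // ltW.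
  rewrite /C -[leRHS]mul1r ler_pdivlMr //.
  have := bernoulli_ge n (ltW C0).
  rewrite (_ : 1 + (w^-1 - 1) = w^-1) ?exprVn; last by ring.
  move=> B.
  have wn : 0 < w ^+ n by rewrite exprn_gt0.
  rewrite -mulrA mulrCA mulrC -ler_pdivlMr // mul1r.
  by apply: le_trans B; rewrite lerDr.
by apply: cvg_geometric; rewrite gtr0_norm.
Qed.

(* The polynomials of the Stone-Weierstrass proof: on [0, 1] they tend to the indicator
   of [0, 1/2); the exponent n 2^n rather than 2^n gives the limit 0 at t = 1/2 too. *)
Definition threshold n (t : R) : R := (1 - t ^+ n) ^+ (n * 2 ^ n).

Lemma threshold01 n t : 0 <= t <= 1 -> 0 <= threshold n t <= 1.
Proof.
move=> /andP[t0 t1]; have t1' : t ^+ n <= 1 by rewrite exprn_ile1.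
rewrite /threshold exprn_ge0 ?subr_ge0 //=.
by rewrite exprn_ile1 ?subr_ge0 // gerBl exprn_ge0.
Qed.

Lemma cvg_threshold (t : R) : 0 <= t <= 1 ->
  threshold n t @[n --> \oo] --> ((t < 2^-1)%R%:R : R).
Proof.
move=> /andP[t0 t1].
have [tlt|tge] := ltP t 2^-1; last first.
  (* Put [u = t ^ n] and [N = n 2 ^ n]. Then [N u >= n], and [(1 - u) ^ N (1 + u) ^ N <= 1], so
     Bernoulli's inequality bounds the threshold by [1 / n.+1]. *)
  apply: (@squeeze_cvg0 _ _ (fun n => n.+1%:R^-1)); last exact: cvg_harmonic.
  move=> n; have /andP[-> _] /= := @threshold01 n t (introT andP (conj t0 t1)).
  set u := t ^+ n.
  have u0 : 0 <= u by rewrite exprn_ge0.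
  have u1 : u <= 1 by rewrite exprn_ile1.
  have ub : 1 <= u * 2 ^+ n.
    rewrite /u -exprMn exprn_ege1 // -ler_pdivrMr // mul1r //.
  rewrite /threshold -/u -[leRHS]mul1r ler_pdivlMr //.
  apply: (@le_trans _ _ ((1 - u) ^+ (n * 2 ^ n) * (1 + u) ^+ (n * 2 ^ n))).
    rewrite ler_wpM2l ?exprn_ge0 ?subr_ge0 //.
    apply: le_trans (bernoulli_ge _ u0).
    rewrite natrM natrX -natr1 addrC lerD2l -mulrA [_ * u]mulrC -[leLHS]mulr1.
    by rewrite ler_wpM2l.
  rewrite -exprMn exprn_ile1 //.
    by rewrite mulr_ge0 ?subr_ge0 // addr_ge0.
  by rewrite -subr_sqr expr1n gerBl sqr_ge0.
(* Bernoulli's inequality gives [1 - threshold n t <= n (2 t) ^ n], a null sequence since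
   [2 t < 1]. *)
have z01 : 0 <= 2 * t < 1 by rewrite mulr_ge0 //= mulrC -ltr_pdivlMr // mul1r.
have -> : threshold^~ t = (fun n => 1 - (1 - threshold n t)).
  by apply/funext => n; rewrite subKr.
rewrite -[X in _ --> X]subr0; apply: cvgB; first exact: cvg_cst.
apply: squeeze_cvg0 (cvg_natM_pow z01) => n.
have /andP[_ h1] := @threshold01 n t (introT andP (conj t0 t1)).
rewrite subr_ge0 h1 lerBlDl -lerBlDr /=.
have tn : 0 <= t ^+ n <= 1 by rewrite exprn_ge0 ?exprn_ile1.
have := bernoulli_le (n * 2 ^ n) tn; rewrite natrM natrX.
by rewrite exprMn mulrA.
Qed.

End Threshold.

(** * Dynkin systems of sets over which the integral vanishes *)

Section NullPreimages.
Local Open Scope ereal_scope.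
Context d (T : measurableType d) (R : realType) (mu : {measure set T -> \bar R}).

(** The sets [A] in question form a Dynkin system, complements being handled by the vanishing over
    [E]. The set [E] carries a condition on one coordinate while the other one varies. *)
Lemma null_preimage d' (T' : measurableType d') (f : T -> T') (g : T -> \bar R)
    (E : set T) (GG : set (set T')) :
  measurable_fun setT f -> mu.-integrable setT g -> measurable E ->
  @measurable _ T' = <<s GG >> -> setI_closed GG ->
  \int[mu]_(z in E) g z = 0 ->
  (forall A, GG A -> \int[mu]_(z in E `&` f @^-1` A) g z = 0) ->
  forall A, measurable A -> \int[mu]_(z in E `&` f @^-1` A) g z = 0.
Proof.
move=> mf ig mE mGG IGG E0 GG0 A; rewrite mGG.
have mEf S : measurable S -> measurable (E `&` f @^-1` S).
  by move=> mS; apply: measurableI => //; rewrite -[_ @^-1` _]setTI; exact: mf.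
have ig' S : measurable S -> mu.-integrable S g by move=> mS; exact: integrableS ig.
move: A; apply: (@dynkin_induction _ T' GG
  (fun A => \int[mu]_(z in E `&` f @^-1` A) g z = 0) mGG IGG) => //.
- by rewrite preimage_setT setIT.
- move=> S mS S0.
  have := @integral_setU _ _ _ mu (E `&` f @^-1` S) (E `&` f @^-1` (~` S)) g.
  rewrite -setIUr -preimage_setU setUv preimage_setT setIT E0 S0 add0e.
  move=> -> //; try exact: mEf; first by apply: mEf; exact: measurableC.
    exact: measurable_int (ig' _ mE).
  by rewrite preimage_setC; apply/disj_setPS => x [[_ ?] [_ ?]].
move=> F mF tF F0; rewrite preimage_bigcup setI_bigcupr integral_bigcup.
- by apply: eseries0 => k _ _; exact: F0.
- apply/trivIsetP => i j _ _ ij; rewrite -subset0 => x [[_ Fi] [_ Fj]].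
  have /trivIsetP/(_ i j I I ij) FF := tF.
  by have : (F i `&` F j) (f x) by []; rewrite FF.
- by move=> k; exact: mEf.
- by apply: ig'; apply: bigcupT_measurable => k; exact: mEf.
Qed.

End NullPreimages.

(** * From trigonometric polynomials to measurable sets *)

Section MomentTotality.
Context {R : realType}.
Variable G : R * R -> R.
Hypothesis mG : measurable_fun [set: plane R] (G : plane R -> R).

Local Notation measurable2 phi := (measurable_fun [set: plane R] (phi : plane R -> R)).
Local Notation integrable2 phi :=
  ((@lebesgue2 R).-integrable setT (fun z : plane R => ((phi : R * R -> R) z)%:E)).

Hypothesis GE : forall a b, integrable2 (fun z => exp_norm a b z * `|G z|).
Hypothesis Gmom : forall m n, ann G (fun z => z.1 ^+ m * z.2 ^+ n).

Let iG : integrable2 G. Proof. exact: moment_integrable. Qed.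

(** Applied to a trigonometric polynomial with values in [[0, 1]], [threshold n] yields another one,
    and these tend boundedly to the indicator of [h < 1 / 2]. *)
Lemma ann_half (h1 h2 : R * R -> R) : trig h1 -> trig h2 ->
  (forall z, 0 <= h1 z <= 1) -> (forall z, 0 <= h2 z <= 1) ->
  ann G (fun z => (h1 z < 2^-1)%R%:R * (h2 z < 2^-1)%R%:R).
Proof.
move=> t1 t2 b1 b2.
have tq (h : R * R -> R) n : trig h -> trig (fun z => threshold n (h z)).
  move=> th; apply: trig_pow.
  apply: trig_ext (trig_add (trig_cst 1) (trig_scale (-1) (trig_pow n th))) => z.
  by rewrite mulN1r.
have tqq n := trig_mul (tq h1 n t1) (tq h2 n t2).
apply: (@ann_blim _ _ mG (fun n z => threshold n (h1 z) * threshold n (h2 z)) _ 1) => //.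
- by move=> n; exact: trig_measurable.
- by move=> z; apply: cvgM; exact: cvg_threshold.
- move=> n z; have /andP[p0 p1] := threshold01 n (b1 z).
  have /andP[q0 q1] := threshold01 n (b2 z).
  by rewrite ger0_norm ?mulr_ge0 // -[leRHS]mulr1 ler_pM.
- by move=> n; exact: trig_ann.
Qed.

(* For k large, [ramp b alpha k z < 1/2] exactly when the coordinate is below alpha. *)
Definition ramp (b : bool) (alpha : R) (k : nat) (z : R * R) : R :=
  (1 + sin (((if b then z.2 else z.1) - alpha) / k.+1%:R)) / 2.

Lemma trig_ramp b alpha k : trig (ramp b alpha k).
Proof.
set c : R := k.+1%:R^-1.
pose a1 := if b then 0 else c; pose a2 := if b then c else 0.
have E (z : R * R) : a1 * z.1 + a2 * z.2 - alpha * c = ((if b then z.2 else z.1) - alpha) * c.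
  by rewrite /a1 /a2; clear a1 a2; case: b; ring.
apply: trig_ext (trig_add (trig_cst 2^-1) (trig_scale 2^-1
  (trig_add (trig_scale (cos (alpha * c)) (trig_sin a1 a2))
            (trig_scale (- sin (alpha * c)) (trig_cos a1 a2))))) => z.
by rewrite /ramp -E sinB; field.
Qed.

Lemma ramp01 b alpha k z : 0 <= ramp b alpha k z <= 1.
Proof.
rewrite /ramp; set t := _ / k.+1%:R.
have := sin_le1 t; have := sin_geN1 t.
by move=> h1 h2; apply/andP; split; lra.
Qed.

(** Once [k.+1 * pi] exceeds the distance from the coordinate to [alpha], the argument lies in
    []-pi, pi[], where the sine has the sign of its argument. The sequence is thus eventually
    constant. *)
Lemma ramp_lim b alpha z :
  ((ramp b alpha k z < 2^-1)%R%:R : R) @[k --> \oo] -->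
  (((if b then z.2 else z.1) < alpha)%R%:R : R).
Proof.
apply: cvg_near_cst; set x := if b then _ else _.
near=> k; congr (nat_of_bool _)%:R.
have k0 : 0 < k.+1%:R :> R by [].
rewrite /ramp -/x; set t := (x - alpha) / k.+1%:R.
have -> : ((1 + sin t) / 2 < 2^-1) = (sin t < 0).
  by rewrite -subr_lt0 (_ : _ - _ = sin t / 2) ?pmulr_llt0 //; field.
have tpi : `|t| < pi.
  rewrite /t normrM normfV [X in _ / X]gtr0_norm // ltr_pdivrMr //.
  rewrite mulrC -ltr_pdivrMr ?pi_gt0 //.
  apply: (@lt_trans _ _ k%:R); last by rewrite ltr_nat.
  by near: k; exact: nbhs_infty_gtr.
move: tpi; rewrite ltr_norml => /andP[tp1 tp2].
have [xa|xa|xa] := ltgtP x alpha.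
- have t0 : t < 0 by rewrite /t pmulr_llt0 ?invr_gt0 // subr_lt0.
  rewrite -oppr_gt0 -sinN; apply: sin_gt0_pi.
  by rewrite oppr_gt0 t0 ltrNl.
- have t0 : 0 < t by rewrite /t divr_gt0 // subr_gt0.
  by apply/negbTE; rewrite -leNgt ltW // sin_gt0_pi // t0.
- by rewrite /t xa subrr mul0r sin0 ltxx.
Unshelve. all: by end_near. Qed.

Lemma mem_ray (T : Type) (h : T -> R) (a : R) (z : T) :
  (z \in h @^-1` `]-oo, a[) = (h z < a).
Proof. by apply/idP/idP; rewrite inE /= in_itv. Qed.

Lemma measurable_lt_ind (h : R * R -> R) (a : R) : measurable2 h ->
  measurable2 (fun z => (h z < a)%R%:R).
Proof.
move=> mh; have -> : (fun z => ((h z < a)%R)%:R) = \1_(h @^-1` `]-oo, a[) :> (R * R -> R).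
  by apply/funext => z; rewrite indicE mem_ray.
apply: measurable_indic.
by rewrite -[_ @^-1` _]setTI; apply: (mh measurableT); exact: measurable_itv.
Qed.

Lemma ind_bound (b c : bool) : `|(b%:R : R) * c%:R| <= 1.
Proof. by case: b; case: c; rewrite ?mulr0 ?mul0r ?mulr1 ?normr0 ?normr1. Qed.

(** One ramp goes to its limit while [h] is kept: [h] is the ramp of the other coordinate, or a
    constant when a single inequality is wanted. *)
Lemma ann_half_plane (h : R * R -> R) b alpha : trig h -> (forall z, 0 <= h z <= 1) ->
  ann G (fun z => ((if b then z.2 else z.1) < alpha)%R%:R * (h z < 2^-1)%R%:R).
Proof.
move=> th h01.
apply: (@ann_blim _ _ mG
  (fun k z => (ramp b alpha k z < 2^-1)%R%:R * (h z < 2^-1)%R%:R) _ 1) => //.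
- by move=> n; apply: measurable_funM; apply: measurable_lt_ind; apply: trig_measurable => //;
  exact: trig_ramp.
- by move=> z; apply: cvgMl; exact: ramp_lim.
- by move=> n z; exact: ind_bound.
- by move=> n; apply: ann_half => //; [exact: trig_ramp|exact: ramp01].
Qed.

Lemma ann_quadrant alpha beta :
  ann G (fun z => (z.1 < alpha)%R%:R * (z.2 < beta)%R%:R).
Proof.
apply: (@ann_ext _ _ (fun z => ((if true then z.2 else z.1) < beta)%R%:R * (z.1 < alpha)%R%:R)).
  by move=> z; rewrite mulrC.
apply: (@ann_blim _ _ mG
  (fun k z => (ramp true beta k z < 2^-1)%R%:R * (z.1 < alpha)%R%:R) _ 1) => //.
- move=> n; apply: measurable_funM; apply: measurable_lt_ind; last exact: measurable_fst.
  by apply: trig_measurable; exact: trig_ramp.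
- by move=> z; apply: cvgMl; exact: ramp_lim.
- by move=> n z; exact: ind_bound.
- move=> n; apply: ann_ext (ann_half_plane false alpha (trig_ramp true beta n) _) => z.
    by rewrite mulrC.
  exact: ramp01.
Qed.

Lemma ann_strip b alpha : ann G (fun z => ((if b then z.2 else z.1) < alpha)%R%:R).
Proof.
apply: ann_ext (ann_half_plane b alpha (trig_cst 0) _) => z /=; last by rewrite lexx ler01.
by rewrite invr_gt0 ltr0n mulr1.
Qed.

Lemma ann_indic (S : set (R * R)) (phi : R * R -> R) :
  (forall z, phi z = (z \in S)%:R) -> ann G phi ->
  (\int[lebesgue2]_(z in S) (G z)%:E = 0)%E.
Proof.
move=> phiE; rewrite /ann => A; rewrite integral_mkcond -[RHS]A.
apply: eq_integral => z _; rewrite phiE patchE.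
by case: ifP => _; rewrite ?mul1r ?mul0r.
Qed.

(** Open rays are a pi-system generating the Borel sets of the line. Quadrants extend to rectangles
    one coordinate at a time, half-planes and strips supplying the vanishing over [E] that
    [null_preimage] asks for; rectangles are then a pi-system for the product. *)
Lemma moment_null (S : set (plane R)) : measurable S ->
  (\int[lebesgue2]_(z in S) (G z)%:E = 0)%E.
Proof.
have IG : setI_closed (@RGenInftyO.G R).
  move=> _ _ [x ->] [y ->]; exists (Num.min x y).
  by apply/seteqP; split=> t /=; rewrite !in_itv /= lt_min => /andP.
have int0 : (\int[lebesgue2]_z (G z)%:E = 0)%E.
  have := trig_ann mG GE Gmom (trig_cst 1); rewrite /ann.
  by under eq_integral do rewrite mul1r.
have m1 : measurable_fun setT (fst : plane R -> measurableTypeR R) := measurable_fst.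
have m2 : measurable_fun setT (snd : plane R -> measurableTypeR R) := measurable_snd.
pose H (beta : R) : set (plane R) := snd @^-1` `]-oo, beta[.
have mH beta : measurable (H beta).
  by rewrite /H -[_ @^-1` _]setTI; apply: m2 => //; exact: measurable_itv.
have strip (A : set (measurableTypeR R)) : measurable A ->
    (\int[lebesgue2]_(z in setT `&` fst @^-1` A) (G z)%:E = 0)%E.
  apply: (null_preimage m1 iG measurableT (RGenInftyO.measurableE R) IG) => //.
  move=> _ [x ->]; rewrite setTI; apply: ann_indic (ann_strip false x) => z /=.
  by rewrite mem_ray.
have half (beta : R) (A : set (measurableTypeR R)) : measurable A ->
    (\int[lebesgue2]_(z in H beta `&` fst @^-1` A) (G z)%:E = 0)%E.
  apply: (null_preimage m1 iG (mH beta) (RGenInftyO.measurableE R) IG).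
    apply: ann_indic (ann_strip true beta) => z /=.
    by rewrite mem_ray.
  move=> _ [x ->]; apply: ann_indic (ann_quadrant x beta) => z /=.
  rewrite in_setI !mem_ray andbC.
  by case: (z.1 < x); case: (z.2 < beta); rewrite ?mulr1 ?mulr0.
have rect (A B : set (measurableTypeR R)) : measurable A -> measurable B ->
    (\int[lebesgue2]_(z in fst @^-1` A `&` snd @^-1` B) (G z)%:E = 0)%E.
  move=> mA; have mA' : measurable (fst @^-1` A : set (plane R)).
    by rewrite -[_ @^-1` _]setTI; exact: m1.
  apply: (null_preimage m2 iG mA' (RGenInftyO.measurableE R) IG).
    by have := strip A mA; rewrite setTI.
  by move=> _ [x ->]; rewrite setIC; exact: half.
move=> mS; rewrite -[S]setTI.
pose GG : set (set (plane R)) :=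
  [set C | exists A, measurable A /\ exists B, measurable B /\ C = A `*` B].
apply: (@null_preimage _ _ _ lebesgue2 _ (plane R) id _ _ GG) => //.
- rewrite measurable_prod_measurableType //; congr (<<s _ >>).
  rewrite predeqE; split => [[A mA [B mB <-]]|[A [mA [B [mB ->]]]]].
    by exists A; split => //; exists B.
  by exists A => //; exists B.
- move=> /= _ _ [X1 [mX1 [X2 [mX2 ->]]]] [Y1 [mY1 [Y2 [mY2 ->]]]].
  rewrite -setXI; exists (X1 `&` Y1); split; first exact: measurableI.
  by exists (X2 `&` Y2); split => //; exact: measurableI.
- by move=> _ [A [mA [B [mB ->]]]]; rewrite setTI; exact: rect.
Qed.

End MomentTotality.

(** * Polynomials times a Gaussian are total in L^2 *)

Section GaussTotality.
Context {R : realType}.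
Local Notation L2r := (Lfun (@lebesgue2 R) 2%:E).

Lemma continuous_gauss (p : R) : continuous (gauss p).
Proof.
move=> z; rewrite /gauss; apply: (@continuous_comp _ _ _
  (fun z : R * R => - (p / 2) * (z.1 ^+ 2 + z.2 ^+ 2)) expR).
  by apply: cvgMr; apply: cvgD; apply: cvgM; first [exact: cvg_fst|exact: cvg_snd].
exact: continuous_expR.
Qed.

Lemma continuous_exp_norm (a b : R) : continuous (exp_norm a b).
Proof.
move=> z; rewrite /exp_norm; apply: (@continuous_comp _ _ _
  (fun z : R * R => a * `|z.1| + b * `|z.2|) expR).
  by apply: cvgD; apply: cvgMr; apply: cvg_norm; first [exact: cvg_fst|exact: cvg_snd].
exact: continuous_expR.
Qed.

(** The product [G] of [F] with the Gaussian has all exponential moments, as a pairing of two L^2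
    functions. It vanishes almost everywhere, and the Gaussian has no zero. *)
Lemma gauss_total (p : R) (F : R * R -> R) : 0 < p -> F \in L2r ->
  (forall m n, \int[lebesgue2]_z (z.1 ^+ m * z.2 ^+ n * gauss p z * F z) = 0) ->
  rip F F = 0.
Proof.
move=> p0 FL mom; have mF := L2r_measurable FL.
have mg := continuous_measurable_plane (@continuous_gauss p).
pose G z := gauss p z * F z.
have mG : measurable_fun [set: plane R] (G : plane R -> R) by exact: measurable_funM.
have eL a b : (fun z => exp_norm a b z * gauss p z) \in L2r.
  apply: decay_L2r; last exact: exp_norm_gauss_decay.
  by apply: continuous_measurable_plane; apply: continuous_mul2;
    [exact: continuous_exp_norm|exact: continuous_gauss].
have GE a b : (@lebesgue2 R).-integrable setT (fun z => (exp_norm a b z * `|G z|)%:E).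
  have := @integrable_norm _ (plane R) R lebesgue2 _ _ (L2r_integrableM (eL a b) FL).
  apply: eq_integrable => // z _ /=.
  by rewrite /G !normrM !(ger0_norm (expR_ge0 _)) mulrA.
have Gmom m n : ann G (fun z => z.1 ^+ m * z.2 ^+ n).
  (* The real integral is also 0 when the extended one is infinite; integrability excludes this. *)
  have int : (@lebesgue2 R).-integrable setT (fun z : plane R => (z.1 ^+ m * z.2 ^+ n * G z)%:E).
    have mom_m : measurable_fun [set: plane R] (fun z : plane R => z.1 ^+ m * z.2 ^+ n : R).
      by apply: measurable_funM; apply: measurable_funX;
        first [exact: measurable_fst|exact: measurable_snd].
    apply: (@exp_norm_integrable _ _ mG GE _ 1 1 (m`!%:R * n`!%:R)) => // z.
    rewrite /exp_norm !mul1r expRD normrM !normrX mulrACA.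
    by apply: ler_pM; rewrite ?exprn_ge0 // pow_le_expR.
  have := mom m n; rewrite /ann /Rintegral.
  under eq_integral do rewrite -mulrA -/(G _).
  by move=> /eqP; rewrite fine_eq0 ?integrable_fin_num // => /eqP.
have iG := moment_integrable mG GE.
have : ae_eq lebesgue2 setT (EFin \o (G : plane R -> R)) (cst 0%E).
  apply: integral_ae_eq => //.
  by move=> S _ mS; rewrite integral0 (moment_null mG GE Gmom).
move=> [N [mN N0 NG]].
rewrite /rip /Rintegral (_ : \int[_]_z _ = 0)%E //.
rewrite (@ae_eq_integral _ _ _ lebesgue2 setT (cst 0%E)) ?integral0 //.
  by apply/measurable_EFinP; exact: measurable_funM.
exists N; split=> // z /= FF; apply: NG => /= GG; apply: FF => _.
have : G z = 0 by have := GG I; case.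
rewrite /G => /eqP; rewrite mulf_eq0 gt_eqF ?expR_gt0 //= => /eqP ->.
by rewrite mul0r.
Qed.

End GaussTotality.

(** * Ladder operators and chirped Gaussians *)

Section RealGaussians.
Context {R : realType}.
Implicit Types f g : R * R -> R.

Definition axis (b : bool) (z : R * R) : R := if b then z.2 else z.1.

Lemma differentiable_axis b z : differentiable (axis b) z.
Proof.
case: b.
  have c : continuous (snd : R * R -> R) by move=> x; exact: cvg_snd.
  exact: (@linear_differentiable _ _ _ snd z c).
have c : continuous (fst : R * R -> R) by move=> x; exact: cvg_fst.
exact: (@linear_differentiable _ _ _ fst z c).
Qed.

Lemma derive_axis b b' z : 'D_(dir b') (axis b) z = (b == b')%:R.
Proof.
rewrite deriveE; last exact: differentiable_axis.
case: b.
  have c : continuous (snd : R * R -> R) by move=> x; exact: cvg_snd.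
  by rewrite (@diff_lin _ _ _ snd z c); case: b'.
have c : continuous (fst : R * R -> R) by move=> x; exact: cvg_fst.
by rewrite (@diff_lin _ _ _ fst z c); case: b'.
Qed.

Lemma derive_comp1 (h : R -> R) f (dh : R) z v : differentiable f z ->
  is_derive (f z) (1 : R) h dh ->
  differentiable (h \o f) z /\ 'D_v (h \o f) z = dh * 'D_v f z.
Proof.
move=> df [dh1 dhE].
have hd : differentiable h (f z) by exact/derivable1_diffP.
have hf := differentiable_comp df hd.
split=> //; rewrite !deriveE // diff_comp //= diff1E // derive1E dhE mulrC //.
Qed.

Variables p q : R.

Definition phase z : R := q * (z.1 * z.2).

Lemma phase_diff z : differentiable phase z /\
  forall b, 'D_(dir b) phase z = q * axis (~~ b) z.
Proof.
have E : phase = q *: (axis false * axis true) by [].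
have d0 := differentiable_axis false z; have d1 := differentiable_axis true z.
have dM : differentiable (axis false * axis true) z by exact: differentiableM.
split=> [|b]; rewrite E; first exact: differentiableZ.
rewrite deriveZ; last exact: diff_derivable.
rewrite deriveM; [|exact: diff_derivable..].
rewrite !derive_axis; congr (_ * _).
by case: b; rewrite /= /GRing.scale /=; ring.
Qed.

Lemma gauss_diff z : differentiable (gauss p) z /\
  forall b, 'D_(dir b) (gauss p) z = - p * axis b z * gauss p z.
Proof.
pose h := (- (p / 2)) *: (axis false * axis false + axis true * axis true).
have E : gauss p = expR \o h by apply/funext => u; rewrite /gauss /h /= !expr2.
have d0 := differentiable_axis false z; have d1 := differentiable_axis true z.
have m0 : differentiable (axis false * axis false) z by exact: differentiableM.
have m1 : differentiable (axis true * axis true) z by exact: differentiableM.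
have ms : differentiable (axis false * axis false + axis true * axis true) z.
  exact: differentiableD.
have dh : differentiable h z by exact: differentiableZ.
have Dh b : 'D_(dir b) h z = - p * axis b z.
  rewrite /h deriveZ; last exact: diff_derivable.
  rewrite deriveD; [|exact: diff_derivable..].
  rewrite !deriveM; try exact: diff_derivable.
  by rewrite !derive_axis; case: b => /=; rewrite /GRing.scale /=; field.
have dc b := derive_comp1 (dir b) dh (is_derive_expR (h z)).
rewrite E; split=> [|b]; first exact: (dc true).1.
by rewrite (dc b).2 Dh mulrC.
Qed.

(** An abstract [h] treats cosine and sine at once. *)
Lemma gauss_wave_diff (h dh : R -> R) z : (forall x : R, is_derive x (1 : R) h (dh x)) ->
  differentiable (fun z => gauss p z * h (phase z)) z /\
  forall b, 'D_(dir b) (fun z => gauss p z * h (phase z)) z =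
     (- p) * (axis b z * (gauss p z * h (phase z))) +
     q * (axis (~~ b) z * (gauss p z * dh (phase z))).
Proof.
move=> hd; have [dg Dg] := gauss_diff z; have [dP DP] := phase_diff z.
have dc b := derive_comp1 (dir b) dP (hd (phase z)).
have dc1 := (dc true).1.
have E : (fun z => gauss p z * h (phase z)) = gauss p * (h \o phase) by [].
split=> [|b]; rewrite E; first exact: differentiableM.
rewrite deriveM; [|exact: diff_derivable..].
by rewrite (dc b).2 Dg DP /GRing.scale /=; ring.
Qed.

(** Contains the real and imaginary parts of polynomials times the chirped Gaussian. Cosine and sine
    come together because a derivative exchanges them; this makes the class stable under partial
    derivatives. *)
Inductive gauss_poly : (R * R -> R) -> Prop :=
| gauss_poly_cos : gauss_poly (fun z => gauss p z * cos (phase z))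
| gauss_poly_sin : gauss_poly (fun z => gauss p z * sin (phase z))
| gauss_polyD f g : gauss_poly f -> gauss_poly g -> gauss_poly (fun z => f z + g z)
| gauss_polyZ a f : gauss_poly f -> gauss_poly (fun z => a * f z)
| gauss_polyX b f : gauss_poly f -> gauss_poly (fun z => axis b z * f z).

Lemma gauss_poly_ext f g : f =1 g -> gauss_poly f -> gauss_poly g.
Proof. by move=> /funext ->. Qed.

Lemma gauss_poly_diff f : gauss_poly f ->
  (forall z, differentiable f z) /\ forall b, gauss_poly ('D_(dir b) f).
Proof.
elim=> {f} [||f g _ [df Df] _ [dg Dg]|a f _ [df Df]|b f gf [df Df]].
- have B z := gauss_wave_diff z (@is_derive_cos R); split=> [z|b]; first exact: (B z).1.
  apply: gauss_poly_ext (gauss_polyD (gauss_polyZ (- p) (gauss_polyX b gauss_poly_cos))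
    (gauss_polyZ (- q) (gauss_polyX (~~ b) gauss_poly_sin))) => z.
  by rewrite (B z).2; ring.
- have B z := gauss_wave_diff z (@is_derive_sin R); split=> [z|b]; first exact: (B z).1.
  apply: gauss_poly_ext (gauss_polyD (gauss_polyZ (- p) (gauss_polyX b gauss_poly_sin))
    (gauss_polyZ q (gauss_polyX (~~ b) gauss_poly_cos))) => z.
  by rewrite (B z).2; ring.
- split=> [z|b]; first exact: differentiableD.
  apply: gauss_poly_ext (gauss_polyD (Df b) (Dg b)) => z.
  by rewrite -deriveD //; exact: diff_derivable.
- split=> [z|b]; first exact: differentiableZ.
  apply: gauss_poly_ext (gauss_polyZ a (Df b)) => z.
  by rewrite -[RHS]/('D_(dir b) (a *: f) z) deriveZ //; exact: diff_derivable.
- split=> [z|b']; first by apply: differentiableM => //; exact: differentiable_axis.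
  apply: gauss_poly_ext (gauss_polyD (gauss_polyX b (Df b')) (gauss_polyZ (b == b')%:R gf)) => z.
  rewrite -[RHS]/('D_(dir b') (axis b * f) z) deriveM; last 2 first.
  + by apply: diff_derivable; exact: differentiable_axis.
  + exact: diff_derivable.
  by rewrite derive_axis /GRing.scale /=; ring.
Qed.

(** A factor [x] or [y] is at most [exp (|x| + |y|)] and raises the rate [k] by 1; the Gaussian
    beats any rate. *)
Lemma gauss_poly_bound f : gauss_poly f ->
  exists (C : R) (k : R), forall z, `|f z| <= C * (exp_norm k k z * gauss p z).
Proof.
have g0 z : 0 <= gauss p z by exact: expR_ge0.
have base (h : R -> R) : (forall x, `|h x| <= 1) ->
    exists (C : R) (k : R), forall z, `|gauss p z * h (phase z)| <= C * (exp_norm k k z * gauss p z).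
  move=> h1; exists 1, 0 => z; rewrite /exp_norm !mul0r addr0 expR0 !mul1r normrM.
  by rewrite ger0_norm // -[leRHS]mulr1 ler_wpM2l.
elim=> {f} [||f g _ [C [k H]] _ [C' [k' H']]|a f _ [C [k H]]|b f _ [C [k H]]].
- by apply: base => x; exact: cos_max.
- by apply: base => x; exact: sin_max.
- exists (`|C| + `|C'|), (Num.max k k') => z; rewrite (le_trans (ler_normD _ _)) // mulrDl.
  have mono (j : R) : j <= Num.max k k' -> exp_norm j j z <= exp_norm (Num.max k k') (Num.max k k') z.
    by move=> jk; rewrite ler_expR lerD // ler_wpM2r.
  apply: lerD.
    apply: le_trans (H z) _; apply: le_trans (ler_wpM2r _ (ler_norm C)) _.
      by rewrite mulr_ge0 ?expR_ge0.
    by rewrite ler_wpM2l // ler_wpM2r // mono // le_max lexx.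
  apply: le_trans (H' z) _; apply: le_trans (ler_wpM2r _ (ler_norm C')) _.
    by rewrite mulr_ge0 ?expR_ge0.
  by rewrite ler_wpM2l // ler_wpM2r // mono // le_max lexx orbT.
- exists (`|a| * C), k => z; rewrite normrM -mulrA; exact: ler_wpM2l.
- exists C, (k + 1) => z; rewrite normrM.
  have -> : exp_norm (k + 1) (k + 1) z = expR (`|z.1| + `|z.2|) * exp_norm k k z.
    by rewrite /exp_norm -expRD; congr expR; ring.
  rewrite [leRHS](_ : _ = expR (`|z.1| + `|z.2|) * (C * (exp_norm k k z * gauss p z))); last by ring.
  apply: ler_pM => //; apply: le_trans (expR_ge1Dx _).
  by have := normr_ge0 z.1; have := normr_ge0 z.2; case: b; rewrite /axis; lra.
Qed.

(** Derivatives and monomial multiples stay in the class, so it is enough to bound its members. *)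
Lemma gauss_poly_schwartz f : 0 < p -> gauss_poly f -> real_schwartz f.
Proof.
move=> p0 gf w; have gw : gauss_poly (iter_partial w f).
  by elim: w => //= b w IH; have [_] := gauss_poly_diff IH; apply.
split=> [z|a b]; first exact: (gauss_poly_diff gw).1.
have gab : gauss_poly (fun z => z.1 ^+ a * z.2 ^+ b * iter_partial w f z).
  elim: a => [|a IH].
    elim: b => [|b IH]; first by apply: gauss_poly_ext gw => z; rewrite !expr0 !mul1r.
    by apply: gauss_poly_ext (gauss_polyX true IH) => z; rewrite exprS /axis; ring.
  by apply: gauss_poly_ext (gauss_polyX false IH) => z; rewrite exprS /axis; ring.
have [C [k H]] := gauss_poly_bound gab.
have [D HD] := exp_norm_gauss_decay k k p0.
exists (`|C| * `|D|) => z; apply: le_trans (H z) _.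
apply: le_trans (ler_norm _) _; rewrite normrM ler_wpM2l //.
apply: le_trans (HD z) _; apply: le_trans (ler_norm _) _; rewrite normrM -[leRHS]mulr1.
by rewrite ler_wpM2l // ger0_norm ?decay_le1 // ltW // decay_gt0.
Qed.

End RealGaussians.

(** * First-order operators on complex scalar fields *)

Section ScalarOperators.
Context {R : realType}.
Implicit Types f g : scalar_field R.

Definition mulx b f : scalar_field R := fun z => (axis b z)%:C * f z.

Definition sdiff f := forall z, differentiable (re f) z /\ differentiable (im f) z.

Lemma re_cpartial b f : re (cpartial b f) = 'D_(dir b) (re f).
Proof. by []. Qed.

Lemma im_cpartial b f : im (cpartial b f) = 'D_(dir b) (im f).
Proof. by []. Qed.

Lemma re_mulx b f : re (mulx b f) = fun z => axis b z * re f z.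
Proof. by apply/funext => z; rewrite /re /mulx ReZ. Qed.

Lemma im_mulx b f : im (mulx b f) = fun z => axis b z * im f z.
Proof. by apply/funext => z; rewrite /im /mulx; case: (f z) => u v /=; ring. Qed.

Lemma complex_ext (u v : R[i]) :
  complex.Re u = complex.Re v -> complex.Im u = complex.Im v -> u = v.
Proof. by case: u => a b; case: v => c d /= -> ->. Qed.

Lemma scalar_ext f g : re f = re g -> im f = im g -> f = g.
Proof.
move=> h1 h2; apply/funext => z; apply: complex_ext.
  by rewrite -[LHS]/(re f z) h1.
by rewrite -[LHS]/(im f z) h2.
Qed.

Lemma derive_lin (a c : R) (u v : R * R -> R) z w :
  differentiable u z -> differentiable v z ->
  'D_w (fun z => a * u z + c * v z) z = a * 'D_w u z + c * 'D_w v z.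
Proof.
move=> du dv; rewrite -[LHS]/('D_w (a *: u + c *: v) z).
rewrite deriveD; try by apply: diff_derivable; exact: differentiableZ.
by rewrite !deriveZ //; exact: diff_derivable.
Qed.

Lemma cpartialD b f g : sdiff f -> sdiff g ->
  cpartial b (f + g) = cpartial b f + cpartial b g.
Proof.
move=> df dg; apply: scalar_ext.
  rewrite reD !re_cpartial reD; apply/funext => z.
  rewrite -[LHS]/('D_(dir b) (re f + re g) z) deriveD //.
    by apply: diff_derivable; exact: (df z).1.
  by apply: diff_derivable; exact: (dg z).1.
rewrite imD !im_cpartial imD; apply/funext => z.
rewrite -[LHS]/('D_(dir b) (im f + im g) z) deriveD //.
  by apply: diff_derivable; exact: (df z).2.
by apply: diff_derivable; exact: (dg z).2.
Qed.

Lemma cpartialZ b a f : sdiff f -> cpartial b (a *: f) = a *: cpartial b f.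
Proof.
move=> df; apply: scalar_ext.
  rewrite reZ re_cpartial reZ re_cpartial im_cpartial; apply/funext => z.
  have := @derive_lin (complex.Re a) (- complex.Im a) (re f) (im f) z (dir b) (df z).1 (df z).2.
  by [].
rewrite imZ im_cpartial imZ re_cpartial im_cpartial; apply/funext => z.
have := @derive_lin (complex.Re a) (complex.Im a) (im f) (re f) z (dir b) (df z).2 (df z).1.
by [].
Qed.

Lemma derive_axisM b b' (u : R * R -> R) z : differentiable u z ->
  'D_(dir b') (fun z => axis b z * u z) z = axis b z * 'D_(dir b') u z + (b == b')%:R * u z.
Proof.
move=> du; rewrite -[LHS]/('D_(dir b') (axis b * u) z) deriveM; last 2 first.
- by apply: diff_derivable; exact: differentiable_axis.
- exact: diff_derivable.
by rewrite derive_axis /GRing.scale /=; ring.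
Qed.

Lemma scalarD f g z : (f + g) z = f z + g z. Proof. by []. Qed.

Lemma scalarZ (a : R[i]) f z : (a *: f) z = a * f z. Proof. by []. Qed.

Lemma cpartial_mulx b b' f : sdiff f ->
  cpartial b' (mulx b f) = mulx b (cpartial b' f) + (b == b')%:R *: f.
Proof.
move=> df; apply: scalar_ext.
  rewrite reD re_mulx reZ re_cpartial re_mulx; apply/funext => z.
  rewrite derive_axisM; last exact: (df z).1.
  by case: (b == b'); rewrite ?mulr1n ?mulr0n /= ?oppr0 ?mul0r ?addr0.
rewrite imD im_mulx imZ im_cpartial im_mulx; apply/funext => z.
rewrite derive_axisM; last exact: (df z).2.
by case: (b == b'); rewrite ?mulr1n ?mulr0n /= ?mul0r ?addr0.
Qed.

Lemma mulxD b f g : mulx b (f + g) = mulx b f + mulx b g.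
Proof. by apply/funext => z; rewrite /mulx -mulrDr. Qed.

Lemma mulxZ b a f : mulx b (a *: f) = a *: mulx b f.
Proof. by apply/funext => z; rewrite /mulx mulrCA. Qed.

Lemma schwartz_sdiff f : schwartz f -> sdiff f.
Proof. by move=> [h1 h2] z; split; exact: schwartz_differentiable. Qed.

Lemma schwartz_sL2 f : schwartz f -> sL2 f.
Proof. by move=> [h1 h2]; split; exact: schwartz_L2r. Qed.

Lemma schwartz_cpartial b f : schwartz f -> schwartz (cpartial b f).
Proof.
by move=> [h1 h2]; split; [exact: (schwartz_partial b h1)|exact: (schwartz_partial b h2)].
Qed.

Lemma schwartz_axis_L2r b (u : R * R -> R) : real_schwartz u ->
  (fun z => axis b z * u z) \in Lfun (@lebesgue2 R) 2%:E.
Proof.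
move=> uS; apply: decay_L2r.
  apply: continuous_measurable_plane; apply: continuous_mul2.
    by move=> z; apply: differentiable_continuous; exact: differentiable_axis.
  exact: schwartz_continuous.
have [M H] := schwartz_decay (~~ b) b uS.
exists M => z; have := H z; case: b {H} => /=; rewrite /axis expr0 expr1.
  by rewrite mul1r.
by rewrite mulr1.
Qed.

Lemma schwartz_mulx_sL2 b f : schwartz f -> sL2 (mulx b f).
Proof.
by move=> [h1 h2]; split; rewrite ?re_mulx ?im_mulx; exact: schwartz_axis_L2r.
Qed.

Lemma sinnerDl f g h : sL2 f -> sL2 g -> sL2 h ->
  sinner (f + g) h = sinner f h + sinner g h.
Proof.
move=> lf lg lh; rewrite (sinnerJ h (f + g)) sinnerDr // (sinnerJ h f) (sinnerJ h g).
exact: rmorphD.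
Qed.

Lemma sinnerZl a f g : sL2 f -> sL2 g -> sinner (a *: f) g = a^*%C * sinner f g.
Proof.
by move=> lf lg; rewrite (sinnerJ g (a *: f)) sinnerZr // (sinnerJ g f); exact: rmorphM.
Qed.

Lemma sinner_mulx b f g : sinner (mulx b f) g = sinner f (mulx b g).
Proof.
have M (u v : R * R -> R) : rip (fun z => axis b z * u z) v = rip u (fun z => axis b z * v z).
  by apply: eq_Rintegral => z _; rewrite mulrA [u z * _]mulrC.
by rewrite /sinner !re_mulx !im_mulx !M.
Qed.

Lemma sinner_cpartial b f g : schwartz f -> schwartz g ->
  sinner (cpartial b f) g = - sinner f (cpartial b g).
Proof.
move=> [f1 f2] [g1 g2]; rewrite /sinner !re_cpartial !im_cpartial.
have M (u v : R * R -> R) : real_schwartz u -> real_schwartz v ->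
    rip u ('D_(dir b) v) = - rip ('D_(dir b) u) v by exact: schwartz_by_parts.
by rewrite !(M (re f)) // !(M (im f)) //; apply: complex_ext => /=; ring.
Qed.

(** All ladder operators have this shape, so that adjoints and commutators are computed once, on the
    four coefficients. *)
Definition linop (c1 c2 d1 d2 : R[i]) f : scalar_field R :=
  c1 *: mulx false f + c2 *: mulx true f
  + d1 *: cpartial false f + d2 *: cpartial true f.

Lemma sL2_lin4 (c1 c2 c3 c4 : R[i]) f1 f2 f3 f4 : sL2 f1 -> sL2 f2 -> sL2 f3 -> sL2 f4 ->
  sL2 (c1 *: f1 + c2 *: f2 + c3 *: f3 + c4 *: f4).
Proof.
by move=> h1 h2 h3 h4; exact: sL2D (sL2D (sL2D (sL2Z c1 h1) (sL2Z c2 h2)) (sL2Z c3 h3)) (sL2Z c4 h4).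
Qed.

Lemma sinner_lin4r (c1 c2 c3 c4 : R[i]) f1 f2 f3 f4 g : sL2 f1 -> sL2 f2 -> sL2 f3 -> sL2 f4 ->
  sL2 g -> sinner g (c1 *: f1 + c2 *: f2 + c3 *: f3 + c4 *: f4) =
  c1 * sinner g f1 + c2 * sinner g f2 + c3 * sinner g f3 + c4 * sinner g f4.
Proof.
move=> h1 h2 h3 h4 hg.
have z1 := sL2Z c1 h1; have z2 := sL2Z c2 h2; have z3 := sL2Z c3 h3; have z4 := sL2Z c4 h4.
have z12 := sL2D z1 z2; have z123 := sL2D z12 z3.
by rewrite (sinnerDr hg z123 z4) (sinnerDr hg z12 z3) (sinnerDr hg z1 z2) !sinnerZr.
Qed.

Lemma sinner_lin4l (c1 c2 c3 c4 : R[i]) f1 f2 f3 f4 g : sL2 f1 -> sL2 f2 -> sL2 f3 -> sL2 f4 ->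
  sL2 g -> sinner (c1 *: f1 + c2 *: f2 + c3 *: f3 + c4 *: f4) g =
  c1^*%C * sinner f1 g + c2^*%C * sinner f2 g + c3^*%C * sinner f3 g + c4^*%C * sinner f4 g.
Proof.
move=> h1 h2 h3 h4 hg.
have z1 := sL2Z c1 h1; have z2 := sL2Z c2 h2; have z3 := sL2Z c3 h3; have z4 := sL2Z c4 h4.
have z12 := sL2D z1 z2; have z123 := sL2D z12 z3.
by rewrite (sinnerDl z123 z4 hg) (sinnerDl z12 z3 hg) (sinnerDl z1 z2 hg) !sinnerZl.
Qed.

Lemma linop_sL2 c1 c2 d1 d2 f : schwartz f -> sL2 (linop c1 c2 d1 d2 f).
Proof.
move=> fS; rewrite /linop.
have h b := schwartz_sL2 (schwartz_cpartial b fS).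
have h' b := schwartz_mulx_sL2 b fS.
exact: sL2_lin4.
Qed.

(** Coordinates are symmetric; derivatives are antisymmetric, by integration by parts. *)
Lemma linop_adjoint c1 c2 d1 d2 f g : schwartz f -> schwartz g ->
  sinner (linop c1 c2 d1 d2 f) g =
  sinner f (linop c1^*%C c2^*%C (- d1^*%C) (- d2^*%C) g).
Proof.
move=> fS gS; have [fL gL] := (schwartz_sL2 fS, schwartz_sL2 gS).
have hf b := schwartz_sL2 (schwartz_cpartial b fS).
have hf' b := schwartz_mulx_sL2 b fS.
have hg b := schwartz_sL2 (schwartz_cpartial b gS).
have hg' b := schwartz_mulx_sL2 b gS.
rewrite /linop (sinner_lin4l _ _ _ _ (hf' _) (hf' _) (hf _) (hf _) gL).
rewrite (sinner_lin4r _ _ _ _ (hg' _) (hg' _) (hg _) (hg _) fL).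
by rewrite !sinner_mulx !sinner_cpartial // !mulrN !mulNr.
Qed.

Lemma linopD c1 c2 d1 d2 f g : sdiff f -> sdiff g ->
  linop c1 c2 d1 d2 (f + g) = linop c1 c2 d1 d2 f + linop c1 c2 d1 d2 g.
Proof.
move=> df dg; rewrite /linop !mulxD !cpartialD //.
have alg (K : comPzRingType) (a1 a2 a3 a4 b1 b2 b3 b4 u1 u2 u3 u4 : K) :
  a1 * (b1 + u1) + a2 * (b2 + u2) + a3 * (b3 + u3) + a4 * (b4 + u4) =
  a1 * b1 + a2 * b2 + a3 * b3 + a4 * b4 + (a1 * u1 + a2 * u2 + a3 * u3 + a4 * u4) by ring.
by apply/funext => z; exact: alg.
Qed.

Lemma linopZ c1 c2 d1 d2 a f : sdiff f ->
  linop c1 c2 d1 d2 (a *: f) = a *: linop c1 c2 d1 d2 f.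
Proof.
move=> df; rewrite /linop !mulxZ !cpartialZ //.
have alg (K : comPzRingType) (e a1 a2 a3 a4 b1 b2 b3 b4 : K) :
  a1 * (e * b1) + a2 * (e * b2) + a3 * (e * b3) + a4 * (e * b4) =
  e * (a1 * b1 + a2 * b2 + a3 * b3 + a4 * b4) by ring.
by apply/funext => z; exact: alg.
Qed.

End ScalarOperators.

(** * Polynomials times the chirped Gaussian, and commutators on them *)

Section ComplexGaussians.
Context {R : realType}.
Variables p q : R.
Implicit Types f g : scalar_field R.

Definition psi0 : scalar_field R := fun z =>
  (gauss p z)%:C * (cos (phase q z) -i* sin (phase q z)).

(** The polynomial multiples of [psi0], an invariant domain common to all ladder operators:
    derivatives stay inside because those of [psi0] are polynomial multiples of it. *)
Inductive hermite : scalar_field R -> Prop :=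
| hermite_psi0 : hermite psi0
| hermiteD f g : hermite f -> hermite g -> hermite (f + g)
| hermiteZ a f : hermite f -> hermite (a *: f)
| hermite_mulx b f : hermite f -> hermite (mulx b f).

Lemma re_psi0 : re psi0 = fun z => gauss p z * cos (phase q z).
Proof. by apply/funext => z; rewrite /re /psi0 ReZ. Qed.

Lemma im_psi0 : im psi0 = fun z => - (gauss p z * sin (phase q z)).
Proof. by apply/funext => z; rewrite /im /psi0 /=; ring. Qed.

Lemma hermite_re_im f : hermite f -> gauss_poly p q (re f) /\ gauss_poly p q (im f).
Proof.
elim=> [|{}f g _ [f1 f2] _ [g1 g2]|a {}f _ [f1 f2]|b {}f _ [f1 f2]].
- rewrite re_psi0 im_psi0; split; first exact: gauss_poly_cos.
  by apply: gauss_poly_ext (gauss_polyZ (-1) (gauss_poly_sin p q)) => z; rewrite mulN1r.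
- by rewrite reD imD; split; exact: gauss_polyD.
- by rewrite reZ imZ; split; apply: gauss_polyD; exact: gauss_polyZ.
- by rewrite re_mulx im_mulx; split; exact: gauss_polyX.
Qed.

Lemma hermite_sdiff f : hermite f -> sdiff f.
Proof.
move=> /hermite_re_im[h1 h2] z; split.
  exact: (gauss_poly_diff h1).1.
exact: (gauss_poly_diff h2).1.
Qed.

Lemma hermite_schwartz f : 0 < p -> hermite f -> schwartz f.
Proof. by move=> p0 /hermite_re_im[h1 h2]; split; [exact: (gauss_poly_schwartz p0 h1)|exact: (gauss_poly_schwartz p0 h2)]. Qed.

Lemma cpartial_psi0 b : cpartial b psi0 =
  (- p%:C) *: mulx b psi0 + (- (0 +i* q)) *: mulx (~~ b) psi0.
Proof.
have C z := gauss_wave_diff p q z (@is_derive_cos R).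
have S z := gauss_wave_diff p q z (@is_derive_sin R).
apply: scalar_ext.
  rewrite re_cpartial re_psi0 reD !reZ !re_mulx !im_mulx re_psi0 im_psi0.
  by apply/funext => z; rewrite (C z).2 /=; ring.
rewrite im_cpartial im_psi0 imD !imZ !im_mulx !re_mulx re_psi0 im_psi0.
apply/funext => z.
rewrite -[LHS]/('D_(dir b) (- (fun z => gauss p z * sin (phase q z))) z) deriveN; last first.
  by apply: diff_derivable; exact: (S z).1.
rewrite (S z).2 /=.
ring.
Qed.

Lemma hermite_cpartial b f : hermite f -> hermite (cpartial b f).
Proof.
elim=> [|{}f g hf H hg H'|a {}f hf H|b' {}f hf H].
- rewrite cpartial_psi0; apply: hermiteD; apply: hermiteZ; apply: hermite_mulx; exact: hermite_psi0.
- by rewrite cpartialD; [exact: hermiteD|exact: hermite_sdiff..].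
- by rewrite cpartialZ; [exact: hermiteZ|exact: hermite_sdiff].
- rewrite cpartial_mulx; last exact: hermite_sdiff.
  by apply: hermiteD; [exact: hermite_mulx|exact: hermiteZ].
Qed.

(** By induction on [hermite]: for [psi0] both sides are explicit polynomial multiples, and a
    coordinate factor adds the same two terms on either side, in another order. *)
Lemma cpartialC b b' f : hermite f ->
  cpartial b (cpartial b' f) = cpartial b' (cpartial b f).
Proof.
have sd := hermite_sdiff.
elim=> [|{}f g hf H hg H'|a {}f hf H|b1 {}f hf H].
- have hp := hermite_psi0; have hx c := hermite_mulx c hp.
  have D c : cpartial c psi0 =
    (- p%:C) *: mulx c psi0 + (- (0 +i* q)) *: mulx (~~ c) psi0 by exact: cpartial_psi0.
  have DD c c' : cpartial c (cpartial c' psi0) =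
      (- p%:C) *: (mulx c' (cpartial c psi0) + (c' == c)%:R *: psi0) +
      (- (0 +i* q)) *: (mulx (~~ c') (cpartial c psi0) + (~~ c' == c)%:R *: psi0).
    rewrite (D c') cpartialD; [|exact: sd (hermiteZ _ (hx _))..].
    by rewrite !(cpartialZ _ _ (sd _ (hx _))) !(cpartial_mulx _ _ (sd _ hp)).
  rewrite !DD !D; apply/funext => z; rewrite !(scalarD, scalarZ, mulxD, mulxZ) /mulx.
  by case: b; case: b' => //; rewrite /axis /=; ring.
- have h c := sd _ (hermite_cpartial c hf); have h' c := sd _ (hermite_cpartial c hg).
  by rewrite !(cpartialD _ (sd _ hf) (sd _ hg)) !(cpartialD _ (h _) (h' _)) H H'.
- have h c := sd _ (hermite_cpartial c hf).
  by rewrite !(cpartialZ _ _ (sd _ hf)) !(cpartialZ _ _ (h _)) H.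
- have h c := sd _ (hermite_cpartial c hf).
  have h' c := sd _ (hermite_mulx b1 (hermite_cpartial c hf)).
  have h'' a := sd _ (hermiteZ a hf).
  rewrite !(cpartial_mulx _ _ (sd _ hf)) !(cpartialD _ (h' _) (h'' _)).
  rewrite !(cpartial_mulx _ _ (h _)) !(cpartialZ _ _ (sd _ hf)) H.
  exact: addrAC.
Qed.

Lemma hermite_linop c1 c2 d1 d2 f : hermite f -> hermite (linop c1 c2 d1 d2 f).
Proof.
move=> hf; have h b := hermite_cpartial b hf.
have hx b := hermite_mulx b hf.
exact: hermiteD (hermiteD (hermiteD (hermiteZ _ (hx _)) (hermiteZ _ (hx _)))
  (hermiteZ _ (h _))) (hermiteZ _ (h _)).
Qed.

(** Pointwise form of [linop_comm]: [u], [v], [w] are the values of [f] and of its first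
    derivatives, [a], [b], [c] those of the second ones, [b] serving for both mixed derivatives. The
    booleans come from [cpartial_mulx]. *)
Lemma linop_comm_ring (K : comPzRingType) (c1 c2 d1 d2 c1' c2' d1' d2' x y u v w a b c : K) :
  c1 * (x * (c1' * (x * u) + c2' * (y * u) + d1' * v + d2' * w)) +
  c2 * (y * (c1' * (x * u) + c2' * (y * u) + d1' * v + d2' * w)) +
  d1 * (c1' * (x * v + (nat_of_bool true)%:R * u) + c2' * (y * v + (nat_of_bool false)%:R * u) + d1' * a + d2' * b) +
  d2 * (c1' * (x * w + (nat_of_bool false)%:R * u) + c2' * (y * w + (nat_of_bool true)%:R * u) + d1' * b + d2' * c) =
  c1' * (x * (c1 * (x * u) + c2 * (y * u) + d1 * v + d2 * w)) +
  c2' * (y * (c1 * (x * u) + c2 * (y * u) + d1 * v + d2 * w)) +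
  d1' * (c1 * (x * v + (nat_of_bool true)%:R * u) + c2 * (y * v + (nat_of_bool false)%:R * u) + d1 * a + d2 * b) +
  d2' * (c1 * (x * w + (nat_of_bool false)%:R * u) + c2 * (y * w + (nat_of_bool true)%:R * u) + d1 * b + d2 * c) +
  (d1 * c1' + d2 * c2' - c1 * d1' - c2 * d2') * u.
Proof. by rewrite /= mulr1n mulr0n; ring. Qed.

Lemma linop_comm c1 c2 d1 d2 c1' c2' d1' d2' f : hermite f ->
  linop c1 c2 d1 d2 (linop c1' c2' d1' d2' f) =
  linop c1' c2' d1' d2' (linop c1 c2 d1 d2 f) +
  (d1 * c1' + d2 * c2' - c1 * d1' - c2 * d2') *: f.
Proof.
move=> hf; have sd := hermite_sdiff.
have h b := hermite_cpartial b hf; have hx b := hermite_mulx b hf.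
have hdd b b' := hermite_cpartial b (h b').
have E b (e1 e2 e3 e4 : R[i]) : cpartial b (linop e1 e2 e3 e4 f) =
   e1 *: (mulx false (cpartial b f) + (false == b)%:R *: f) +
   e2 *: (mulx true (cpartial b f) + (true == b)%:R *: f) +
   e3 *: cpartial b (cpartial false f) + e4 *: cpartial b (cpartial true f).
  have z1 := hermiteZ e1 (hx false); have z2 := hermiteZ e2 (hx true).
  have z3 := hermiteZ e3 (h false); have z4 := hermiteZ e4 (h true).
  have z12 := hermiteD z1 z2; have z123 := hermiteD z12 z3.
  rewrite /linop (cpartialD _ (sd _ z123) (sd _ z4)) (cpartialD _ (sd _ z12) (sd _ z3)).
  rewrite (cpartialD _ (sd _ z1) (sd _ z2)) !(cpartialZ _ _ (sd _ (hx _))).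
  by rewrite !(cpartialZ _ _ (sd _ (h _))) !(cpartial_mulx _ _ (sd _ hf)).
rewrite {1}/linop [in RHS]/linop !E (cpartialC true false hf).
by apply/funext => z; exact: linop_comm_ring.
Qed.

End ComplexGaussians.

(** * Two commuting pairs of ladder operators, abstractly *)

Section Ladder.
Context {R : realType} {U : lmodType R[i]}.
Variables (W : U -> Prop) (ip : U -> U -> R[i]) (A A' B B' : U -> U) (psi0 : U).
Hypotheses (WA' : forall f, W f -> W (A' f)) (WB' : forall f, W f -> W (B' f)) (W0 : W psi0).
Hypotheses (ipZ : forall a f g, W f -> W g -> ip f (a *: g) = a * ip f g)
  (ipJ : forall f g, ip g f = (ip f g)^*%C).
Hypotheses (AZ : forall a f, W f -> A (a *: f) = a *: A f)
  (A'Z : forall a f, W f -> A' (a *: f) = a *: A' f)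
  (BZ : forall a f, W f -> B (a *: f) = a *: B f)
  (B'Z : forall a f, W f -> B' (a *: f) = a *: B' f).
Hypotheses (AA' : forall f, W f -> A (A' f) = A' (A f) + f)
  (BB' : forall f, W f -> B (B' f) = B' (B f) + f)
  (AB' : forall f, W f -> A (B' f) = B' (A f))
  (BA' : forall f, W f -> B (A' f) = A' (B f))
  (A'B' : forall f, W f -> A' (B' f) = B' (A' f)).
Hypotheses (A0 : A psi0 = 0) (B0 : B psi0 = 0).
Hypotheses (A'ip : forall f g, W f -> W g -> ip (A' f) g = ip f (A g))
  (B'ip : forall f g, W f -> W g -> ip (B' f) g = ip f (B g)).

Definition ladder m n := iter m A' (iter n B' psi0).

Lemma ladder_dom m n : W (ladder m n).
Proof.
by rewrite /ladder; elim: m => [|m IH] /=; [elim: n => [//|n IH]; exact: WB'|exact: WA'].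
Qed.

(** The powers of [B'] are innermost, so [B'] has to pass through those of [A']. *)
Lemma ladder_raise_right m n : B' (ladder m n) = ladder m n.+1.
Proof.
elim: m => [//|m IH]; rewrite -[ladder m.+1 n]/(A' (ladder m n)).
by rewrite -A'B' ?IH //; exact: ladder_dom.
Qed.

Lemma ladder_scale0 (T : U -> U) : (forall a f, W f -> T (a *: f) = a *: T f) -> T 0 = 0.
Proof. by move=> TZ; rewrite -(scale0r psi0) TZ // !scale0r. Qed.

(** Each passage of [A] through a factor [A'] contributes one copy. At [m = 0] the predecessor is
    again 0, but its coefficient vanishes. *)
Lemma ladder_lower_left m n : A (ladder m n) = m%:R *: ladder m.-1 n.
Proof.
elim: m => [|m IH].
  rewrite scale0r; elim: n => [//|n IH]; rewrite -ladder_raise_right AB' ?IH.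
    exact: ladder_scale0.
  exact: ladder_dom.
have Wm := ladder_dom m n.
rewrite -[ladder m.+1 n]/(A' (ladder m n)) AA' // IH A'Z; last exact: ladder_dom.
have -> : m%:R *: A' (ladder m.-1 n) = m%:R *: ladder m n.
  by case: m {IH Wm} => [|m] //; rewrite !scale0r.
by rewrite -natr1 scalerDl scale1r.
Qed.

Lemma ladder_lower_right m n : B (ladder m n) = n%:R *: ladder m n.-1.
Proof.
elim: m => [|m IH].
  elim: n => [|n IH]; first by rewrite scale0r.
  have Wn := ladder_dom 0 n.
  rewrite -ladder_raise_right BB' // IH B'Z; last exact: ladder_dom.
  have -> : n%:R *: B' (ladder 0 n.-1) = n%:R *: ladder 0 n.
    by case: n {IH Wn} => [|n] //; rewrite !scale0r.
  by rewrite -natr1 scalerDl scale1r.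
rewrite -[ladder m.+1 n]/(A' (ladder m n)) BA'; last exact: ladder_dom.
by rewrite IH A'Z //; exact: ladder_dom.
Qed.

(** Raising on the left is lowering on the right: each exchange brings out an index, hence the
    factorials, and unequal indices end with a lowering operator applied to [psi0]. *)
Lemma ladder_ip m n m' n' : ip (ladder m n) (ladder m' n') =
  ((m == m') && (n == n'))%:R * (m`! * n`!)%:R * ip psi0 psi0.
Proof.
have ip0 f : W f -> ip f 0 = 0 by move=> Wf; rewrite -(scale0r psi0) ipZ // mul0r.
have base k l : ip (ladder 0 k) (ladder 0 l) = (k == l)%:R * k`!%:R * ip psi0 psi0.
  elim: k l => [|k IH] [|l]; first by rewrite fact0 !mul1r.
  (* Only the right index is positive here; conjugate symmetry puts it on the left. *)
  - rewrite ipJ -ladder_raise_right B'ip ?ladder_lower_right ?scale0r ?ip0 ?mul0r ?conjc0 //;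
      exact: ladder_dom.
  - rewrite -ladder_raise_right B'ip ?ladder_lower_right ?scale0r ?ip0 ?mul0r //;
      exact: ladder_dom.
  rewrite -(ladder_raise_right 0 k) B'ip; [|exact: ladder_dom..].
  rewrite ladder_lower_right ipZ; [|exact: ladder_dom..].
  rewrite [_.-1]/= IH eqSS; case: eqP => [->|_]; last by rewrite !mul0r mulr0.
  by rewrite !mul1r factS natrM mulrA.
elim: m m' => [|m IH] [|m'].
- by rewrite base fact0 mul1n.
- rewrite ipJ -[ladder m'.+1 n']/(A' (ladder m' n')) A'ip; [|exact: ladder_dom..].
  by rewrite ladder_lower_left scale0r ip0 ?conjc0 ?mul0r //; exact: ladder_dom.
- rewrite -[ladder m.+1 n]/(A' (ladder m n)) A'ip; [|exact: ladder_dom..].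
  by rewrite ladder_lower_left scale0r ip0 ?mul0r //; exact: ladder_dom.
rewrite -[ladder m.+1 n]/(A' (ladder m n)) A'ip; [|exact: ladder_dom..].
rewrite ladder_lower_left ipZ; [|exact: ladder_dom..].
rewrite [m'.+1.-1]/= IH eqSS; case: eqP => [->|_] /=; last by rewrite !mul0r mulr0.
by rewrite factS -mulnA [in RHS]natrM; case: (n == n'); rewrite ?mul0r ?mulr0 // !mul1r mulrA.
Qed.

Inductive ladder_span : U -> Prop :=
| ladder_span_base m n : ladder_span (ladder m n)
| ladder_spanD f g : ladder_span f -> ladder_span g -> ladder_span (f + g)
| ladder_spanZ a f : ladder_span f -> ladder_span (a *: f).

Hypotheses (WD : forall f g, W f -> W g -> W (f + g)) (WZ : forall a f, W f -> W (a *: f)).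
Hypotheses (AD : forall f g, W f -> W g -> A (f + g) = A f + A g)
  (A'D : forall f g, W f -> W g -> A' (f + g) = A' f + A' g)
  (BD : forall f g, W f -> W g -> B (f + g) = B f + B g)
  (B'D : forall f g, W f -> W g -> B' (f + g) = B' f + B' g).

Lemma ladder_span_dom f : ladder_span f -> W f.
Proof. by elim=> *; [exact: ladder_dom|exact: WD|exact: WZ]. Qed.

Lemma ladder_span_linear (T : U -> U) : (forall m n, ladder_span (T (ladder m n))) ->
  (forall f g, W f -> W g -> T (f + g) = T f + T g) ->
  (forall a f, W f -> T (a *: f) = a *: T f) ->
  forall f, ladder_span f -> ladder_span (T f).
Proof.
move=> Tb TD TZ f; elim=> [//|{}f g sf H sg H'|a {}f sf H].
  by rewrite TD; [exact: ladder_spanD|exact: ladder_span_dom..].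
by rewrite TZ; [exact: ladder_spanZ|exact: ladder_span_dom].
Qed.

Lemma ladder_span_closed f : ladder_span f ->
  [/\ ladder_span (A f), ladder_span (A' f), ladder_span (B f) & ladder_span (B' f)].
Proof.
move=> sf; split; apply: ladder_span_linear sf => // m n.
- by rewrite ladder_lower_left; apply: ladder_spanZ; exact: ladder_span_base.
- exact: (ladder_span_base m.+1 n).
- by rewrite ladder_lower_right; apply: ladder_spanZ; exact: ladder_span_base.
- by rewrite ladder_raise_right; exact: ladder_span_base.
Qed.

End Ladder.

(** * The ladder operators of X, Y and of X', Y' *)

Section LandauLadder.
Context {R : realType}.
Variables a b c d : R.
Hypothesis det1 : a * d - b * c = 1.

Let t : R := (Num.sqrt 2)^-1.

(* The ladder operators of the commuting canonical pairs *)
(*   X = a y - i b dx, Y = c x - i d dy  and  X' = a x - i b dy, Y' = c y - i d dx. *)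
Definition lowerX : scalar_field R -> scalar_field R :=
  linop (0 +i* (t * c)) ((t * a) +i* 0) (0 +i* (- (t * b))) ((t * d) +i* 0).
Definition raiseX : scalar_field R -> scalar_field R :=
  linop (0 +i* (- (t * c))) ((t * a) +i* 0) (0 +i* (- (t * b))) ((- (t * d)) +i* 0).
Definition lowerX' : scalar_field R -> scalar_field R :=
  linop ((t * a) +i* 0) (0 +i* (t * c)) ((t * d) +i* 0) (0 +i* (- (t * b))).
Definition raiseX' : scalar_field R -> scalar_field R :=
  linop ((t * a) +i* 0) (0 +i* (- (t * c))) ((- (t * d)) +i* 0) (0 +i* (- (t * b))).

(** [p = width] and [q = twist] solve [b q + d p = a] and [d q - b p = c], which is what [lowerX]
    killing the Gaussian amounts to. The system has determinant [b ^ 2 + d ^ 2]. *)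
Definition width : R := (b ^+ 2 + d ^+ 2)^-1.
Definition twist : R := (a * b + c * d) * width.

Local Notation W := (hermite width twist).
Local Notation g0 := (psi0 width twist).

Lemma sqr_t : t * t = 2^-1.
Proof. by rewrite /t -invfM -expr2 sqr_sqrtr. Qed.

Lemma bd_gt0 : 0 < b ^+ 2 + d ^+ 2.
Proof.
rewrite lt_neqAle addr_ge0 ?sqr_ge0 // andbT eq_sym paddr_eq0 ?sqr_ge0 //.
apply/negP => /andP[]; rewrite !sqrf_eq0 => /eqP b0 /eqP d0.
by move: det1; rewrite b0 d0 mulr0 mul0r subr0 => /eqP; rewrite eq_sym oner_eq0.
Qed.

Lemma width_gt0 : 0 < width.
Proof. by rewrite invr_gt0 bd_gt0. Qed.

Lemma width_twist : b * twist + d * width = a /\ d * twist - b * width = c.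
Proof.
have h : (b ^+ 2 + d ^+ 2) * width = 1 by rewrite mulfV // gt_eqF // bd_gt0.
split.
  (* The second term is a multiple of [1 - (a d - b c)], hence 0. *)
  transitivity (((b ^+ 2 + d ^+ 2) * width) * a + d * width * (1 - (a * d - b * c))).
    by rewrite /twist; ring.
  by rewrite h det1; ring.
transitivity (((b ^+ 2 + d ^+ 2) * width) * c + b * width * ((a * d - b * c) - 1)).
  by rewrite /twist; ring.
by rewrite h det1; ring.
Qed.

Lemma comm_lowerX_raiseX f : W f -> lowerX (raiseX f) = raiseX (lowerX f) + f.
Proof.
move=> hf; rewrite /lowerX /raiseX (linop_comm _ _ _ _ _ _ _ _ hf); congr (_ + _).
rewrite -[RHS]scale1r; congr (_ *: _); apply: complex_ext => /=; last by ring.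
transitivity (2 * (t * t) * (a * d - b * c)); first by ring.
by rewrite sqr_t det1 mulr1 mulfV.
Qed.

Lemma comm_lowerX'_raiseX' f : W f -> lowerX' (raiseX' f) = raiseX' (lowerX' f) + f.
Proof.
move=> hf; rewrite /lowerX' /raiseX' (linop_comm _ _ _ _ _ _ _ _ hf); congr (_ + _).
rewrite -[RHS]scale1r; congr (_ *: _); apply: complex_ext => /=; last by ring.
transitivity (2 * (t * t) * (a * d - b * c)); first by ring.
by rewrite sqr_t det1 mulr1 mulfV.
Qed.

Lemma comm_lowerX_raiseX' f : W f -> lowerX (raiseX' f) = raiseX' (lowerX f).
Proof.
move=> hf; rewrite /lowerX /raiseX' (linop_comm _ _ _ _ _ _ _ _ hf) -[RHS]addr0; congr (_ + _).
by rewrite -[RHS](scale0r f); congr (_ *: _); apply: complex_ext => /=; ring.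
Qed.

Lemma comm_lowerX'_raiseX f : W f -> lowerX' (raiseX f) = raiseX (lowerX' f).
Proof.
move=> hf; rewrite /lowerX' /raiseX (linop_comm _ _ _ _ _ _ _ _ hf) -[RHS]addr0; congr (_ + _).
by rewrite -[RHS](scale0r f); congr (_ *: _); apply: complex_ext => /=; ring.
Qed.

Lemma comm_raiseX_raiseX' f : W f -> raiseX (raiseX' f) = raiseX' (raiseX f).
Proof.
move=> hf; rewrite /raiseX /raiseX' (linop_comm _ _ _ _ _ _ _ _ hf) -[RHS]addr0; congr (_ + _).
by rewrite -[RHS](scale0r f); congr (_ *: _); apply: complex_ext => /=; ring.
Qed.

Lemma linop_psi0 c1 c2 d1 d2 :
  linop c1 c2 d1 d2 g0 =
  (c1 - d1 * width%:C - d2 * (0 +i* twist)) *: mulx false g0 +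
  (c2 - d2 * width%:C - d1 * (0 +i* twist)) *: mulx true g0.
Proof.
rewrite /linop !cpartial_psi0 /=; apply/funext => z.
have alg (K : comPzRingType) (e1 e2 e3 e4 u v x y : K) :
  e1 * x + e2 * y + e3 * (- u * x + - v * y) + e4 * (- u * y + - v * x) =
  (e1 - e3 * u - e4 * v) * x + (e2 - e4 * u - e3 * v) * y by ring.
exact: alg.
Qed.

Lemma lowerX_psi0 : lowerX g0 = 0.
Proof.
have [h1 h2] := width_twist; rewrite /lowerX linop_psi0.
rewrite [X in X *: mulx false _](_ : _ = 0) ?[X in X *: mulx true _](_ : _ = 0) ?scale0r ?addr0 //.
  by apply: complex_ext => /=; [rewrite -h1; ring|ring].
by apply: complex_ext => /=; [ring|rewrite -h2; ring].
Qed.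

(** Exchanging [x] and [y] turns [lowerX] into [lowerX'] and fixes [psi0], so the same two equations
    occur. *)
Lemma lowerX'_psi0 : lowerX' g0 = 0.
Proof.
have [h1 h2] := width_twist; rewrite /lowerX' linop_psi0.
rewrite [X in X *: mulx false _](_ : _ = 0) ?[X in X *: mulx true _](_ : _ = 0) ?scale0r ?addr0 //.
  by apply: complex_ext => /=; [ring|rewrite -h2; ring].
by apply: complex_ext => /=; [rewrite -h1; ring|ring].
Qed.

Lemma linop_congr (c1 c2 d1 d2 c1' c2' d1' d2' : R[i]) f :
  c1 = c1' -> c2 = c2' -> d1 = d1' -> d2 = d2' ->
  linop c1 c2 d1 d2 f = linop c1' c2' d1' d2' f.
Proof. by move=> -> -> -> ->. Qed.

Lemma raiseX_adjoint f g : schwartz f -> schwartz g ->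
  sinner (raiseX f) g = sinner f (lowerX g).
Proof.
move=> fS gS; rewrite /raiseX linop_adjoint //; apply: (congr1 (sinner f)).
by apply: linop_congr; apply: complex_ext => /=; rewrite ?opprK ?oppr0.
Qed.

Lemma raiseX'_adjoint f g : schwartz f -> schwartz g ->
  sinner (raiseX' f) g = sinner f (lowerX' g).
Proof.
move=> fS gS; rewrite /raiseX' linop_adjoint //; apply: (congr1 (sinner f)).
by apply: linop_congr; apply: complex_ext => /=; rewrite ?opprK ?oppr0.
Qed.

Lemma linop_comb4_ring (K : comPzRingType) (k1 k2 k3 k4 x1 y1 u1 v1 x2 y2 u2 v2 x3 y3 u3 v3 x4 y4 u4 v4
    x y u v : K) :
  k1 * (x1 * x + y1 * y + u1 * u + v1 * v) + k2 * (x2 * x + y2 * y + u2 * u + v2 * v) +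
  k3 * (x3 * x + y3 * y + u3 * u + v3 * v) + k4 * (x4 * x + y4 * y + u4 * u + v4 * v) =
  (k1 * x1 + k2 * x2 + k3 * x3 + k4 * x4) * x + (k1 * y1 + k2 * y2 + k3 * y3 + k4 * y4) * y +
  (k1 * u1 + k2 * u2 + k3 * u3 + k4 * u4) * u + (k1 * v1 + k2 * v2 + k3 * v3 + k4 * v4) * v.
Proof. by ring. Qed.

Lemma linop_comb4 (e1 e2 e3 e4 x1 y1 u1 v1 x2 y2 u2 v2 x3 y3 u3 v3 x4 y4 u4 v4 : R[i]) f :
  e1 *: linop x1 y1 u1 v1 f + e2 *: linop x2 y2 u2 v2 f +
  e3 *: linop x3 y3 u3 v3 f + e4 *: linop x4 y4 u4 v4 f =
  linop (e1 * x1 + e2 * x2 + e3 * x3 + e4 * x4) (e1 * y1 + e2 * y2 + e3 * y3 + e4 * y4)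
    (e1 * u1 + e2 * u2 + e3 * u3 + e4 * u4) (e1 * v1 + e2 * v2 + e3 * v3 + e4 * v4) f.
Proof.
by apply/funext => z; exact: linop_comb4_ring.
Qed.

Lemma linop_mulx (b1 : bool) f : linop (if b1 then 0 else 1) (if b1 then 1 else 0) 0 0 f = mulx b1 (f : scalar_field R).
Proof.
have alg (K : comPzRingType) (x y u v : K) :
  (1 * x + 0 * y + 0 * u + 0 * v = x) * (0 * x + 1 * y + 0 * u + 0 * v = y) by split; ring.
by apply/funext => z; case: b1; [exact: (alg _ _ _ _ _).2|exact: (alg _ _ _ _ _).1].
Qed.

(** Since [a d - b c = 1], one has [y = d X - b Y'] and [x = d X' - b Y]; moreover
    [X = t (lowerX + raiseX)] and [i Y = t (lowerX - raiseX)], and likewise for the primed pair. *)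
Lemma mulx_ladder b1 f : mulx b1 f =
  if b1 then (t * d)%:C *: lowerX f + (t * d)%:C *: raiseX f
    + (0 +i* (t * b)) *: lowerX' f + (0 +i* (- (t * b))) *: raiseX' f
  else (t * d)%:C *: lowerX' f + (t * d)%:C *: raiseX' f
    + (0 +i* (t * b)) *: lowerX f + (0 +i* (- (t * b))) *: raiseX f.
Proof.
have h : 2 * (t * t) * (a * d - b * c) = 1 by rewrite sqr_t det1 mulr1 mulfV.
rewrite -[LHS]linop_mulx /lowerX /raiseX /lowerX' /raiseX' !linop_comb4.
by case: b1; apply: linop_congr; apply: complex_ext => /=;
  first [by ring | by rewrite -[LHS]h; ring].
Qed.

End LandauLadder.

(** * Orthogonality and totality of the Landau functions *)

Section LandauBasis.
Context {R : realType}.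
Variables a b c d : R.
Hypothesis det1 : a * d - b * c = 1.

Local Notation p := (width b d).
Local Notation q := (twist a b c d).
Local Notation W := (hermite p q).
Local Notation A := (lowerX a b c d).
Local Notation A' := (raiseX a b c d).
Local Notation B' := (raiseX' a b c d).

Definition landau : nat -> nat -> scalar_field R := ladder A' B' (psi0 p q).

Lemma hermite_raiseX f : W f -> W (A' f). Proof. exact: hermite_linop. Qed.
Lemma hermite_raiseX' f : W f -> W (B' f). Proof. exact: hermite_linop. Qed.

Lemma landau_hermite m n : W (landau m n).
Proof.
exact: (ladder_dom hermite_raiseX hermite_raiseX' (hermite_psi0 p q)).
Qed.

Lemma landau_schwartz m n : schwartz (landau m n).
Proof. exact: hermite_schwartz (width_gt0 det1) (landau_hermite m n). Qed.

Lemma hermite_linopZ c1 c2 d1 d2 u f : W f ->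
  linop c1 c2 d1 d2 (u *: f) = u *: linop c1 c2 d1 d2 f.
Proof. by move=> /hermite_sdiff; exact: linopZ. Qed.

Lemma hermite_linopD c1 c2 d1 d2 f g : W f -> W g ->
  linop c1 c2 d1 d2 (f + g) = linop c1 c2 d1 d2 f + linop c1 c2 d1 d2 g.
Proof. by move=> /hermite_sdiff hf /hermite_sdiff hg; exact: linopD. Qed.

Local Notation W0 := (hermite_psi0 p q).

Lemma lowerX_landau m n : A (landau m n) = m%:R *: landau m.-1 n.
Proof.
exact: (ladder_lower_left hermite_raiseX hermite_raiseX' W0
  (hermite_linopZ _ _ _ _) (hermite_linopZ _ _ _ _) (comm_lowerX_raiseX det1)
  (@comm_lowerX_raiseX' _ _ _ _ _) (@comm_raiseX_raiseX' _ _ _ _ _) (lowerX_psi0 det1)).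
Qed.

Lemma raiseX_landau m n : A' (landau m n) = landau m.+1 n.
Proof. by []. Qed.

Lemma landau_ip m n m' n' : sinner (landau m n) (landau m' n') =
  ((m == m') && (n == n'))%:R * (m`! * n`!)%:R * sinner (psi0 p q) (psi0 p q).
Proof.
have S f (hf : W f) : schwartz f by exact: hermite_schwartz (width_gt0 det1) hf.
have L f (hf : W f) : sL2 f by exact: schwartz_sL2 (S f hf).
exact: (ladder_ip hermite_raiseX hermite_raiseX' W0
  (fun u f g hf hg => sinnerZr u (L f hf) (L g hg)) (@sinnerJ _)
  (hermite_linopZ _ _ _ _) (hermite_linopZ _ _ _ _) (comm_lowerX_raiseX det1)
  (comm_lowerX'_raiseX' det1)
  (@comm_lowerX_raiseX' _ _ _ _ _) (@comm_lowerX'_raiseX _ _ _ _ _)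
  (@comm_raiseX_raiseX' _ _ _ _ _) (lowerX_psi0 det1) (lowerX'_psi0 det1)
  (fun f g hf hg => raiseX_adjoint _ _ _ _ (S f hf) (S g hg))
  (fun f g hf hg => raiseX'_adjoint _ _ _ _ (S f hf) (S g hg))).
Qed.

(** The span of the ladder is stable under the four ladder operators, hence under multiplication by
    the coordinates. *)
Lemma hermite_landau f : W f -> ladder_span A' B' (psi0 p q) f.
Proof.
have closed := ladder_span_closed hermite_raiseX hermite_raiseX' W0
  (hermite_linopZ _ _ _ _) (hermite_linopZ _ _ _ _)
  (hermite_linopZ _ _ _ _) (hermite_linopZ _ _ _ _) (comm_lowerX_raiseX det1)
  (comm_lowerX'_raiseX' det1)
  (@comm_lowerX_raiseX' _ _ _ _ _) (@comm_lowerX'_raiseX _ _ _ _ _)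
  (@comm_raiseX_raiseX' _ _ _ _ _) (lowerX_psi0 det1) (lowerX'_psi0 det1)
  (@hermiteD _ _ _) (@hermiteZ _ _ _) (hermite_linopD _ _ _ _) (hermite_linopD _ _ _ _)
  (hermite_linopD _ _ _ _) (hermite_linopD _ _ _ _).
elim=> [|{}f g _ H _ H'|u {}f _ H|b' {}f _ H].
- exact: (ladder_span_base _ _ _ 0 0).
- exact: ladder_spanD.
- exact: ladder_spanZ.
have [h1 h2 h3 h4] := closed _ H.
by rewrite (mulx_ladder det1); case: b'; do ?apply: ladder_spanD; exact: ladder_spanZ.
Qed.

Lemma landau_hermite_orth f : sL2 f -> (forall m n, sinner (landau m n) f = 0) ->
  forall g, W g -> sinner g f = 0.
Proof.
move=> fL f0 g /hermite_landau.
have L h : W h -> sL2 h by move=> /(hermite_schwartz (width_gt0 det1)) /schwartz_sL2.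
have D h : ladder_span A' B' (psi0 p q) h -> sL2 h.
  move=> sh; apply: L; exact: (ladder_span_dom hermite_raiseX hermite_raiseX' W0
    (@hermiteD _ _ _) (@hermiteZ _ _ _) sh).
elim=> [m n|{}g h sg H sh H'|u {}g sg H]; first exact: f0.
  by rewrite sinnerDl ?H ?H' ?addr0 //; exact: D.
by rewrite sinnerZl ?H ?mulr0 //; exact: D.
Qed.

Lemma bounded_L2r (h F : R * R -> R) : continuous h -> (forall z, `|h z| <= 1) ->
  F \in Lfun (@lebesgue2 R) 2%:E -> (fun z => h z * F z) \in Lfun (@lebesgue2 R) 2%:E.
Proof.
move=> ch h1 /Lfun2P[mF fF]; have mh := continuous_measurable_plane ch.
have mhF : measurable_fun [set: plane R] (fun z : plane R => h z * F z).
  exact: measurable_funM.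
apply/Lfun2P; split => //; apply: le_lt_trans fF.
apply: ge0_le_integral => //.
- by move=> z _; rewrite lee_fin sqr_ge0.
- exact: measurable_sqr.
- exact: measurable_sqr.
move=> z _; rewrite lee_fin exprMn -[leRHS]mul1r ler_wpM2r ?sqr_ge0 //.
by rewrite -real_normK ?num_real // expr_le1.
Qed.

Lemma continuous_phase (k : R) : continuous (phase k : R * R -> R).
Proof. by move=> z; apply: differentiable_continuous; exact: (phase_diff k z).1. Qed.

Lemma hermite_monomial m n :
  W (fun z => (z.1 ^+ m * z.2 ^+ n)%:C * psi0 p q z : R[i]).
Proof.
have -> : (fun z => (z.1 ^+ m * z.2 ^+ n)%:C * psi0 p q z : R[i]) =
    iter m (mulx false) (iter n (mulx true) (psi0 p q)).
  apply/funext => z; elim: m => [|m IH] /=.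
    elim: n => [|n IH] /=; first by rewrite !expr0 !mul1r.
    by rewrite /mulx -IH mulrA -rmorphM /= exprS /axis !expr0 !mul1r.
  have -> : z.1 ^+ m.+1 * z.2 ^+ n = axis false z * (z.1 ^+ m * z.2 ^+ n).
    by rewrite exprS mulrA.
  by rewrite rmorphM -mulrA IH.
elim: m => [|m IH] /=; last exact: hermite_mulx.
by elim: n => [|n IH] /=; [exact: hermite_psi0|exact: hermite_mulx].
Qed.

(** The conjugate of [psi0] times [f] is the real Gaussian times [F1 + i F2], where
    [F1 + i F2 = exp (i q x y) f] has the modulus of [f]. So the real moment theorem applies to [F1]
    and [F2] separately. *)
Lemma landau_total f : sL2 f -> (forall m n, sinner (landau m n) f = 0) ->
  sinner f f = 0.
Proof.
move=> fL f0; have [f1 f2] := fL.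
have cc : continuous (fun z : R * R => cos (phase q z)).
  move=> z; apply: continuous_comp; [exact: continuous_phase|exact: continuous_cos].
have cs : continuous (fun z : R * R => sin (phase q z)).
  move=> z; apply: continuous_comp; [exact: continuous_phase|exact: continuous_sin].
have L1 F : F \in Lfun (@lebesgue2 R) 2%:E ->
    (fun z => cos (phase q z) * F z) \in Lfun (@lebesgue2 R) 2%:E.
  by apply: bounded_L2r => // z; exact: cos_max.
have L2 F : F \in Lfun (@lebesgue2 R) 2%:E ->
    (fun z => sin (phase q z) * F z) \in Lfun (@lebesgue2 R) 2%:E.
  by apply: bounded_L2r => // z; exact: sin_max.
pose F1 z := cos (phase q z) * re f z + sin (phase q z) * (- 1 * im f z).
pose F2 z := cos (phase q z) * im f z + sin (phase q z) * re f z.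
have F1L : F1 \in Lfun (@lebesgue2 R) 2%:E.
  by apply: L2rD; [exact: L1|apply: L2; exact: L2rZ].
have F2L : F2 \in Lfun (@lebesgue2 R) 2%:E by apply: L2rD; [exact: L1|exact: L2].
have mom m n : rip (fun z => z.1 ^+ m * z.2 ^+ n * gauss p z) F1 = 0 /\
    rip (fun z => z.1 ^+ m * z.2 ^+ n * gauss p z) F2 = 0.
  have hm := hermite_monomial m n.
  set g := (fun z => _ : R[i]) in hm.
  have [gL1 gL2] := schwartz_sL2 (hermite_schwartz (width_gt0 det1) hm).
  have := landau_hermite_orth fL f0 hm => -[E1 E2].
  have reg z : re g z = z.1 ^+ m * z.2 ^+ n * (gauss p z * cos (phase q z)).
    by rewrite /re /g /psi0 !ReZ.
  have img z : im g z = - (z.1 ^+ m * z.2 ^+ n * (gauss p z * sin (phase q z))).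
    by rewrite /im /g /psi0 /=; ring.
  have i1 := L2r_integrableM gL1 f1; have i2 := L2r_integrableM gL2 f2.
  have i3 := L2r_integrableM gL1 f2; have i4 := L2r_integrableM gL2 f1.
  split.
    rewrite -E1 -RintegralD //; apply: eq_Rintegral => z _.
    by rewrite /F1 reg img; ring.
  rewrite -E2 -RintegralB //; apply: eq_Rintegral => z _.
  by rewrite /F2 reg img; ring.
have t1 : rip F1 F1 = 0 by apply: (gauss_total (width_gt0 det1)) => // m n; exact: (mom m n).1.
have t2 : rip F2 F2 = 0 by apply: (gauss_total (width_gt0 det1)) => // m n; exact: (mom m n).2.
have i1 := L2r_integrableM F1L F1L; have i2 := L2r_integrableM F2L F2L.
have i3 := L2r_integrableM f1 f1; have i4 := L2r_integrableM f2 f2.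
apply: complex_ext => /=; last by rewrite [rip (im f) _]ripC subrr.
rewrite -[RHS]addr0 -{1}t1 -t2 -!RintegralD //; apply: eq_Rintegral => z _.
have := cos2Dsin2 (phase q z); rewrite /F1 /F2; move: (cos _) (sin _) (re f z) (im f z) => x y u v h.
transitivity ((x ^+ 2 + y ^+ 2) * (u * u + v * v)); first by rewrite h mul1r.
by ring.
Qed.

End LandauBasis.

(** * Spectral theory of the Dirac operator *)

Section Spin.
Context {R : realType}.
Implicit Types (f g : scalar_field R) (u v : spinor R).

Definition spin f g : spinor R := fun z => \col_k (if k == 0 then f z else g z).

Lemma component_spin0 f g : component 0 (spin f g) = f.
Proof. by apply/funext => z; rewrite /component mxE. Qed.

Lemma component_spin1 f g : component 1 (spin f g) = g.
Proof. by apply/funext => z; rewrite /component mxE. Qed.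

Lemma ord2_ind (P : 'I_2 -> Prop) : P 0 -> P 1 -> forall k, P k.
Proof.
move=> P0 P1 k; have [->//|k0] := eqVneq k 0.
by suff -> : k = 1 by []; apply/val_inj; case: k k0 => -[|[|]].
Qed.

Lemma sum_ord2 (V : zmodType) (F : 'I_2 -> V) : \sum_k F k = F 0 + F 1.
Proof.
rewrite !big_ord_recl big_ord0 addr0; congr (_ + F _); exact/val_inj.
Qed.

Lemma spin_ext u v : component 0 u = component 0 v -> component 1 u = component 1 v -> u = v.
Proof.
move=> h0 h1; apply/funext => z; apply/colP.
by apply: ord2_ind; [have := congr1 (@^~ z) h0|have := congr1 (@^~ z) h1].
Qed.

Lemma spinL2 f g : sL2 f -> sL2 g -> L2 (spin f g).
Proof. by move=> hf hg; apply: ord2_ind; rewrite -?[_ /\ _]/(sL2 _) ?component_spin0 ?component_spin1. Qed.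

Lemma inner2 u v : L2 u -> L2 v -> inner u v =
  sinner (component 0 u) (component 0 v) + sinner (component 1 u) (component 1 v).
Proof. by move=> uL vL; rewrite innerE // sum_ord2. Qed.

Lemma iter_partial_lin (x y : R) (h k : R * R -> R) w : real_schwartz h -> real_schwartz k ->
  iter_partial w (fun z => x * h z + y * k z) =
  (fun z => x * iter_partial w h z + y * iter_partial w k z).
Proof.
move=> hS kS; elim: w => [//|b w IH]; rewrite /= -!/(iter_partial w _) IH.
apply/funext => z; apply: derive_lin; [exact: (hS w).1|exact: (kS w).1].
Qed.

Lemma real_schwartz_lin (x y : R) (h k : R * R -> R) : real_schwartz h -> real_schwartz k ->
  real_schwartz (fun z => x * h z + y * k z).
Proof.
move=> hS kS w; rewrite iter_partial_lin //; split=> [z|m n].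
  have -> : (fun z => x * iter_partial w h z + y * iter_partial w k z) =
      x *: iter_partial w h + y *: iter_partial w k by [].
  by apply: differentiableD; apply: differentiableZ; [exact: (hS w).1|exact: (kS w).1].
have [M HM] := (hS w).2 m n; have [N HN] := (kS w).2 m n.
exists (`|x| * M + `|y| * N) => z; rewrite mulrDr.
rewrite (le_trans (ler_normD _ _)) // lerD // mulrCA normrM ler_wpM2l //.
Qed.

Lemma schwartzD f g : schwartz f -> schwartz g -> schwartz (f + g).
Proof.
move=> [f1 f2] [g1 g2]; split.
  have -> : (fun z => complex.Re ((f + g) z)) = (fun z => 1 * re f z + 1 * re g z).
    by apply/funext => z; rewrite scalarD ReD !mul1r.
  exact: real_schwartz_lin.
have -> : (fun z => complex.Im ((f + g) z)) = (fun z => 1 * im f z + 1 * im g z).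
  by apply/funext => z; rewrite scalarD ImD !mul1r.
exact: real_schwartz_lin.
Qed.

Lemma schwartzZ a f : schwartz f -> schwartz (a *: f).
Proof.
move=> [f1 f2]; rewrite /schwartz.
rewrite -[fun z => complex.Re ((a *: f) z)]/(re (a *: f)) -[fun z => complex.Im ((a *: f) z)]/(im (a *: f)).
by rewrite reZ imZ; split; exact: real_schwartz_lin.
Qed.

End Spin.

(** Expansions are indexed by natural numbers, eigenvectors by an integer level and a degeneracy
    index. *)
Lemma int_nat_enum : exists e : nat -> int * nat,
  injective e /\ forall i, exists n, e n = i.
Proof.
have : ([set: int * nat] #= [set: nat])%card.
  apply: eq_card_nat; first exact: countableP.
  have inf : infinite_set [set: nat] by exact: infinite_nat.
  move=> fin; apply: inf.
  have := finite_image (fun z : int * nat => z.2) fin.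
  apply: sub_finite_set => n _; by exists (0, n).
move=> /card_set_bijP[g]; rewrite setTT_bijective => -[e ge eg]; exists e; split.
  exact: can_inj eg.
by move=> i; exists (g i).
Qed.

(** The modulus of [psi0] is the Gaussian, whose square is at least [exp (- 2 p)] on the unit
    square, a set of measure 1. *)
Lemma gauss_sqr_pos (R : realType) (p q : R) : 0 < p ->
  0 < complex.Re (sinner (psi0 p q) (psi0 p q)).
Proof.
move=> p0.
have [h1 h2] := schwartz_sL2 (hermite_schwartz p0 (hermite_psi0 p q)).
have i1 := L2r_integrableM h1 h1; have i2 := L2r_integrableM h2 h2.
rewrite /= -RintegralD //.
have -> : \int[lebesgue2]_z (re (psi0 p q) z * re (psi0 p q) z + im (psi0 p q) z * im (psi0 p q) z) =
    \int[lebesgue2]_z (gauss p z * gauss p z).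
  apply: eq_Rintegral => z _; rewrite re_psi0 im_psi0.
  rewrite -[RHS]mul1r -(cos2Dsin2 (phase q z)); ring.
have ig : (@lebesgue2 R).-integrable setT (EFin \o (fun z => gauss p z * gauss p z)).
  have := integrableD measurableT i1 i2; apply: eq_integrable => // z _ /=.
  rewrite -EFinD re_psi0 im_psi0; congr EFin.
  rewrite -[RHS]mul1r -(cos2Dsin2 (phase q z)); ring.
have cg := @continuous_gauss R p.
pose S : set (plane R) := `[0, 1]%classic `*` `[0, 1]%classic.
have mS : measurable S by apply: measurableX; exact: measurable_itv.
have g0 z : (0 <= (gauss p z * gauss p z)%:E)%E by rewrite lee_fin mulr_ge0 ?expR_ge0.
pose e := expR (- (2 * p)).
have Se : (e%:E * lebesgue2 S <= \int[lebesgue2]_(z in S) (gauss p z * gauss p z)%:E)%E.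
  rewrite -integral_cst //; apply: ge0_le_integral => //.
  - by move=> z _; rewrite lee_fin expR_ge0.
  - by apply: (measurable_funS measurableT) => //; case/integrableP: ig.
  move=> z /= -[]; rewrite /= !in_itv /= => /andP[z1 z1'] /andP[z2 z2'].
  rewrite lee_fin /gauss -expRD ler_expR.
  have : z.1 ^+ 2 <= 1 by rewrite expr_le1.
  have : z.2 ^+ 2 <= 1 by rewrite expr_le1.
  by nra.
have S1 : lebesgue2 S = 1%E.
  have E := @product_measure1E _ _ _ _ _ (@lebesgue_measure R) (@lebesgue_measure R)
    _ _ (measurable_itv `[0%R, 1%R]) (measurable_itv `[0%R, 1%R]).
  apply: eq_trans E _.
  by rewrite /= lebesgue_measure_itv /= lte_fin ltr01 oppr0 adde0 mul1e.
rewrite -lte_fin /Rintegral fineK; last exact: integrable_fin_num.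
apply: lt_le_trans (_ : e%:E <= _)%E; first by rewrite lte_fin expR_gt0.
rewrite -[leLHS]mule1 -S1; apply: le_trans Se _.
apply: ge0_subset_integral => //.
by case/integrableP: ig.
Qed.

(** * Eigenvectors of the Dirac operator *)

Section LandauDirac.
Context {R : realType}.
Variables a b c d : R.
Hypothesis det1 : a * d - b * c = 1.
Implicit Types (f g : scalar_field R) (u v : spinor R).

Local Notation A := (lowerX a b c d).
Local Notation A' := (raiseX a b c d).
Local Notation landau := (landau a b c d).

Definition landau_dirac (u : spinor R) : spinor R :=
  spin (A' (component 1 u)) (A (component 0 u)).

Definition landau_core (u v : spinor R) : Prop := schwartz_spinor u /\ v = landau_dirac u.

Lemma schwartz_spinL2 u : schwartz_spinor u -> L2 u.
Proof. by move=> uS k; exact: schwartz_sL2. Qed.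

Lemma landau_core_L2 u v : landau_core u v -> L2 u /\ L2 v.
Proof.
move=> [uS ->]; split; first exact: schwartz_spinL2.
by apply: spinL2; exact: linop_sL2.
Qed.

Lemma landau_core_lin x u v (u' v' : spinor R) : landau_core u v -> landau_core u' v' ->
  landau_core (x *: u + u') (x *: v + v').
Proof.
move=> [uS ->] [uS' ->]; split.
  by move=> k; rewrite componentD componentZ; apply: schwartzD => //; exact: schwartzZ.
have h k := schwartz_sdiff (uS k); have h' k := schwartz_sdiff (uS' k).
have hZ k := schwartz_sdiff (schwartzZ x (uS k)).
apply: spin_ext; rewrite !componentD componentZ !(component_spin0, component_spin1).
  by rewrite componentD componentZ /raiseX linopD // linopZ.
by rewrite componentD componentZ /lowerX linopD // linopZ.
Qed.

Lemma landau_core0 : landau_core 0 0.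
Proof.
have S0 : schwartz_spinor (0 : spinor R).
  move=> k; rewrite component0 -(scale0r (landau 0 0)); apply: schwartzZ.
  exact: landau_schwartz.
split=> //; have := landau_core_lin (-1) (conj S0 erefl) (conj S0 erefl).
by rewrite !scaleN1r !addNr => -[].
Qed.

Lemma lowerX_adjoint f g : schwartz f -> schwartz g ->
  sinner (A f) g = sinner f (A' g).
Proof. by move=> fS gS; rewrite sinnerJ -raiseX_adjoint // -sinnerJ. Qed.

Lemma landau_core_sym u v (u' v' : spinor R) : landau_core u v -> landau_core u' v' ->
  inner v u' = inner u v'.
Proof.
move=> /[dup] /landau_core_L2[uL vL] [uS vE] /[dup] /landau_core_L2[uL' vL'] [uS' vE'].
rewrite !inner2 // vE vE' !component_spin0 !component_spin1.
rewrite (raiseX_adjoint _ _ _ _ (uS 1) (uS' 0)) (lowerX_adjoint (uS 0) (uS' 1)).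
exact: addrC.
Qed.

(** The sign of [k] chooses between the two square roots, so a single family covers 0 and both
    signs. *)
Definition landau_level (k : int) : R := (sgz k)%:~R * Num.sqrt (`|k|%N%:R).

(** At level 0 the predecessor is again 0, but the zero coefficient removes the second component:
    these are the zero modes. *)
Definition landau_state (i : int * nat) : spinor R :=
  spin (landau `|i.1|%N i.2) ((landau_level i.1)%:C *: landau `|i.1|.-1%N i.2).

Lemma landau_level_sqr k : landau_level k * landau_level k = (`|k|%N)%:R.
Proof.
rewrite /landau_level; case: k => [[|n]|n] /=; first by rewrite !mul0r.
  by rewrite !mul1r -expr2 sqr_sqrtr.
by rewrite rmorphN !mulN1r mulrNN -expr2 sqr_sqrtr.
Qed.

Lemma landau_levelN k : landau_level (- k) = - landau_level k.
Proof. by rewrite /landau_level sgzN abszN rmorphN mulNr. Qed.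

Lemma landau_core_state i : landau_core (landau_state i)
  ((landau_level i.1)%:C *: landau_state i).
Proof.
case: i => k n; set l := landau_level k; have S m := landau_schwartz det1 m n.
split.
  apply: ord2_ind; rewrite ?component_spin0 ?component_spin1 //; exact: schwartzZ.
apply: spin_ext; rewrite componentZ /landau_dirac !component_spin0 !component_spin1 /=.
  rewrite /raiseX linopZ; last exact: schwartz_sdiff.
  rewrite -/(A' _) raiseX_landau; rewrite -/l /l; case: k {l} => -[|m] //.
  by rewrite /landau_level /= mul0r !scale0r.
rewrite lowerX_landau // scalerA; congr (_ *: _).
by rewrite -rmorphM landau_level_sqr rmorph_nat.
Qed.

Lemma landau_state_L2 i : L2 (landau_state i).
Proof. exact: (landau_core_L2 (landau_core_state i)).1. Qed.

Lemma landau_state_orth i j : i != j -> inner (landau_state i) (landau_state j) = 0.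
Proof.
case: i j => k n [k' n'] ij.
have S m m' := schwartz_sL2 (landau_schwartz det1 m m').
rewrite inner2; [|exact: landau_state_L2..].
rewrite !component_spin0 !component_spin1 /= sinnerZl ?sinnerZr //; last exact: sL2Z.
rewrite !landau_ip //.
have [nn|nn] := eqVneq n n'; last by rewrite !andbF !(mul0r, mulr0) addr0.
rewrite !andbT; have [kk|kk] := eqVneq `|k|%N `|k'|%N.
  (* Opposite levels: with [m] the common absolute value, the second components contribute
     [- m (m - 1)! n!], which cancels the [m! n!] of the first ones. *)
  have k'E : k' = - k.
    have [k'k|//] : k' = k \/ k' = - k by clear -kk; lia.
    by move: ij; rewrite k'k nn eqxx.
  have k0 : k != 0 by apply: contraNneq ij => k0; rewrite k'E k0 oppr0 nn.
  have h : (landau_level k)%:C * (landau_level k')%:C = - (`|k|%N%:R : R[i]).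
    by rewrite k'E landau_levelN -rmorphM mulrN landau_level_sqr rmorphN rmorph_nat.
  rewrite -kk eqxx conjc_real mulrA h mulNr !mul1r.
  have : (0 < `|k|)%N by rewrite absz_gt0.
  by case: `|k|%N => [//|m] _ /=; rewrite factS -mulnA natrM -mulrA subrr.
rewrite !mul0r add0r.
(* Distinct absolute values with equal predecessors are 0 and 1, and the level 0 kills the term. *)
have [kk'|_] := eqVneq `|k|.-1 `|k'|.-1; last by rewrite !(mul0r, mulr0).
have : landau_level k = 0 \/ landau_level k' = 0.
  have z m : `|m|%N = 0%N -> landau_level m = 0.
    by move=> /eqP; rewrite absz_eq0 => /eqP ->; rewrite /landau_level mul0r.
  have [h|h] : `|k|%N = 0%N \/ `|k'|%N = 0%N by clear -kk kk'; lia.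
    by left; exact: z.
  by right; exact: z.
by move=> [] ->; rewrite ?conjc0 ?(mul0r, mulr0).
Qed.

Lemma landau_state_norm i : 0 < complex.Re (inner (landau_state i) (landau_state i)).
Proof.
case: i => k n; have S m m' := schwartz_sL2 (landau_schwartz det1 m m').
rewrite inner2; [|exact: landau_state_L2..].
have -> : component 0 (landau_state (k, n)) = landau `|k|%N n by exact: component_spin0.
rewrite ReD ltr_wpDr ?sinner_ge0 // landau_ip // !eqxx /= mul1r.
have := gauss_sqr_pos (twist a b c d) (width_gt0 det1).
set G := sinner _ _; case: G => x y /= x0.
rewrite -[X in (X * _)](rmorph_nat (real_complex R)) ReZ /=.
by rewrite mulr_gt0 // ltr0n muln_gt0 !fact_gt0.
Qed.

(** Levels [k] and [- k] differ by the sign of the second component: adding their relations isolates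
    the first component, after which the nonzero level [m.+1] gives the second. *)
Lemma landau_state_total u : L2 u -> (forall i, inner (landau_state i) u = 0) ->
  inner u u = 0.
Proof.
move=> uL u0; have S m m' := schwartz_sL2 (landau_schwartz det1 m m').
have E k n : sinner (landau `|k|%N n) (component 0 u) +
    (landau_level k)%:C * sinner (landau `|k|.-1%N n) (component 1 u) = 0.
  rewrite -(u0 (k, n)) inner2 //; last exact: landau_state_L2.
  by rewrite component_spin0 component_spin1 sinnerZl ?conjc_real //; exact: uL.
have E0 m n : sinner (landau m n) (component 0 u) = 0.
  have := E m n; have := E (- m%:Z) n; rewrite abszN !absz_nat landau_levelN rmorphN mulNr.
  move: (sinner _ _) (_ * _) => x y h1 h2.
  have : 2 * x = (x - y) + (x + y) by ring.
  by rewrite h1 h2 addr0 => /eqP; rewrite mulf_eq0 pnatr_eq0 => /eqP.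
have E1 m n : sinner (landau m n) (component 1 u) = 0.
  have := E m.+1 n; rewrite absz_nat E0 add0r => /eqP; rewrite mulf_eq0 => /orP[|/eqP//].
  by rewrite /landau_level /= mul1r => /eqP[] /eqP; rewrite sqrtr_eq0 leNgt ltr0n.
by rewrite inner2 // !(landau_total det1) ?addr0 //; exact: uL.
Qed.

End LandauDirac.

Lemma orthonormal_dist (R : realType) (V : lmodType R[i]) (P : V -> Prop) (ip : V -> V -> R[i]) x y :
  hilbert P ip -> P x -> P y -> ip_norm ip x = 1 -> ip_norm ip y = 1 -> ip x y = 0 ->
  ip_norm ip (x - y) ^+ 2 = 2.
Proof.
move=> hP Px Py x1 y1 xy; rewrite (ip_norm_sqrD hP Px (hilbertN hP Py)).
by rewrite (ip_normN hP) // (ipNr hP) // xy x1 y1 oppr0 mulr0 addr0 expr1n.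
Qed.

Lemma close_points (R : realType) (x y1 y2 : R) :
  y1 < 1 / 2 -> y2 < 1 / 2 -> 0 <= x -> x ^+ 2 = 2 -> x <= y1 + y2 -> False.
Proof. by move=> h1 h2 x0 x2 xy; have x1 : x < 1; [lra|nra]. Qed.

(** * Convergence and null sets for spinors *)

Section Closure.
Context {R : realType}.
Implicit Types (u v w : spinor R) (A : spinor R -> spinor R -> Prop).

Lemma L2_cvgE (f : nat -> spinor R) u : (forall n, L2 (f n)) -> L2 u ->
  L2_cvg f u <-> ip_norm inner (f n - u) @[n --> \oo] --> 0.
Proof.
move=> fL uL; rewrite /L2_cvg.
have -> : (fun n => L2norm (f n - u)) = (fun n => (ip_norm inner (f n - u))%:E).
  by apply/funext => n; rewrite L2normE //; exact: L2B.
split=> [/fine_cvg//|h].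
by apply: cvg_EFin => //; exact: nearW.
Qed.

Lemma op_closureE A u v : (forall f g, A f g -> L2 f /\ L2 g) ->
  op_closure A u v <-> graph_closure (@L2 R) inner A u v.
Proof.
move=> AL; split=> -[uL vL [f [g [Afg fu gv]]]].
  have fL n := (AL _ _ (Afg n)).1; have gL n := (AL _ _ (Afg n)).2.
  exact: And3 uL vL (ex_intro _ f (ex_intro _ g
    (And3 Afg ((L2_cvgE fL uL).1 fu) ((L2_cvgE gL vL).1 gv)))).
have fL n := (AL _ _ (Afg n)).1; have gL n := (AL _ _ (Afg n)).2.
exact: And3 uL vL (ex_intro _ f (ex_intro _ g
  (And3 Afg ((L2_cvgE fL uL).2 fu) ((L2_cvgE gL vL).2 gv)))).
Qed.

Lemma op_closure_sub A u v : (forall f g, A f g -> L2 f /\ L2 g) -> A u v -> op_closure A u v.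
Proof.
move=> AL Auv; have [uL vL] := AL _ _ Auv.
have cst0 w : L2 w -> L2_cvg (fun=> w) w.
  move=> wL; apply: (L2_cvgE (fun=> wL) wL).2; rewrite subrr (ip_norm0 L2_hilbert).
  exact: cvg_cst.
exact: And3 uL vL (ex_intro _ (fun=> u) (ex_intro _ (fun=> v)
  (And3 (fun=> Auv) (cst0 u uL) (cst0 v vL)))).
Qed.

(** Meant for linear independence modulo null sets: pairing a relation that holds almost everywhere
    with a basis vector extracts a coefficient. *)
Lemma inner_ae0 u w : L2 u -> L2 w -> {ae @lebesgue2 R, forall z, w z = 0} -> inner u w = 0.
Proof.
move=> uL wL w0.
have aeS (P Q : plane R -> Prop) : (forall z, P z -> Q z) ->
    {ae @lebesgue2 R, forall z, P z} -> {ae @lebesgue2 R, forall z, Q z}.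
  move=> PQ [N [mN N0 sN]]; exists N; split=> // z nQ; apply: sN => Pz.
  by apply: nQ; exact: PQ.
have r0 (f g : R * R -> R) : f \in Lfun (@lebesgue2 R) 2%:E -> g \in Lfun (@lebesgue2 R) 2%:E ->
    {ae @lebesgue2 R, forall z, g z = 0} -> rip f g = 0.
  move=> fL gL g0; rewrite /rip /Rintegral.
  rewrite (@ae_eq_integral _ _ _ _ setT (cst 0%E)) ?integral0 //.
    have /integrableP[mfg _] := L2r_integrableM fL gL; exact: mfg.
  by apply: aeS g0 => z gz _ /=; rewrite gz mulr0.
have s0 k : sinner (component k u) (component k w) = 0.
  have [u1 u2] := uL k; have [w1 w2] := wL k.
  have c1 : {ae @lebesgue2 R, forall z, re (component k w) z = 0}.
    by apply: aeS w0 => z wz; rewrite /re /component wz mxE.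
  have c2 : {ae @lebesgue2 R, forall z, im (component k w) z = 0}.
    by apply: aeS w0 => z wz; rewrite /im /component wz mxE.
  by rewrite /sinner !r0 // subr0 addr0.
by rewrite inner2 // !s0 addr0.
Qed.

End Closure.

(** * Spectrum, eigenspaces and resolvent *)

Section LandauSpectrum.
Context {R : realType}.
Variables a b c d : R.
Hypothesis det1 : a * d - b * c = 1.
Local Notation state := (landau_state a b c d).
Local Notation level := (@landau_level R).
Local Notation core := (landau_core a b c d).
Local Notation nrm := (ip_norm (@inner R)).
Local Notation D := (op_closure core).
Let hP := @L2_hilbert R.

Lemma state_norm_gt0 i : 0 < nrm (state i).
Proof. by rewrite sqrtr_gt0; exact: landau_state_norm. Qed.

Definition unit_state i : spinor R := (nrm (state i))^-1%:C *: state i.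

Lemma unit_state_L2 i : L2 (unit_state i).
Proof. by apply: L2Z; exact: landau_state_L2. Qed.

Lemma unit_state_ip i j : inner (unit_state i) (unit_state j) = (i == j)%:R.
Proof.
have [iL jL] := (landau_state_L2 det1 i, landau_state_L2 det1 j).
rewrite (ipZl hP) ?(ipZr hP) //; last exact: unit_state_L2.
have [<-|ij] := eqVneq i j; last by rewrite landau_state_orth // !mulr0.
rewrite (ipxx hP) // conjc_real -!rmorphM; congr (_%:C).
by field; rewrite gt_eqF // state_norm_gt0.
Qed.

Lemma core_unit_state i : core (unit_state i) ((level i.1)%:C *: unit_state i).
Proof.
have := landau_core_lin ((nrm (state i))^-1%:C) (landau_core_state det1 i) (landau_core0 det1).
by rewrite !addr0 /unit_state !scalerA mulrC.
Qed.

Lemma unit_state_total u : L2 u -> (forall i, inner (unit_state i) u = 0) -> nrm u = 0.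
Proof.
move=> uL u0; rewrite /ip_norm (landau_state_total det1) ?sqrtr0 // => i.
have := u0 i; rewrite (ipZl hP) //; last exact: landau_state_L2.
move/eqP; rewrite mulf_eq0 conjc_real => /orP[|/eqP//].
by rewrite -normc_eq0 normc_real normr_eq0 invr_eq0 gt_eqF // state_norm_gt0.
Qed.

Local Notation GC := (graph_closure (@L2 R) inner core).

Lemma landau_closure :
  [/\ forall u v, GC u v <-> [/\ L2 u, L2 v & forall f g, GC f g -> inner g u = inner f v],
      forall u, L2 u -> exists f g : nat -> spinor R,
        (forall n, GC (f n) (g n)) /\ nrm (f n - u) @[n --> \oo] --> 0 &
      forall (l : R[i]) e, 0 < e -> (forall k, e <= normc ((level k)%:C - l)) ->
        (forall v, L2 v -> exists u, GC u (v + l *: u)) /\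
        (forall v u, L2 v -> GC u (v + l *: u) -> nrm u <= e^-1 * nrm v)].
Proof.
have [e [einj esurj]] := int_nat_enum.
pose phi j := unit_state (e j).
have phiP j : L2 (phi j) by exact: unit_state_L2.
have phiO i j : inner (phi i) (phi j) = (i == j)%:R by rewrite unit_state_ip (inj_eq einj).
have phiT x : L2 x -> (forall j, inner (phi j) x = 0) -> nrm x = 0.
  move=> xL x0; apply: unit_state_total => // i; have [n <-] := esurj i; exact: x0.
have cD f g f' g' : core f g -> core f' g' -> core (f + f') (g + g').
  by move=> h h'; have := landau_core_lin 1 h h'; rewrite !scale1r.
have c0 := landau_core0 det1.
have cZ x f g : core f g -> core (x *: f) (x *: g).
  by move=> h; have := landau_core_lin x h c0; rewrite !addr0.
have cphi j : core (phi j) ((level (e j).1)%:C *: phi j) by exact: core_unit_state.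
have cL f g : core f g -> L2 f /\ L2 g by exact: landau_core_L2.
have cS f g f' g' : core f g -> core f' g' -> inner g f' = inner f g'.
  exact: landau_core_sym.
split.
- exact: (graph_closure_adjoint hP phiP phiO phiT cL c0 cD cZ cphi cS).
- exact: (graph_closure_dense hP phiP phiO phiT cL c0 cD cZ cphi cS).
- move=> l x x0 H; apply: (graph_closure_resolvent hP phiP phiO phiT cL c0 cD cZ cphi cS x0).
  by move=> j; exact: H.
Qed.

Lemma landau_closureE u v : D u v <-> GC u v.
Proof. by apply: op_closureE => f g; exact: landau_core_L2. Qed.

Lemma core_closure_state i : D (unit_state i) ((level i.1)%:C *: unit_state i).
Proof.
apply: op_closure_sub (core_unit_state i) => f g; exact: landau_core_L2.
Qed.

Lemma landau_self_adjoint : self_adjoint D.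
Proof.
have [adj dense _] := landau_closure; have DE := landau_closureE.
split=> [u uL|u v].
  have [f [g [fg fu]]] := dense u uL; exists f, g; split=> [n|]; first exact/DE.
  have fL n : L2 (f n) by have [] := fg n.
  exact: (L2_cvgE fL uL).2 fu.
split=> [/DE /adj [uL vL uv]|[uL vL uv]].
  by split=> // f g /DE; exact: uv.
by apply/DE/adj; split=> // f g /DE; exact: uv.
Qed.

(** The levels have no accumulation point: finitely many come near [l], each at a positive distance,
    and the others stay at distance at least 1. *)
Lemma level_gap (l : R[i]) : (forall k, (level k)%:C != l) ->
  exists2 e : R, 0 < e & forall k, e <= normc ((level k)%:C - l).
Proof.
move=> lk.
have pos k : 0 < normc ((level k)%:C - l).
  by rewrite lt_neqAle normc_ge0 eq_sym normc_eq0 subr_eq0 lk.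
have fin N : exists2 e : R, 0 < e & forall k : int, (`|k| <= N)%N -> e <= normc ((level k)%:C - l).
  elim: N => [|N [e e0 H]].
    by exists (normc ((level 0)%:C - l)) => // k; rewrite leqn0 absz_eq0 => /eqP ->.
  exists (Num.min e (Num.min (normc ((level N.+1)%:C - l)) (normc ((level (- N.+1%:Z))%:C - l)))).
    by rewrite !lt_min e0 !pos.
  move=> k kN; have [kN'|[->|->]] : (`|k| <= N)%N \/ k = N.+1 \/ k = - N.+1%:Z by lia.
  - by rewrite ge_min H.
  - by rewrite !ge_min lexx orbT.
  - by rewrite !ge_min lexx !orbT.
(* If [|k| > (|l| + 1) ^ 2], then [|level k| >= |l| + 1], so [level k] is at distance at least 1
   from [l]. *)
have [e e0 H] := fin (Num.truncn ((normc l + 1) ^+ 2)).+1.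
exists (Num.min e 1); first by rewrite lt_min e0 ltr01.
move=> k; have [/H h|kN] := leqP `|k|%N (Num.truncn ((normc l + 1) ^+ 2)).+1.
  by rewrite ge_min h.
rewrite ge_min; apply/orP; right.
have big : normc l + 1 <= `|level k|.
  rewrite -(@ler_pXn2r _ 2) ?nnegrE ?addr_ge0 ?normc_ge0 // real_normK ?num_real // expr2.
  rewrite [leRHS]expr2 landau_level_sqr -expr2; apply/ltW; apply: lt_trans (truncnS_gt _) _.
  by rewrite ltr_nat.
have := le_normcD ((level k)%:C - l) l; rewrite subrK normc_real; lra.
Qed.

Lemma landau_spectrumP (l : R[i]) : op_spectrum D l <-> exists k, l = (level k)%:C.
Proof.
have DE := landau_closureE; split=> [sl|[k ->] [_ [M HM]]].
  apply: contrapT => nl; apply: sl.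
  have [e e0 gap] : exists2 e : R, 0 < e & forall k, e <= normc ((level k)%:C - l).
    by apply: level_gap => k; apply/eqP => E; apply: nl; exists k.
  have [_ _ /(_ l e e0 gap)[ex bd]] := landau_closure; split.
    by move=> v vL; have [u uv] := ex v vL; exists u; exact/DE.
  exists e^-1 => v u /DE uv; have [uL vuL _] := uv.
  have vL : L2 v by rewrite -[v](addrK (l *: u)); apply: L2B => //; exact: L2Z.
  by rewrite !L2normE // -EFinM lee_fin; exact: bd.
(* At an eigenvalue the resolvent relation sends 0 to an eigenvector, whose norm 1 would be at most
   [M * 0]. *)
have := HM 0 (unit_state (k, 0)).
rewrite /op_resolvent add0r => /(_ (core_closure_state (k, 0))).
rewrite !L2normE; [|exact: L2_0|exact: unit_state_L2].
rewrite (ip_norm0 hP) -EFinM mulr0 lee_fin leNgt.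
by rewrite /ip_norm sqrtr_gt0 unit_state_ip eqxx ltr01.
Qed.

(** The degeneracy index varies at a fixed level; pairing with one of these vectors gives its
    coefficient. *)
Lemma landau_eigenspace k : infinite_dimensional (op_eigenspace D (level k)%:C).
Proof.
move=> N; exists (fun i : 'I_N => unit_state (k, i : nat)); split=> [i|x x0 i].
  exact: (core_closure_state (k, i : nat)).
pose w := \sum_(i < N) x i *: unit_state (k, i : nat).
have termL (j : 'I_N) : L2 (x j *: unit_state (k, j : nat)) by apply: L2Z; exact: unit_state_L2.
have wL : L2 w by apply: (big_ind (@L2 R)) => //; [exact: L2_0|exact: L2D].
have wE z : w z = \sum_i x i *: unit_state (k, i : nat) z.
  by rewrite /w; elim/big_rec2: _ => // j y1 y2 _ <-.
have := inner_ae0 (unit_state_L2 (k, i : nat)) wL.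
have -> : inner (unit_state (k, i : nat)) w = x i.
  have [rL r0] : L2 (\sum_(j < N | j != i) x j *: unit_state (k, j : nat)) /\
      inner (unit_state (k, i : nat)) (\sum_(j < N | j != i) x j *: unit_state (k, j : nat)) = 0.
    apply: (big_ind (fun u => L2 u /\ inner (unit_state (k, i : nat)) u = 0)).
    - by split; [exact: L2_0|rewrite (ip0r hP) //; exact: unit_state_L2].
    - move=> u v [uL u0] [vL v0]; split; first exact: L2D.
      by rewrite (ipDr hP) ?u0 ?v0 ?addr0 //; exact: unit_state_L2.
    - move=> j ji; split=> //; rewrite (ipZr hP); [|exact: unit_state_L2..].
      by rewrite unit_state_ip xpair_eqE eqxx /= eq_sym -[LHS]/(_ * (j == i)%:R) (negbTE ji) mulr0.
  have uL := unit_state_L2 (k, i : nat).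
  rewrite /w (bigD1 i) //= (ipDr hP uL (termL i) rL) r0 addr0 (ipZr hP (x i) uL uL).
  by rewrite unit_state_ip eqxx mulr1.
apply; case: x0 => [M [mM M0 sM]]; exists M; split=> // z nw; apply: sM => x0.
by apply: nw; exact: (eq_trans (wE z) x0).
Qed.

(** The zero modes [z n] satisfy [(D - l) z n = - l z n], so the resolvent sends a bounded sequence
    to them; being orthonormal, they have mutual distance [sqrt 2] and no convergent subsequence. *)
Lemma landau_resolvent_not_compact : ~ has_compact_resolvent D.
Proof.
case=> l _ comp.
pose z n := unit_state (0, n).
have zL n : L2 (z n) by exact: unit_state_L2.
have z1 n : nrm (z n) = 1 by rewrite /ip_norm unit_state_ip eqxx sqrtr1.
have res n : op_resolvent D l (- l *: z n) (z n).
  rewrite /op_resolvent scaleNr addNr.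
  by have := core_closure_state (0, n); rewrite /landau_level /= mul0r scale0r.
have [|k [w [kinc wL lim]]] := comp _ _ res.
  exists (normc l) => n; rewrite L2normE; last exact: L2Z.
  by rewrite (ip_normZ hP) // normcN z1 mulr1.
have {}lim := (L2_cvgE (fun n => zL (k n)) wL).1 lim.
have [N _ HN] : \forall n \near \oo, nrm (z (k n) - w) < 1 / 2.
  by apply: cvgr_lt lim _ _; rewrite divr_gt0.
(* Two terms within [1 / 2] of [w] would be at distance less than 1. *)
have h1 := HN N (leqnn N); have h2 := HN N.+1 (leqnSn N).
have := ip_norm_distD hP (zL (k N)) wL (zL (k N.+1)).
rewrite (ip_norm_distC hP wL) //.
have : nrm (z (k N) - z (k N.+1)) ^+ 2 = 2.
  apply: (orthonormal_dist hP) => //.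
  by rewrite unit_state_ip xpair_eqE eqxx /= ltn_eqF ?kinc.
have := ip_norm_ge0 inner (z (k N) - z (k N.+1)).
exact: (close_points h1 h2).
Qed.

End LandauSpectrum.

Lemma linopE (R : realType) (c1 c2 d1 d2 : R[i]) f z : linop c1 c2 d1 d2 f z =
  c1 * (z.1%:C * f z) + c2 * (z.2%:C * f z) + d1 * cpartial false f z + d2 * cpartial true f z.
Proof. by []. Qed.

Lemma lowerX_value (R : realType) (a b c d : R) f z : lowerX a b c d f z =
  ((Num.sqrt 2)^-1)%:C * ((a * z.2)%:C * f z + (0 +i* - b) * cpartial false f z +
    'i%C * ((c * z.1)%:C * f z + (0 +i* - d) * cpartial true f z)).
Proof.
rewrite /lowerX linopE.
move: (f z) (cpartial false f z) (cpartial true f z) z.1 z.2 (Num.sqrt 2)^-1 => [u1 u2] [v1 v2] [w1 w2] x y t.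
by apply: complex_ext => /=; ring.
Qed.

Lemma raiseX_value (R : realType) (a b c d : R) f z : raiseX a b c d f z =
  ((Num.sqrt 2)^-1)%:C * ((a * z.2)%:C * f z + (0 +i* - b) * cpartial false f z +
    - 'i%C * ((c * z.1)%:C * f z + (0 +i* - d) * cpartial true f z)).
Proof.
rewrite /raiseX linopE.
move: (f z) (cpartial false f z) (cpartial true f z) z.1 z.2 (Num.sqrt 2)^-1 => [u1 u2] [v1 v2] [w1 w2] x y t.
by apply: complex_ext => /=; ring.
Qed.

(** * Identification of the parameters a, b, c, d *)

Section DiracParameters.
Context {R : realType}.
Variables hbar theta B r s : R.

(** The four coefficients are [a], [b], [c], [d] of the ladder construction, in this order; those of
    the momenta include the factor [hbar]. *)
Definition coef_xy : R := (Num.sqrt `|hbar * B|)^-1 * ((1 - r) * hbar * B / (hbar - r * theta * B)).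
Definition coef_xp : R := (Num.sqrt `|hbar * B|)^-1 *
  (((r + s - r * s) * theta * B - hbar) / (r * theta * B - hbar)) * hbar.
Definition coef_yx : R := Num.sg (hbar * B) * (Num.sqrt `|hbar * B|)^-1 * (- r * B).
Definition coef_yp : R := Num.sg (hbar * B) * (Num.sqrt `|hbar * B|)^-1 *
  (1 + r * (s - 1) * (theta * B / hbar)) * hbar.

Lemma tPi_xE f z : tPi_x hbar theta B r s f z =
  (coef_xy * z.2)%:C * f z + (0 +i* - coef_xp) * cpartial false f z.
Proof.
rewrite /tPi_x /Pi_x /p_x /coef_xy /coef_xp.
move: (f z) (cpartial false f z) (_^-1) (_ / _) (_ / _) => [u1 u2] [v1 v2] k x y.
by apply: complex_ext => /=; ring.
Qed.

Lemma tPi_yE f z : tPi_y hbar theta B r s f z =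
  (coef_yx * z.1)%:C * f z + (0 +i* - coef_yp) * cpartial true f z.
Proof.
rewrite /tPi_y /Pi_y /p_y /coef_yx /coef_yp.
move: (f z) (cpartial true f z) (Num.sg _ * _^-1) (1 + _ * _) => [u1 u2] [v1 v2] k x.
by apply: complex_ext => /=; ring.
Qed.

(** This is the relation [[X, Y] = i]. The scalings contribute [sg (hbar B) / |hbar B|], and what
    remains is [hbar] times a bracket of rational functions equal to [B]. *)
Lemma coef_det : hbar <> 0 -> B <> 0 -> hbar - r * theta * B != 0 ->
  coef_xy * coef_yp - coef_xp * coef_yx = 1.
Proof.
move=> /eqP h0 /eqP B0 hr.
have hr' : r * theta * B - hbar != 0 by rewrite -oppr_eq0 opprB.
have hB : hbar * B != 0 by rewrite mulf_neq0.
have k2 : (Num.sqrt `|hbar * B|)^-1 * (Num.sqrt `|hbar * B|)^-1 = `|hbar * B|^-1.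
  by rewrite -invfM -expr2 sqr_sqrtr.
have sgk : Num.sg (hbar * B) * `|hbar * B|^-1 * (hbar * B) = 1.
  rewrite {3}(numEsg (hbar * B)) mulrACA -expr2 sqr_sg hB mul1r mulVf // normr_eq0 //.
rewrite /coef_xy /coef_xp /coef_yx /coef_yp.
set k := (Num.sqrt _)^-1 in k2 *; set sg := Num.sg _ in sgk *.
transitivity (sg * (k * k) * hbar *
  ((1 - r) * hbar * B / (hbar - r * theta * B) * (1 + r * (s - 1) * (theta * B / hbar)) -
   ((r + s - r * s) * theta * B - hbar) / (r * theta * B - hbar) * (- r * B))).
  ring.
rewrite k2 -[LHS]mulrA -[RHS]sgk; congr (_ * _).
by field; rewrite h0 hr hr'.
Qed.

Lemma sigma_mul (F : 'I_2 -> R[i]) : let v := \col_k F k in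
  [/\ (sigma_x *m v) 0 0 = F 1, (sigma_x *m v) 1 0 = F 0,
      (sigma_y *m v) 0 0 = - 'i%C * F 1 & (sigma_y *m v) 1 0 = 'i%C * F 0].
Proof. by split; rewrite mxE sum_ord2 !mxE /= ?mul0r ?mul1r ?add0r ?addr0. Qed.

(** The entries [- i] and [i] of [sigma_y] give [X - i Y] in the upper row and [X + i Y] in the
    lower one. *)
Lemma dirac_exprE u : dirac_expr hbar theta B r s u = landau_dirac coef_xy coef_xp coef_yx coef_yp u.
Proof.
have E k z : component k (dirac_expr hbar theta B r s u) z = ((Num.sqrt 2)^-1)%:C *
    ((sigma_x *m \col_k tPi_x hbar theta B r s (component k u) z) k 0 +
     (sigma_y *m \col_k tPi_y hbar theta B r s (component k u) z) k 0).
  by rewrite /component /dirac_expr /op_tensor mxE; congr (_ * _); rewrite mxE.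
apply: spin_ext; rewrite ?component_spin0 ?component_spin1; apply/funext => z.
  have [X _ _ _] := sigma_mul (fun k => tPi_x hbar theta B r s (component k u) z).
  have [_ _ Y _] := sigma_mul (fun k => tPi_y hbar theta B r s (component k u) z).
  apply: (etrans (E 0 z)).
  rewrite tPi_xE in X; rewrite tPi_yE in Y.
  apply: (etrans (congr1 ( *%R _) (congr2 +%R X Y))).
  exact/esym/raiseX_value.
have [_ X _ _] := sigma_mul (fun k => tPi_x hbar theta B r s (component k u) z).
have [_ _ _ Y] := sigma_mul (fun k => tPi_y hbar theta B r s (component k u) z).
apply: (etrans (E 1 z)).
rewrite tPi_xE in X; rewrite tPi_yE in Y.
apply: (etrans (congr1 ( *%R _) (congr2 +%R X Y))).
exact/esym/lowerX_value.
Qed.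

End DiracParameters.

Theorem lemma3p2 (R : realType) (hbar0 theta0 B0 r s : R)
  (hbar0_neq0 : hbar0 <> 0) (theta0_neq0 : theta0 <> 0) (B0_neq0 : B0 <> 0)
  (hbar0_theta0_B0 : hbar0 - theta0 * B0 <> 0)
  (r_neq : r <> hbar0 / (theta0 * B0)) :
  let D := dirac_op hbar0 theta0 B0 r s in
  [/\ self_adjoint D,
      op_spectrum D = [set 0] `|`
        [set l : R[i] | exists2 n : nat, (0 < n)%N &
           l = (Num.sqrt (n%:R : R))%:C \/ l = - (Num.sqrt (n%:R : R))%:C],
      forall l, op_spectrum D l -> infinite_dimensional (op_eigenspace D l)
    & ~ has_compact_resolvent D].
Proof.
move=> D.
(* The excluded value of [r] is the one at which the denominators in [Pi_x] vanish. *)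
have hr : hbar0 - r * theta0 * B0 != 0.
  apply/eqP => h; apply: r_neq; have /eqP t0 := theta0_neq0; have /eqP b0 := B0_neq0.
  have -> : hbar0 = r * (theta0 * B0) by rewrite mulrA; apply/eqP; rewrite -subr_eq0 h.
  by rewrite mulfK // mulf_neq0.
have det1 := coef_det s hbar0_neq0 B0_neq0 hr.
have DE : D = op_closure (landau_core (coef_xy hbar0 theta0 B0 r) (coef_xp hbar0 theta0 B0 r s)
    (coef_yx hbar0 B0 r) (coef_yp hbar0 theta0 B0 r s)).
  congr op_closure; apply/funext => u; apply/funext => v.
  by rewrite /dirac_core /landau_core dirac_exprE.
rewrite DE; split.
- exact: landau_self_adjoint.
- apply/seteqP; split=> l /=; rewrite landau_spectrumP //.
    (* [Negz n] is [- n.+1], so both signs are labelled by the positive number [n.+1]. *)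
    case=> -[[|n]|n] ->.
    + by left; rewrite /landau_level /= mul0r.
    + by right; exists n.+1 => //; left; rewrite /landau_level /= mul1r.
    + by right; exists n.+1 => //; right; rewrite /landau_level /= rmorphN mulN1r rmorphN.
  case=> [->|[[//|n] _ [->|->]]].
  + by exists 0; rewrite /landau_level /= mul0r.
  + by exists (Posz n.+1); rewrite /landau_level /= mul1r.
  + by exists (Negz n); rewrite /landau_level /= rmorphN mulN1r rmorphN.
- by move=> l /(landau_spectrumP det1)[k ->]; exact: landau_eigenspace.
- exact: landau_resolvent_not_compact.
Qed.
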